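(* Assume that $g_\theta$ and $g_\kappa$ both have radius of convergence $R>0$, with $g_\theta(R)<\infty$, $g_\kappa(R)<\infty$, $g_\kappa^{\{1\}}(R)=1$ and $0<g_\kappa^{\{2\}}(R)<\infty$. Let $f$ be holomorphic in the open disk $|z|<R$ and continuous up to the boundary $|z|=R$. Then, uniformly in $v\in[1,v_0]$ for an arbitrary constant $v_0\ge1$, $$[z^N]\big[f(z)\exp\{vG_N(z)\}\big]\sim\frac{f(r_v)\exp\{vG_N(r_v)\}}{r_v^N\sqrt{2\pi Nv\,b_2(r_v)}},\qquad N\to\infty.$$ In particular, $H_N\sim\dfrac{\exp\{G_N(R)\}}{R^N\sqrt{2\pi Nb_2(R)}}$ as $N\to\infty$.
   Context: $(\theta_j)_{j\ge1}$, $(\kappa_j)_{j\ge1}$ are sequences of nonnegative reals; $g_\theta(z)=\sum_{j\ge1}\theta_jz^j/j$, $g_\kappa(z)=\sum_{j\ge1}\kappa_jz^j/j$, $G_N=g_\theta+Ng_\kappa$, with values at $R$ defined as limits $r\uparrow R$. $[z^N]F(z)$ is the coefficient of $z^N$. $H_N=\frac1{N!}\sum_{\sigma\in S_N}\prod_{j=1}^N(\theta_j+N\kappa_j)^{C_j(\sigma)}$, $C_j(\sigma)$ the number of $j$-cycles of $\sigma$. $g^{\{n\}}(z)=z^ng^{(n)}(z)$, $g_\kappa^{\{n\}}(R):=\lim_{r\uparrow R}g_\kappa^{\{n\}}(r)$. $b_2(r)=g_\kappa^{\{1\}}(r)+g_\kappa^{\{2\}}(r)$. For $v\ge1$, $r_v\in(0,R]$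 is the unique solution of $g_\kappa^{\{1\}}(r)=1/v$ (so $r_1=R$). Standing assumption: $(\kappa_j)$ is non-arithmetic (no integer $j_0>1$ such that $\kappa_j\ne0$ implies $j_0\mid j$) and $\kappa_j>0$ for some $j\ge2$.
   Formalization: The first ''~'' is stated as: the coefficient times r_v^N sqrt(2πNv b_2(r_v))/exp{vG_N(r_v)} minus f(r_v) tends to 0 uniformly in v; this gives the ratio form when f(r_v) is nonzero on [1,v_0], while the ratio form fails if f vanishes at some r_v. *)

(* Defs.v *)
From HB Require Import structures.
From mathcomp Require Import all_boot all_order all_algebra all_fingroup.
From mathcomp Require Import Rstruct.
From Stdlib Require Import Reals ClassicalEpsilon.
From Coquelicot Require Import Coquelicot.

Set Implicit Arguments.
Unset Strict Implicit.
Unset Printing Implicit Defensive.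

Section HN.
Import GRing.Theory.
Local Open Scope ring_scope.
Definition ncycles (N j : nat) (s : {perm 'I_N}) : nat :=
  #|[set X in porbits s | #|X| == j]|.
Definition H_N (theta kappa : nat -> R) (N : nat) : R :=
  (N`!%:R)^-1 * \sum_(s : {perm 'I_N})
     \prod_(1 <= j < N.+1) (theta j + N%:R * kappa j) ^+ ncycles j s.
End HN.

Local Open Scope R_scope.

Definition gcoef (a : nat -> R) (n : nat) : R :=
  match n with O => 0 | S _ => a n / INR n end.

Definition greal (a : nat -> R) (r : R) : R := PSeries (gcoef a) r.
Definition g1real (a : nat -> R) (r : R) : R := r * Derive (greal a) r.
Definition g2real (a : nat -> R) (r : R) : R := r ^ 2 * Derive_n (greal a) 2 r.

(* value of a function on (0,R], the value at R being the given boundary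
   value L (the limit r -> R^-) *)
Definition bval (F : R -> R) (R0 L : R) (r : R) : R :=
  if Rlt_dec r R0 then F r else L.

(* sum of a complex power series (chosen; unique when it converges) *)
Definition Cpsum (a : nat -> C) (z : C) : C :=
  epsilon (inhabits (RtoC 0)) (fun l => is_pseries (K := C_AbsRing) (V := C_NormedModule) a z l).

Definition gcomplex (a : nat -> R) (z : C) : C :=
  Cpsum (fun n => RtoC (gcoef a n)) z.

Definition Cexp (z : C) : C :=
  (exp (fst z) * cos (snd z), exp (fst z) * sin (snd z)).

(* Taylor coefficients at 0 of a function F holomorphic on |z| < R0:
   the (unique) sequence (a_n) with F(z) = sum a_n z^n for |z| < R0;
   [z^N] F = taylor R0 F N *)
Definition taylor (R0 : R) (F : C -> C) : nat -> C :=
  epsilon (inhabits (fun _ => RtoC 0))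
    (fun a => forall z : C, Cmod z < R0 ->
       is_pseries (K := C_AbsRing) (V := C_NormedModule) a z (F z)).

Definition non_arithmetic (k : nat -> R) : Prop :=
  ~ (exists j0 : nat, (1 < j0)%nat /\
       forall j : nat, (1 <= j)%nat -> k j <> 0 -> Nat.divide j0 j).

(* Main.v *)
(** For [r = r_v], the integral of [f(z) exp(v G_N(z)) z^{-N}] over the circle
    [z = r e^{it}], [|t| <= PI], in the variable [t], is [2 PI] times the [N]-th Taylor
    coefficient; on the boundary circle [r = R] this follows by letting [r] increase to [R].
    Since [v g^{1}(r) = 1], the term linear in [t] of the exponent cancels, and the
    exponent is [- N v b_2(r) t^2 / 2 + o(N t^2)], uniformly in [r] because
    [sum n^2 c_n R^n] converges for the coefficients [c_n] of [g_kappa].  Away from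
    [t = 0] non-arithmeticity gives [Re g_kappa(r e^{it}) <= g_kappa(r) - c t^2], so
    only the Gaussian integral survives.  Complex differentiability of [f] without
    continuity of [f'] requires a Goursat argument: [int f(w) dw / (w - z0)] over the
    contracted circles [w = z0 + s (r e^{it} - z0)] does not depend on [s] (by bisection
    in the parameters [(s, t)]), and [s -> 0] gives Cauchy's formula.  For [H_N],
    removing the successor of a marked point from its cycle yields the recurrence
    [n h_n = sum_j x_j h_{n-j}], which the coefficients of [exp (sum_j x_j z^j / j)]
    also satisfy. *)
Require Import Defs.
From Stdlib Require Import Reals Lra Lia Classical ClassicalEpsilon.
From Coquelicot Require Import Coquelicot.
Set Bullet Behavior "Strict Subproofs".
Local Open Scope R_scope.

(** Third moments of [c_n R^n] may diverge, so no cubic Taylor bound is available on the boundary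
    circle. Remainders are kept in the form [x^2 min(1, |x|)]: summed at [x = n t] against [c_n R^n]
    they give [o(t^2)] by dominated convergence. Uniformity in [v] rests on two comparisons: the
    first derivative term at [r] is at most [r / R], which forces [r_v >= R / v0], and [n <= n^2]
    gives [1 <= v b_2(r_v) <= v0 b_2(R)]; so neither the decay constant nor the width of the
    Gaussian degenerates. The decay constant is uniform in [r] without any compactness argument,
    because the integers [d] for which [|sin (d t / 2)|] is at most a constant times the square root
    of [Re (g(r) - g(r e^{it}))] are closed under sums and differences. Nonnegative coefficients
    turn each limit at [R] into the sum of a convergent series, so that the circle of radius [R]
    obeys the same formulas as the inner ones. Moduli of complex integrals and series are bounded
    through components; the resulting factors 2 multiply error terms only. *)

Local Notation is_seriesC := (is_series (K := C_AbsRing) (V := C_NormedModule)) (only parsing).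
Local Notation is_pseriesC := (is_pseries (K := C_AbsRing) (V := C_NormedModule)) (only parsing).
Local Notation RV := R_NormedModule (only parsing).
Local Notation RB := R_CompleteNormedModule (only parsing).
Local Notation sumC := (sum_n (G := C_NormedModule)) (only parsing).

Ltac le_trans_by H := eapply Rle_trans; [apply H|].
Ltac lt_trans_by H := eapply Rle_lt_trans; [apply H|].
Ltac R_ring := match goal with |- @eq _ ?x ?y => change (@eq R x y) end; ring.
Ltac C_ring := match goal with |- @eq _ ?x ?y => change (@eq C x y) end; ring.

Lemma lt_Rmin_l {x a b : R} : x < Rmin a b -> x < a.
Proof. intros H. exact (Rlt_le_trans _ _ _ H (Rmin_l _ _)). Qed.

Lemma lt_Rmin_r {x a b : R} : x < Rmin a b -> x < b.
Proof. intros H. exact (Rlt_le_trans _ _ _ H (Rmin_r _ _)). Qed.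

Lemma ex_series_scal_R (k : R) (a : nat -> R) : ex_series a -> ex_series (fun n => k * a n).
Proof. exact (ex_series_scal (K := R_AbsRing) (V := RV) k a). Qed.

Lemma continuous_of_derive (g : R -> R) (x : R) : ex_derive g x -> continuous g x.
Proof. exact (ex_derive_continuous (V := RV) g x). Qed.

(** * Nonnegative power series at the radius of convergence *)

Lemma sum_n_S (a : nat -> R) (n : nat) : sum_n a (S n) = sum_n a n + a (S n).
Proof. now rewrite sum_Sn. Qed.

Lemma sum_n_cont (a : nat -> R) (N : nat) (x : R) :
  continuous (fun r => sum_n (fun k => a k * r ^ k) N) x.
Proof.
  induction N as [|N IH].
  - apply continuous_ext with (fun _ : R => a 0%nat).
    + intros r. rewrite sum_O. simpl. now rewrite Rmult_1_r.
    + apply continuous_const.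
  - apply continuous_ext with
      (fun r : R => plus (sum_n (fun k => a k * r ^ k) N) (a (S N) * r ^ S N)).
    + intros r. now rewrite sum_Sn.
    + apply (continuous_plus (V := RV)).
      * exact IH.
      * apply continuous_of_derive. auto_derive. trivial.
Qed.

Lemma sum_n_le_Series (b : nat -> R) (N : nat) :
  (forall n, 0 <= b n) -> ex_series b -> sum_n b N <= Series b.
Proof.
  intros Hb Hex.
  apply (is_lim_seq_incr_compare (sum_n b) (Series b)).
  - exact (Series_correct _ Hex).
  - intros n. rewrite sum_n_S. specialize (Hb (S n)). lra.
Qed.

Lemma term_le_Series (b : nat -> R) (n : nat) :
  (forall n, 0 <= b n) -> ex_series b -> b n <= Series b.
Proof.
  intros Hb Hex.
  apply Rle_trans with (sum_n b n); [|now apply sum_n_le_Series].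
  destruct n as [|n].
  - rewrite sum_O. lra.
  - rewrite sum_n_S.
    assert (0 <= sum_n b n); [|lra].
    clear Hex. induction n as [|n IH].
    + rewrite sum_O. apply Hb.
    + rewrite sum_n_S. specialize (Hb (S n)). lra.
Qed.

Lemma Series_nonneg (b : nat -> R) :
  (forall n, 0 <= b n) -> ex_series b -> 0 <= Series b.
Proof.
  intros Hb Hex. apply Rle_trans with (b 0%nat); [apply Hb|].
  now apply term_le_Series.
Qed.

Lemma ex_series_nonneg_bounded (b : nat -> R) (M : R) :
  (forall n, 0 <= b n) -> (forall n, sum_n b n <= M) -> ex_series b.
Proof.
  intros Hb HM.
  destruct (ex_finite_lim_seq_incr (sum_n b) M) as [l Hl].
  - intros n. rewrite sum_n_S. specialize (Hb (S n)). lra.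
  - exact HM.
  - exists l. exact Hl.
Qed.

Lemma ex_series_dominated (a b : nat -> R) :
  (forall n, Rabs (a n) <= b n) -> ex_series b -> ex_series a.
Proof.
  exact (ex_series_le (K := R_AbsRing) (V := RB) a b).
Qed.

Lemma Rabs_Series_le (a b : nat -> R) :
  (forall n, Rabs (a n) <= b n) -> ex_series b -> Rabs (Series a) <= Series b.
Proof.
  intros Hab Hb.
  apply Rle_trans with (Series (fun n => Rabs (a n))).
  - apply Series_Rabs. apply ex_series_dominated with b; [|exact Hb].
    intros n. now rewrite Rabs_Rabsolu.
  - apply Series_le; [|exact Hb]. intros n. split; [apply Rabs_pos|apply Hab].
Qed.

Lemma PSeries_sum (a : nat -> R) (r : R) : PSeries a r = Series (fun n => a n * r ^ n).
Proof. reflexivity. Qed.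


(** Monotone convergence takes the place of Abel's theorem: a partial sum is continuous at [R0] and
    below [PSeries a r] for [r < R0], hence at most [L]; so the series converges at [R0], and its
    sum dominates every [PSeries a r], hence [L]. *)
Lemma abel_nonneg (a : nat -> R) (R0 L : R) :
  0 < R0 -> (forall n, 0 <= a n) -> CV_radius a = Finite R0 ->
  filterlim (PSeries a) (at_left R0) (locally L) ->
  is_series (fun n => a n * R0 ^ n) L.
Proof.
  intros HR Ha Hrad Hlim.
  assert (Hin : at_left R0 (fun r => 0 < r < R0)).
  { exists (mkposreal R0 HR). intros y Hy Hlt. simpl in Hy.
    unfold ball in Hy; simpl in Hy. unfold AbsRing_ball, abs, minus, plus, opp in Hy; simpl in Hy.
    apply Rabs_lt_between in Hy. lra. }
  assert (Hexr : forall r, 0 < r < R0 -> ex_series (fun n => a n * r ^ n)).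
  { intros r Hr. apply ex_series_Rabs. apply CV_disk_inside. rewrite Hrad.
    simpl. rewrite Rabs_pos_eq; lra. }
  assert (Hpos : forall r, 0 <= r -> forall n, 0 <= a n * r ^ n).
  { intros r Hr n. apply Rmult_le_pos; [apply Ha|]. now apply pow_le. }
  assert (Hpart : forall N, sum_n (fun n => a n * R0 ^ n) N <= L).
  { intros N.
    apply (filterlim_le (F := at_left R0)
      (fun r => sum_n (fun k => a k * r ^ k) N) (PSeries a)
      (Finite (sum_n (fun n => a n * R0 ^ n) N)) (Finite L)).
    - revert Hin. apply filter_imp. intros r Hr. rewrite PSeries_sum.
      apply sum_n_le_Series; [apply Hpos; lra|now apply Hexr].
    - apply (filterlim_filter_le_1 (F := locally R0)).
      + intros P HP. unfold at_left, within.
        revert HP. apply filter_imp. intros y Hy _. exact Hy.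
      + exact (sum_n_cont a N R0).
    - exact Hlim. }
  assert (Hex : ex_series (fun n => a n * R0 ^ n)).
  { apply ex_series_nonneg_bounded with L; [apply Hpos; lra|exact Hpart]. }
  replace L with (Series (fun n => a n * R0 ^ n)); [now apply Series_correct|].
  apply Rle_antisym.
  - apply (is_lim_seq_le (sum_n (fun n => a n * R0 ^ n)) (fun _ => L)
      (Series (fun n => a n * R0 ^ n)) L Hpart).
    + exact (Series_correct _ Hex).
    + apply is_lim_seq_const.
  - apply (filterlim_le (F := at_left R0)
      (PSeries a) (fun _ => Series (fun n => a n * R0 ^ n)) (Finite L)
      (Finite (Series (fun n => a n * R0 ^ n)))).
    + revert Hin. apply filter_imp. intros r Hr. rewrite PSeries_sum.
      apply Series_le; [|exact Hex]. intros n. split; [apply Hpos; lra|].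
      apply Rmult_le_compat_l; [apply Ha|]. apply pow_incr. lra.
    + exact Hlim.
    + apply filterlim_const.
Qed.

Lemma Rmin_1_bounds (n : nat) (tau : R) : 0 <= tau -> 0 <= Rmin 1 (INR n * tau) <= 1.
Proof.
  intros Ht. split; [|apply Rmin_l]. apply Rmin_glb; [lra|]. apply Rmult_le_pos; [apply pos_INR|exact Ht].
Qed.

Lemma ex_series_modulus (M : nat -> R) (tau : R) :
  (forall n, 0 <= M n) -> ex_series M -> 0 <= tau -> ex_series (fun n => M n * Rmin 1 (INR n * tau)).
Proof.
  intros HM Hex Ht. apply ex_series_dominated with M; [|exact Hex]. intros n.
  assert (H := Rmin_1_bounds n tau Ht). specialize (HM n).
  rewrite Rabs_pos_eq by (apply Rmult_le_pos; lra). nra.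
Qed.

(** Dominated convergence made elementary: up to a cut-off [n0] the minimum is at most [n tau],
    beyond it at most 1, so the sum is at most [tau K] plus a tail of [M]. It serves where the
    moment with one more factor [n] may diverge. *)
Lemma modulus_small (M : nat -> R) :
  (forall n, 0 <= M n) -> ex_series M -> forall eta, 0 < eta ->
  exists delta, 0 < delta /\ forall tau, 0 <= tau < delta ->
    Series (fun n => M n * Rmin 1 (INR n * tau)) <= eta.
Proof.
  intros HM Hex eta Heta.
  assert (Hlim : is_lim_seq (sum_n M) (Series M)) by exact (Series_correct _ Hex).
  assert (He2 : 0 < eta / 2) by lra.
  apply is_lim_seq_spec in Hlim. destruct (Hlim (mkposreal _ He2)) as [n0 Hn0].
  specialize (Hn0 n0 (le_n _)). simpl in Hn0.
  set (K := sum_n (fun n => INR n * M n) n0).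
  assert (HK : 0 <= K).
  { unfold K. clear -HM. induction n0 as [|n IH].
    - rewrite sum_O. simpl. lra.
    - rewrite sum_Sn. unfold plus; simpl plus.
      assert (0 <= INR (S n) * M (S n)) by (apply Rmult_le_pos; [apply pos_INR|apply HM]).
      simpl in *. lra. }
  exists (eta / 2 / (K + 1)). split; [apply Rdiv_lt_0_compat; lra|].
  intros tau Ht.
  assert (Hle : forall N, (n0 <= N)%nat ->
    sum_n (fun n => M n * Rmin 1 (INR n * tau)) N <= tau * K + (sum_n M N - sum_n M n0)).
  { intros N HN. induction HN as [|N HN IH].
    - unfold Rminus. rewrite Rplus_opp_r, Rplus_0_r. unfold K. assert (Ht0 : 0 <= tau) by lra. clear -HM Ht0.
      induction n0 as [|n IH].
      + rewrite !sum_O. simpl. rewrite Rmult_0_l.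
        rewrite Rmin_right by lra. lra.
      + rewrite !sum_n_S.
        assert (M (S n) * Rmin 1 (INR (S n) * tau) <= M (S n) * (INR (S n) * tau)).
        { apply Rmult_le_compat_l; [apply HM|apply Rmin_r]. }
        lra.
    - rewrite !sum_n_S.
      assert (M (S N) * Rmin 1 (INR (S N) * tau) <= M (S N) * 1).
      { apply Rmult_le_compat_l; [apply HM|apply Rmin_l]. }
      lra. }
  assert (Hexm := ex_series_modulus M tau HM Hex (proj1 Ht)).
  assert (HtK : tau * K <= eta / 2).
  { apply Rle_trans with (eta / 2 / (K + 1) * (K + 1)).
    - apply Rmult_le_compat; lra.
    - right. field. lra. }
  apply (is_lim_seq_le_loc (sum_n (fun n => M n * Rmin 1 (INR n * tau))) (fun _ => eta)
    (Series (fun n => M n * Rmin 1 (INR n * tau))) eta).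
  - exists n0. intros N HN. specialize (Hle N HN).
    assert (sum_n M N <= Series M) by now apply sum_n_le_Series.
    apply Rabs_lt_between in Hn0. lra.
  - exact (Series_correct _ Hexm).
  - apply is_lim_seq_const.
Qed.

(** * Decay of the real part away from the positive axis *)

(** The bounds on [sin] and [cos] below climb one degree at a time through this lemma: each
    inequality is the sign of the derivative needed for the next. *)
Lemma nonneg_of_derive (f df : R -> R) (x : R) :
  (forall y, 0 <= y -> is_derive f y (df y)) -> (forall y, 0 <= y -> 0 <= df y) ->
  0 <= f 0 -> 0 <= x -> 0 <= f x.
Proof.
  intros Hd Hp H0 Hx.
  destruct (MVT_gen f 0 x df) as [c [Hc Heq]].
  - intros y Hy. apply Hd. rewrite Rmin_left in Hy by lra. lra.
  - intros y Hy. rewrite Rmin_left in Hy by lra.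
    apply continuity_pt_filterlim.
    apply continuous_of_derive. eexists. apply Hd. lra.
  - rewrite Rmin_left in Hc by lra.
    assert (0 <= df c * (x - 0)) by (apply Rmult_le_pos; [apply Hp|]; lra). lra.
Qed.

Lemma sin_le_id (x : R) : 0 <= x -> sin x <= x.
Proof.
  intros [Hx|<-]; [left; now apply sin_lt_x|]. rewrite sin_0. lra.
Qed.

Lemma cos_ge_parabola (x : R) : 1 - x ^ 2 / 2 <= cos x.
Proof.
  assert (H : forall y, 0 <= y -> 1 - y ^ 2 / 2 <= cos y).
  { intros y Hy.
    enough (0 <= cos y - (1 - y ^ 2 / 2)) by lra.
    apply (nonneg_of_derive (fun y => cos y - (1 - y ^ 2 / 2)) (fun y => y - sin y)).
    - intros z _. auto_derive; [trivial|]. field.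
    - intros z Hz. generalize (sin_le_id z Hz). lra.
    - rewrite cos_0. lra.
    - exact Hy. }
  destruct (Rle_dec 0 x) as [Hx|Hx]; [now apply H|].
  rewrite <- cos_neg. replace (x ^ 2) with ((- x) ^ 2) by ring. apply H. lra.
Qed.

Lemma sin_ge_cubic (x : R) : 0 <= x -> x - x ^ 3 / 6 <= sin x.
Proof.
  intros Hx. enough (0 <= sin x - (x - x ^ 3 / 6)) by lra.
  apply (nonneg_of_derive (fun y => sin y - (y - y ^ 3 / 6)) (fun y => cos y - (1 - y ^ 2 / 2))).
  - intros z _. auto_derive; [trivial|]. field.
  - intros z _. generalize (cos_ge_parabola z). lra.
  - rewrite sin_0. lra.
  - exact Hx.
Qed.

Lemma cos_le_quartic (x : R) : cos x <= 1 - x ^ 2 / 2 + x ^ 4 / 24.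
Proof.
  assert (H : forall y, 0 <= y -> cos y <= 1 - y ^ 2 / 2 + y ^ 4 / 24).
  { intros y Hy.
    enough (0 <= 1 - y ^ 2 / 2 + y ^ 4 / 24 - cos y) by lra.
    apply (nonneg_of_derive (fun y => 1 - y ^ 2 / 2 + y ^ 4 / 24 - cos y)
             (fun y => sin y - (y - y ^ 3 / 6))).
    - intros z _. auto_derive; [trivial|]. field.
    - intros z Hz. generalize (sin_ge_cubic z Hz). lra.
    - rewrite cos_0. lra.
    - exact Hy. }
  destruct (Rle_dec 0 x) as [Hx|Hx]; [now apply H|].
  rewrite <- cos_neg. replace (x ^ 2) with ((- x) ^ 2) by ring.
  replace (x ^ 4) with ((- x) ^ 4) by ring. apply H. lra.
Qed.

Lemma Rabs_sq (x : R) : x ^ 2 = Rabs x ^ 2.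
Proof. now rewrite pow2_abs. Qed.

(** The quartic bound serves for [|x| < 1], boundedness of [cos] otherwise. The factor [min(1, |x|)]
    in place of a higher power is what makes a finite second moment sufficient. *)
Lemma cos_taylor2 (x : R) : Rabs (cos x - 1 + x ^ 2 / 2) <= 2 * x ^ 2 * Rmin 1 (Rabs x).
Proof.
  assert (H1 := cos_ge_parabola x). assert (H2 := cos_le_quartic x).
  assert (H3 := COS_bound x).
  rewrite Rabs_pos_eq by lra.
  rewrite Rabs_sq in *. replace (x ^ 4) with (Rabs x ^ 4) in H2.
  2:{ replace (x ^ 4) with ((x ^ 2) ^ 2) by ring. rewrite (Rabs_sq x). ring. }
  generalize (Rabs_pos x). set (y := Rabs x) in *. clearbody y. intros Hy.
  unfold Rmin. destruct (Rle_dec 1 y).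
  - nra.
  - assert (y ^ 4 <= y ^ 3). { replace (y ^ 4) with (y ^ 3 * y) by ring.
      assert (0 <= y ^ 3) by now apply pow_le. nra. }
    assert (0 <= y ^ 3) by now apply pow_le.
    replace (2 * y ^ 2 * y) with (2 * y ^ 3) by ring. lra.
Qed.

Lemma sin_taylor1 (x : R) : Rabs (sin x - x) <= 2 * x ^ 2 * Rmin 1 (Rabs x).
Proof.
  assert (H : forall y, 0 <= y -> Rabs (sin y - y) <= 2 * y ^ 2 * Rmin 1 y).
  { intros y Hy. assert (H1 := sin_le_id y Hy). assert (H2 := sin_ge_cubic y Hy).
    assert (H3 := SIN_bound y).
    rewrite Rabs_left1 by lra. unfold Rmin. destruct (Rle_dec 1 y).
    - nra.
    - assert (0 <= y ^ 3) by now apply pow_le.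
      replace (2 * y ^ 2 * y) with (2 * y ^ 3) by ring. lra. }
  destruct (Rle_dec 0 x) as [Hx|Hx].
  - rewrite (Rabs_pos_eq x) by lra. now apply H.
  - rewrite (Rabs_left1 x) by lra. rewrite <- Rabs_Ropp.
    replace (- (sin x - x)) with (sin (- x) - (- x)) by (rewrite sin_neg; ring).
    replace (x ^ 2) with ((- x) ^ 2) by ring. apply H. lra.
Qed.

(** For [x^2 <= 4] the minorant [x - x^3 / 6] is at least [x / 3]. The interval contains [PI / 2]
    already by the crude bound [PI <= 4]. *)
Lemma sin_ge_third (x : R) : 0 <= x <= 2 -> x / 3 <= sin x.
Proof.
  intros Hx. apply Rle_trans with (x - x ^ 3 / 6); [|apply sin_ge_cubic; lra].
  nra.
Qed.

Lemma Rabs_sin_half_ge (t : R) : Rabs t <= PI -> Rabs t / 6 <= Rabs (sin (t / 2)).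
Proof.
  intros Ht. assert (HPI := PI_4).
  assert (H : forall y, 0 <= y <= PI -> y / 6 <= Rabs (sin (y / 2))).
  { intros y Hy. apply Rle_trans with (sin (y / 2)); [|apply Rle_abs].
    apply Rle_trans with (y / 2 / 3); [lra|]. apply sin_ge_third. lra. }
  destruct (Rle_dec 0 t) as [H0|H0].
  - rewrite (Rabs_pos_eq t) in * by lra. apply H. lra.
  - rewrite (Rabs_left1 t) in * by lra.
    replace (t / 2) with (- (- t / 2)) by field. rewrite sin_neg, Rabs_Ropp.
    apply H. lra.
Qed.

Lemma one_minus_cos (x : R) : 1 - cos x = 2 * sin (x / 2) ^ 2.
Proof.
  replace x with (2 * (x / 2)) at 1 by field. rewrite cos_2a_sin. ring.
Qed.

(** This subadditivity lets bounds for [sin (a t / 2)] and [sin (b t / 2)] pass to the indices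
    [a + b] and [a - b]. *)
Lemma Rabs_sin_plus (a b : R) : Rabs (sin (a + b)) <= Rabs (sin a) + Rabs (sin b).
Proof.
  rewrite sin_plus. le_trans_by Rabs_triang.
  rewrite !Rabs_mult.
  assert (Rabs (cos a) <= 1) by (apply Rabs_le; apply COS_bound).
  assert (Rabs (cos b) <= 1) by (apply Rabs_le; apply COS_bound).
  generalize (Rabs_pos (sin a)) (Rabs_pos (sin b)). nra.
Qed.

Lemma least_positive (P : nat -> Prop) (n : nat) :
  (0 < n)%nat -> P n ->
  exists d, (0 < d)%nat /\ P d /\ forall m, (0 < m < d)%nat -> ~ P m.
Proof.
  revert P. induction n as [n IH] using Wf_nat.lt_wf_ind. intros P Hn HP.
  destruct (classic (exists m, (0 < m < n)%nat /\ P m)) as [[m [Hm HPm]]|Hno].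
  - destruct (IH m (proj2 Hm) P (proj1 Hm) HPm) as [d Hd]. now exists d.
  - exists n. split; [exact Hn|split; [exact HP|]]. intros m Hm HPm. apply Hno. now exists m.
Qed.

(* A set of naturals closed under sums and differences consists of multiples of
   its least positive element; membership here plays the role of a Bezout
   combination of indices [j] with [kappa j <> 0]. *)
Lemma non_arithmetic_generates (k : nat -> R) (P : nat -> Prop) :
  non_arithmetic k ->
  (exists j, (2 <= j)%nat /\ 0 < k j) ->
  (forall a b, P a -> P b -> P (a + b)%nat) ->
  (forall a b, (b <= a)%nat -> P a -> P b -> P (a - b)%nat) ->
  (forall j, (1 <= j)%nat -> k j <> 0 -> P j) -> P 1%nat.
Proof.
  intros Hna [j0 [Hj0 Hkj0]] Hadd Hsub Hgen.
  destruct (least_positive P j0) as [d [Hd [HPd Hmin]]]; [lia|apply Hgen; [lia|lra]|].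
  destruct (Nat.eq_dec d 1) as [->|Hd1]; [exact HPd|].
  exfalso. apply Hna. exists d.
  split; [apply (ssrbool.introT ssrnat.leP); lia|]. intros j Hj Hkj.
  apply (ssrbool.elimT ssrnat.leP) in Hj.
  assert (HPj := Hgen j Hj Hkj).
  assert (H0 : P 0%nat).
  { replace 0%nat with (d - d)%nat by lia. now apply Hsub. }
  assert (Hmul : forall q, P (q * d)%nat).
  { induction q as [|q IHq]; [exact H0|]. replace (S q * d)%nat with (d + q * d)%nat by lia. now apply Hadd. }
  assert (Hdiv := Nat.div_mod j d ltac:(lia)).
  assert (Hmod : P (j mod d)).
  { replace (j mod d) with (j - j / d * d)%nat by lia. apply Hsub; [lia|exact HPj|apply Hmul]. }
  assert (Hlt := Nat.mod_upper_bound j d ltac:(lia)).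
  destruct (Nat.eq_dec (j mod d) 0) as [Hz|Hnz].
  - exists (j / d)%nat. lia.
  - exfalso. apply (Hmin (j mod d)); [lia|exact Hmod].
Qed.

Lemma ex_series_pow_le (a : nat -> R) (R0 r : R) :
  (forall n, 0 <= a n) -> ex_series (fun n => a n * R0 ^ n) -> 0 <= r <= R0 ->
  ex_series (fun n => a n * r ^ n).
Proof.
  intros Ha Hex Hr. apply ex_series_dominated with (fun n => a n * R0 ^ n); [|exact Hex].
  intros n. rewrite Rabs_pos_eq.
  - apply Rmult_le_compat_l; [apply Ha|]. now apply pow_incr.
  - apply Rmult_le_pos; [apply Ha|]. now apply pow_le.
Qed.

Lemma gcoef_nonneg (a : nat -> R) :
  (forall j, (1 <= j)%nat -> 0 <= a j) -> forall n, 0 <= gcoef a n.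
Proof.
  intros Ha [|n]; cbn -[INR]; [lra|].
  apply Rdiv_le_0_compat; [apply Ha; lia|]. apply lt_0_INR. lia.
Qed.

(** The sum is [Re (g(r) - g(r e^{it}))]; a single [j] with [k j <> 0] makes it control
    [sin^2 (j t / 2)]. Such control passes to sums and differences of indices, so it reaches the
    index 1, where [|sin (t / 2)| >= |t| / 6]. The condition [r >= r0] keeps [c_j r^j] away from
    0. *)
Lemma real_part_decay (k : nat -> R) (R0 r0 : R) :
  (forall j, (1 <= j)%nat -> 0 <= k j) -> non_arithmetic k ->
  (exists j, (2 <= j)%nat /\ 0 < k j) ->
  ex_series (fun n => gcoef k n * R0 ^ n) -> 0 < r0 <= R0 ->
  exists c, 0 < c /\ forall r t, r0 <= r <= R0 -> Rabs t <= PI ->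
    c * t ^ 2 <= Series (fun n => gcoef k n * r ^ n * (1 - cos (INR n * t))).
Proof.
  intros Hk Hna Hk2 Hex Hr0.
  set (Phi := fun r t => Series (fun n => gcoef k n * r ^ n * (1 - cos (INR n * t)))).
  assert (Hc := gcoef_nonneg k Hk).
  assert (Hpos : forall r t n, r0 <= r <= R0 -> 0 <= gcoef k n * r ^ n * (1 - cos (INR n * t))).
  { intros r t n Hr. apply Rmult_le_pos.
    - apply Rmult_le_pos; [apply Hc|]. apply pow_le. lra.
    - generalize (COS_bound (INR n * t)). lra. }
  assert (Hsum : forall r t, r0 <= r <= R0 -> ex_series (fun n => gcoef k n * r ^ n * (1 - cos (INR n * t)))).
  { intros r t Hr.
    apply ex_series_dominated with (fun n => 2 * (gcoef k n * r ^ n)).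
    - intros n. rewrite Rabs_pos_eq by now apply Hpos.
      rewrite Rmult_comm. apply Rmult_le_compat_r.
      + apply Rmult_le_pos; [apply Hc|]. apply pow_le. lra.
      + generalize (COS_bound (INR n * t)). lra.
    - apply ex_series_scal_R.
      apply ex_series_pow_le with R0; [exact Hc|exact Hex|lra]. }
  (* [C] may depend on [d] but not on [r] or [t]; the uniformity of the final constant comes from
     here. *)
  set (P := fun d : nat => exists C, 0 <= C /\ forall r t, r0 <= r <= R0 ->
    Rabs (sin (INR d * t / 2)) <= C * sqrt (Phi r t)).
  assert (HP1 : P 1%nat).
  { apply (non_arithmetic_generates k P Hna Hk2).
    - intros a b [Ca [HCa Ha]] [Cb [HCb Hb]]. exists (Ca + Cb). split; [lra|].
      intros r t Hr. specialize (Ha r t Hr). specialize (Hb r t Hr).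
      rewrite plus_INR. replace ((INR a + INR b) * t / 2) with (INR a * t / 2 + INR b * t / 2) by field.
      le_trans_by Rabs_sin_plus. lra.
    - intros a b Hab [Ca [HCa Ha]] [Cb [HCb Hb]]. exists (Ca + Cb). split; [lra|].
      intros r t Hr. specialize (Ha r t Hr). specialize (Hb r t Hr).
      rewrite minus_INR by exact Hab.
      replace ((INR a - INR b) * t / 2) with (INR a * t / 2 + - (INR b * t / 2)) by field.
      le_trans_by Rabs_sin_plus. rewrite sin_neg, Rabs_Ropp. lra.
    - intros j Hj Hkj.
      assert (Hcj : 0 < gcoef k j * r0 ^ j).
      { apply Rmult_lt_0_compat; [|apply pow_lt; lra].
        destruct j as [|j]; [lia|]. cbn -[INR]. apply Rdiv_lt_0_compat; [|apply lt_0_INR; lia].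
        specialize (Hk (S j) Hj). lra. }
      (* The term of index [j] is [2 c_j r^j sin^2 (j t / 2)], and [r0 ^ j <= r ^ j]. *)
      exists (sqrt (/ (gcoef k j * r0 ^ j))). split; [apply sqrt_pos|].
      intros r t Hr. rewrite <- sqrt_mult_alt.
      2:{ left. now apply Rinv_0_lt_compat. }
      rewrite <- sqrt_Rsqr_abs. apply sqrt_le_1_alt.
      apply Rmult_le_reg_l with (gcoef k j * r0 ^ j); [exact Hcj|].
      rewrite <- Rmult_assoc, Rinv_r, Rmult_1_l by lra.
      eapply Rle_trans; [|apply (term_le_Series _ j (fun n => Hpos r t n Hr) (Hsum r t Hr))].
      cbn beta. rewrite one_minus_cos. unfold Rsqr.
      assert (gcoef k j * r0 ^ j <= gcoef k j * r ^ j).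
      { apply Rmult_le_compat_l; [apply Hc|]. apply pow_incr. lra. }
      set (s := sin (INR j * t / 2)). assert (0 <= s * s) by nra. nra. }
  destruct HP1 as [C [HC HC1]].
  (* The square of [6 (C + 1)]: 6 comes from [Rabs_sin_half_ge], and [C + 1] replaces [C], which may
     be 0. *)
  exists (/ (36 * (C + 1) ^ 2)). split; [apply Rinv_0_lt_compat; nra|].
  intros r t Hr Ht. fold (Phi r t).
  assert (HPhi : 0 <= Phi r t) by (apply Series_nonneg; [intros n; now apply Hpos|now apply Hsum]).
  assert (H1 := Rabs_sin_half_ge t Ht). specialize (HC1 r t Hr).
  simpl INR in HC1. rewrite Rmult_1_l in HC1.
  assert (Hs := sqrt_pos (Phi r t)). assert (Hss := sqrt_sqrt _ HPhi).
  set (s := sqrt (Phi r t)) in *.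
  assert (H2 : Rabs t <= 6 * (C + 1) * s) by nra.
  rewrite <- Hss. apply Rmult_le_reg_l with (36 * (C + 1) ^ 2); [nra|].
  rewrite <- Rmult_assoc, Rinv_r, Rmult_1_l by nra.
  rewrite <- pow2_abs. assert (Hat := Rabs_pos t).
  replace (36 * (C + 1) ^ 2 * (s * s)) with ((6 * (C + 1) * s) ^ 2) by ring.
  now apply pow_incr.
Qed.

(** * The Gaussian integral *)

Lemma ex_RInt_of_derive (g : R -> R) (a b : R) : (forall x, ex_derive g x) -> ex_RInt g a b.
Proof.
  intros Hg. apply (ex_RInt_continuous (V := RB)). intros x _. now apply continuous_of_derive.
Qed.

Local Notation gaussian B := (fun t : R => exp (- (B * t ^ 2))) (only parsing).

Lemma continuous_exp_sq (c x : R) : continuous (gaussian c) x.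
Proof.
  apply continuous_of_derive. auto_derive. trivial.
Qed.

Lemma ex_RInt_exp_sq (c a b : R) : ex_RInt (gaussian c) a b.
Proof.
  apply ex_RInt_of_derive. intros x. auto_derive. trivial.
Qed.

Definition gauss (x : R) : R := RInt (gaussian 1) 0 x.

Lemma is_derive_gauss (x : R) : is_derive gauss x (exp (- x ^ 2)).
Proof.
  replace (exp (- x ^ 2)) with (exp (- (1 * x ^ 2))) by (f_equal; ring).
  apply (is_derive_RInt (V := RV) (gaussian 1) gauss 0 x).
  - exists (mkposreal 1 Rlt_0_1). intros y _. apply (RInt_correct (V := RB)).
    apply ex_RInt_exp_sq.
  - apply continuous_exp_sq.
Qed.

(** The companion integral of a classical trick: its derivative is opposite to that of [gauss ^ 2],
    so the Gaussian integral is found without a double integral. *)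
Definition gauss_aux (x : R) : R := RInt (fun t => exp (- (x ^ 2 * (1 + t ^ 2))) / (1 + t ^ 2)) 0 1.

Lemma ex_RInt_gauss_aux (x a b : R) :
  ex_RInt (fun t => exp (- (x ^ 2 * (1 + t ^ 2))) / (1 + t ^ 2)) a b.
Proof.
  apply ex_RInt_of_derive. intros x'. auto_derive. nra.
Qed.

Lemma is_derive_gauss_aux (x : R) :
  is_derive gauss_aux x (- 2 * exp (- x ^ 2) * gauss x).
Proof.
  assert (Hd : forall u v, is_derive (fun z => exp (- (z ^ 2 * (1 + v ^ 2))) / (1 + v ^ 2)) u
    (- 2 * u * exp (- (u ^ 2 * (1 + v ^ 2))))).
  { intros u v. auto_derive; [nra|]. simpl. field. nra. }
  assert (Hder : forall u v, Derive (fun z => exp (- (z ^ 2 * (1 + v ^ 2))) / (1 + v ^ 2)) u =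
    - 2 * u * exp (- (u ^ 2 * (1 + v ^ 2)))).
  { intros. apply is_derive_unique. apply Hd. }
  replace (- 2 * exp (- x ^ 2) * gauss x) with
    (RInt (fun t => Derive (fun z => exp (- (z ^ 2 * (1 + t ^ 2))) / (1 + t ^ 2)) x) 0 1).
  - apply is_derive_RInt_param.
    + exists (mkposreal 1 Rlt_0_1). intros y _ t _. eexists. apply Hd.
    + intros t _. apply continuity_2d_pt_ext with (fun u v => - 2 * u * exp (- (u ^ 2 * (1 + v ^ 2)))).
      * intros. now rewrite Hder.
      * apply continuity_2d_pt_mult.
        -- apply continuity_2d_pt_mult; [apply continuity_2d_pt_const|apply continuity_2d_pt_id1].
        -- apply (continuity_1d_2d_pt_comp exp).
           ++ apply derivable_continuous_pt, derivable_pt_exp.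
           ++ apply continuity_2d_pt_opp. apply continuity_2d_pt_mult.
              ** apply (continuity_1d_2d_pt_comp (fun z => z ^ 2)).
                 --- apply derivable_continuous_pt. apply derivable_pt_pow.
                 --- apply continuity_2d_pt_id1.
              ** apply continuity_2d_pt_plus; [apply continuity_2d_pt_const|].
                 apply (continuity_1d_2d_pt_comp (fun z => z ^ 2)).
                 --- apply derivable_continuous_pt. apply derivable_pt_pow.
                 --- apply continuity_2d_pt_id2.
    + exists (mkposreal 1 Rlt_0_1). intros y _. apply ex_RInt_gauss_aux.
  (* Since [exp (- x^2 (1 + t^2)) = exp (- x^2) exp (- (x t)^2)], the substitution of [x t] turns
     the integral into [gauss x]. *)
  - transitivity (RInt (fun t => scal (- 2 * exp (- x ^ 2)) (scal x (exp (- (1 * (x * t + 0) ^ 2))))) 0 1).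
    + apply RInt_ext. intros t _. rewrite Hder. unfold scal; simpl; unfold mult; simpl.
      replace (- (x * (x * 1) * (1 + t * (t * 1)))) with
        (- (x * (x * 1)) + - (1 * ((x * t + 0) * ((x * t + 0) * 1)))) by ring.
      rewrite exp_plus. ring.
    + rewrite (RInt_scal (V := RB)).
      2:{ apply (ex_RInt_comp_lin (V := RV) (gaussian 1)). apply ex_RInt_exp_sq. }
      rewrite (RInt_comp_lin (V := RB) (gaussian 1)).
      2:{ apply ex_RInt_exp_sq. }
      unfold gauss, scal; simpl; unfold mult; simpl. f_equal. f_equal; ring.
Qed.

Lemma gauss_aux_bound (x : R) : 0 <= gauss_aux x <= exp (- x ^ 2).
Proof.
  assert (Hc : exp (- x ^ 2) = RInt (fun _ => exp (- x ^ 2)) 0 1).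
  { rewrite RInt_const. unfold scal; simpl; unfold mult; simpl. ring. }
  split.
  - apply RInt_ge_0; [lra|apply ex_RInt_gauss_aux|]. intros t _.
    left. apply Rdiv_lt_0_compat; [apply exp_pos|nra].
  - rewrite Hc. apply RInt_le; [lra|apply ex_RInt_gauss_aux|apply ex_RInt_const|].
    intros t Ht. apply Rmult_le_reg_r with (1 + t ^ 2); [nra|].
    unfold Rdiv. rewrite Rmult_assoc, Rinv_l, Rmult_1_r by nra.
    apply Rle_trans with (exp (- x ^ 2)).
    + assert (H : - (x ^ 2 * (1 + t ^ 2)) <= - x ^ 2) by (generalize (pow2_ge_0 x) (pow2_ge_0 t); nra).
      destruct H as [H|H]; [left; now apply exp_increasing|rewrite H; lra].
    + generalize (exp_pos (- x ^ 2)) (pow2_ge_0 t). nra.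
Qed.

(** The derivative of the left side vanishes, and its value at 0 is [atan 1]. *)
Lemma gauss_identity (x : R) : 0 <= x -> gauss x ^ 2 + gauss_aux x = PI / 4.
Proof.
  intros Hx.
  assert (Hd : forall y, is_derive (fun z => gauss z ^ 2 + gauss_aux z) y 0).
  { intros y. evar_last.
    - apply (is_derive_plus (V := RV) (fun z => gauss z ^ 2) gauss_aux).
      + apply (is_derive_pow gauss 2 y). apply is_derive_gauss.
      + apply is_derive_gauss_aux.
    - unfold plus; simpl. ring. }
  assert (H0 : gauss 0 ^ 2 + gauss_aux 0 = PI / 4).
  { unfold gauss. rewrite RInt_point. unfold zero; simpl.
    unfold gauss_aux. rewrite (RInt_ext _ (fun t => / (1 + t ^ 2))).
    - rewrite (is_RInt_unique _ 0 1 (minus (atan 1) (atan 0))).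
      + rewrite atan_0, atan_1. unfold minus, plus, opp; simpl. ring.
      + apply (is_RInt_derive (V := RB) atan).
        * intros t _. auto_derive; [trivial|]. simpl. field. nra.
        * intros t _. apply continuous_of_derive. auto_derive. nra.
    - intros t _. rewrite (pow_ne_zero 2) by lia.
      rewrite Rmult_0_l, Ropp_0, exp_0. apply Rmult_1_l. }
  rewrite <- H0.
  destruct (MVT_gen (fun z => gauss z ^ 2 + gauss_aux z) 0 x (fun _ => 0)) as [c [_ Hc]].
  - intros; apply Hd.
  - intros y _. apply continuity_pt_filterlim.
    apply (continuous_of_derive (fun z => gauss z ^ 2 + gauss_aux z)).
    eexists; apply Hd.
  - lra.
Qed.

Lemma gauss_pos (x : R) : 0 <= x -> 0 <= gauss x.
Proof.
  intros Hx. apply RInt_ge_0; [exact Hx|apply ex_RInt_exp_sq|]. intros. left. apply exp_pos.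
Qed.

Lemma gauss_opp (x : R) : gauss (- x) = - gauss x.
Proof.
  unfold gauss.
  replace (- x) with (-1 * x + 0) by ring. replace 0 with (-1 * 0 + 0) at 1 by ring.
  rewrite <- (RInt_comp_lin (V := RB) (gaussian 1)).
  2:{ apply ex_RInt_exp_sq. }
  rewrite (RInt_ext _ (fun t => opp (exp (- (1 * t ^ 2))))).
  - rewrite (RInt_opp (V := RB)); [reflexivity|apply ex_RInt_exp_sq].
  - intros t _. replace ((-1 * t + 0) ^ 2) with (t ^ 2) by ring.
    unfold scal, opp; simpl; unfold mult; simpl. lra.
Qed.

Lemma RInt_exp_sq_scaled (B T : R) : 0 < B ->
  RInt (gaussian B) (- T) T = 2 * gauss (sqrt B * T) / sqrt B.
Proof.
  intros HB. assert (Hs := sqrt_lt_R0 B HB).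
  assert (Hss := sqrt_sqrt B (Rlt_le _ _ HB)).
  assert (H := RInt_comp_lin (V := RB) (gaussian 1)
    (sqrt B) 0 (- T) T (ex_RInt_exp_sq _ _ _)).
  rewrite (RInt_scal (V := RB)) in H.
  2:{ apply ex_RInt_of_derive. intros x'. auto_derive. trivial. }
  rewrite (RInt_ext _ (gaussian B)) in H.
  2:{ intros t _. f_equal. f_equal. rewrite <- Hss at 2. ring. }
  unfold scal in H; simpl in H; unfold mult in H; simpl in H.
  rewrite !Rplus_0_r in H.
  rewrite <- (RInt_Chasles (V := RB) _ (sqrt B * - T) 0 (sqrt B * T)) in H
    by apply ex_RInt_exp_sq.
  rewrite <- (opp_RInt_swap (V := RB) _ 0 (sqrt B * - T)) in H by apply ex_RInt_exp_sq.
  change (sqrt B * RInt (gaussian B) (- T) T =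
    - gauss (sqrt B * - T) + gauss (sqrt B * T)) in H.
  replace (sqrt B * - T) with (- (sqrt B * T)) in H by ring. rewrite gauss_opp in H.
  apply Rmult_eq_reg_l with (sqrt B); [|lra]. rewrite H. field. lra.
Qed.

Lemma gaussian_integral_eq (B T : R) : 0 < B ->
  sqrt (B / PI) * RInt (gaussian B) (- T) T = 2 * gauss (sqrt B * T) / sqrt PI.
Proof.
  intros HB. rewrite RInt_exp_sq_scaled by exact HB.
  assert (HPI := PI_RGT_0). assert (Hs := sqrt_lt_R0 B HB). assert (Hsp := sqrt_lt_R0 PI HPI).
  rewrite sqrt_div_alt by lra. field. lra.
Qed.

Lemma gaussian_integral_le (B T : R) : 0 < B -> 0 <= T ->
  sqrt (B / PI) * RInt (gaussian B) (- T) T <= 1.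
Proof.
  intros HB HT. rewrite gaussian_integral_eq by exact HB.
  assert (HPI := PI_RGT_0). assert (Hs := sqrt_lt_R0 B HB).
  assert (Hsp := sqrt_lt_R0 PI HPI). assert (Hspp := sqrt_sqrt PI (Rlt_le _ _ HPI)).
  assert (Hx : 0 <= sqrt B * T) by (apply Rmult_le_pos; lra).
  assert (H := gauss_identity _ Hx). assert (Hb := gauss_aux_bound (sqrt B * T)).
  assert (Hg := gauss_pos _ Hx). apply Rle_div_l; nra.
Qed.

(** With [x = sqrt B T], the square of the normalised integral is [1 - 4 gauss_aux x / PI], and a
    number in [[0, 1]] is at least its square. The weak tail [exp (- x^2) <= 1 / x^2] suffices, as
    an error [O(1 / N)] is all that is wanted. *)
Lemma gaussian_integral_ge (B T : R) : 0 < B -> 0 < T ->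
  1 - 2 / (B * T ^ 2) <= sqrt (B / PI) * RInt (gaussian B) (- T) T.
Proof.
  intros HB HT. rewrite gaussian_integral_eq by exact HB.
  assert (HPI := PI_RGT_0). assert (Hs := sqrt_lt_R0 B HB).
  assert (Hsp := sqrt_lt_R0 PI HPI). assert (Hspp := sqrt_sqrt PI (Rlt_le _ _ HPI)).
  assert (HPI2 : 2 <= PI) by (generalize PI2_1; lra).
  assert (Hx : 0 < sqrt B * T) by (apply Rmult_lt_0_compat; lra).
  replace (B * T ^ 2) with ((sqrt B * T) ^ 2) by (rewrite <- (sqrt_sqrt B) at 2; [ring|lra]).
  set (x := sqrt B * T) in *. assert (Hx0 : 0 <= x) by lra.
  assert (H := gauss_identity x Hx0). assert (Hb := gauss_aux_bound x).
  assert (Hg := gauss_pos x Hx0).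
  assert (He : exp (- x ^ 2) <= / x ^ 2).
  { rewrite exp_Ropp. apply Rinv_le_contravar; [nra|].
    generalize (exp_ineq1_le (x ^ 2)). nra. }
  set (u := 2 * gauss x / sqrt PI).
  assert (Hu : 0 <= u).
  { apply Rmult_le_pos; [lra|]. left. now apply Rinv_0_lt_compat. }
  assert (Hu2 : u * u = 1 - 4 * gauss_aux x / PI).
  { unfold u. replace (2 * gauss x / sqrt PI * (2 * gauss x / sqrt PI)) with (4 * gauss x ^ 2 / (sqrt PI * sqrt PI)) by (field; lra).
    rewrite Hspp. replace (gauss x ^ 2) with (PI / 4 - gauss_aux x) by lra. field. lra. }
  assert (Hk : 4 * gauss_aux x / PI <= 2 / x ^ 2).
  { apply Rle_trans with (2 * gauss_aux x).
    - apply Rle_div_l; nra.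
    - unfold Rdiv. lra. }
  assert (Hk0 : 0 <= 4 * gauss_aux x / PI).
  { apply Rmult_le_pos; [lra|]. left. now apply Rinv_0_lt_compat. }
  nra.
Qed.

(** * Integrals of complex-valued paths *)

Lemma Cmod_le_abs (z : C) : Cmod z <= Rabs (fst z) + Rabs (snd z).
Proof.
  unfold Cmod. assert (H1 := Rabs_pos (fst z)). assert (H2 := Rabs_pos (snd z)).
  rewrite <- (sqrt_pow2 (Rabs (fst z) + Rabs (snd z))) by lra.
  apply sqrt_le_1_alt. rewrite (Rabs_sq (fst z)), (Rabs_sq (snd z)). nra.
Qed.

Lemma Rabs_fst_le_Cmod (z : C) : Rabs (fst z) <= Cmod z.
Proof. eapply Rle_trans; [apply Rmax_l|apply Rmax_Cmod]. Qed.

Lemma Rabs_snd_le_Cmod (z : C) : Rabs (snd z) <= Cmod z.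
Proof. eapply Rle_trans; [apply Rmax_r|apply Rmax_Cmod]. Qed.

Lemma Rabs_fst_minus (x y : C) : Rabs (fst x - fst y) <= Cmod (x - y).
Proof. exact (Rabs_fst_le_Cmod (x - y)). Qed.

Lemma Rabs_snd_minus (x y : C) : Rabs (snd x - snd y) <= Cmod (x - y).
Proof. exact (Rabs_snd_le_Cmod (x - y)). Qed.

Lemma Cmod_minus_le_abs (x y : C) : Cmod (x - y) <= Rabs (fst x - fst y) + Rabs (snd x - snd y).
Proof. exact (Cmod_le_abs (x - y)). Qed.

Lemma Cmod_triangle_minus (x y : C) : Cmod (x - y) <= Cmod x + Cmod y.
Proof. unfold Cminus. le_trans_by Cmod_triangle. rewrite Cmod_opp. lra. Qed.

Lemma Cmod_triangle_rev (x y : C) : Cmod x - Cmod y <= Cmod (x - y).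
Proof.
  assert (H := Cmod_triangle (x - y) y). replace (x - y + y)%C with x in H by ring. lra.
Qed.

Lemma Cmod_eps_0 (z : C) (K : R) : (forall eps, 0 < eps -> Cmod z <= K * eps) -> z = 0%C.
Proof.
  intros H. apply Cmod_eq_0. apply Rle_antisym; [|apply Cmod_ge_0].
  apply le_epsilon. intros eps Heps.
  assert (HK := Rabs_pos K).
  specialize (H (eps / (Rabs K + 1)) ltac:(apply Rdiv_lt_0_compat; lra)).
  eapply Rle_trans; [exact H|]. rewrite Rplus_0_l.
  apply Rle_trans with (Rabs K * (eps / (Rabs K + 1))).
  - apply Rmult_le_compat_r; [|apply Rle_abs]. left. apply Rdiv_lt_0_compat; lra.
  - apply Rmult_le_reg_r with (Rabs K + 1); [lra|].
    replace (Rabs K * (eps / (Rabs K + 1)) * (Rabs K + 1)) with (Rabs K * eps) by (field; lra). nra.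
Qed.

Lemma Cmod_scale (x : R) (z : C) : 0 <= x -> Cmod (x * z) = x * Cmod z.
Proof. intros Hx. now rewrite Cmod_mult, Cmod_R, Rabs_pos_eq. Qed.

(** Continuity of the two components, so that the integration theory of real functions applies
    directly; [pcont_eps] is the equivalent form with the modulus. *)
Definition pcont (h : R -> C) (t : R) : Prop :=
  continuous (fun s => fst (h s)) t /\ continuous (fun s => snd (h s)) t.

Lemma continuous_eps (g : R -> R) (t : R) :
  continuous g t <-> forall eps, 0 < eps -> exists delta, 0 < delta /\
    forall s, Rabs (s - t) < delta -> Rabs (g s - g t) < eps.
Proof.
  split.
  - intros H eps Heps. apply continuity_pt_filterlim in H.
    destruct (H eps Heps) as [d [Hd H1]]. exists d. split; [exact Hd|].
    intros s Hs. destruct (Req_dec s t) as [->|Hne].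
    + rewrite Rminus_diag, Rabs_R0. exact Heps.
    + apply (H1 s). split; [|exact Hs]. split; [exact I|]. now apply not_eq_sym.
  - intros H. apply continuity_pt_filterlim. intros eps Heps.
    destruct (H eps Heps) as [d [Hd H1]]. exists d. split; [exact Hd|].
    intros s [_ Hs]. apply H1. exact Hs.
Qed.

Lemma pcont_eps (h : R -> C) (t : R) :
  pcont h t <-> forall eps, 0 < eps -> exists delta, 0 < delta /\
    forall s, Rabs (s - t) < delta -> Cmod (h s - h t) < eps.
Proof.
  unfold pcont. rewrite !continuous_eps. split.
  - intros [H1 H2] eps Heps.
    destruct (H1 (eps / 2) ltac:(lra)) as [d1 [Hd1 H1']].
    destruct (H2 (eps / 2) ltac:(lra)) as [d2 [Hd2 H2']].
    exists (Rmin d1 d2). split; [now apply Rmin_pos|]. intros s Hs.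
    lt_trans_by Cmod_le_abs. simpl.
    specialize (H1' s (lt_Rmin_l Hs)).
    specialize (H2' s (lt_Rmin_r Hs)).
    unfold Rminus in *. lra.
  - intros H. split; intros eps Heps; destruct (H eps Heps) as [d [Hd H1]]; exists d;
      (split; [exact Hd|]); intros s Hs; (eapply Rle_lt_trans; [|exact (H1 s Hs)]).
    + apply Rabs_fst_minus.
    + apply Rabs_snd_minus.
Qed.

Lemma pcont_const (c : C) (t : R) : pcont (fun _ => c) t.
Proof. split; apply continuous_const. Qed.

Lemma pcont_real (g : R -> R) (t : R) : continuous g t -> pcont (fun s => RtoC (g s)) t.
Proof. intros H. split; [exact H|apply continuous_const]. Qed.

Lemma pcont_plus (g h : R -> C) (t : R) :
  pcont g t -> pcont h t -> pcont (fun s => g s + h s)%C t.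
Proof.
  intros [H1 H2] [H3 H4]. split; simpl; now apply (continuous_plus (V := RV)).
Qed.

Lemma pcont_minus (g h : R -> C) (t : R) :
  pcont g t -> pcont h t -> pcont (fun s => g s - h s)%C t.
Proof.
  intros [H1 H2] [H3 H4]. split; simpl; now apply (continuous_minus (V := RV)).
Qed.

Lemma pcont_mult (g h : R -> C) (t : R) :
  pcont g t -> pcont h t -> pcont (fun s => g s * h s)%C t.
Proof.
  intros [H1 H2] [H3 H4]. split; simpl.
  - apply (continuous_minus (V := RV)); now apply (continuous_mult (K := R_AbsRing)).
  - apply (continuous_plus (V := RV)); now apply (continuous_mult (K := R_AbsRing)).
Qed.

Lemma pcont_scal (c : C) (h : R -> C) (t : R) : pcont h t -> pcont (fun s => c * h s)%C t.
Proof. apply pcont_mult, pcont_const. Qed.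

Lemma pcont_inv (h : R -> C) (t : R) :
  pcont h t -> h t <> 0%C -> pcont (fun s => / h s)%C t.
Proof.
  intros [H1 H2] Hne.
  assert (Hn : fst (h t) ^ 2 + snd (h t) ^ 2 <> 0).
  { intros H0. apply Hne. apply injective_projections; simpl; nra. }
  assert (Hden : continuous (fun s => / (fst (h s) ^ 2 + snd (h s) ^ 2)) t).
  { apply (continuous_comp (fun s => fst (h s) ^ 2 + snd (h s) ^ 2) Rinv).
    - apply (continuous_plus (V := RV)).
      + apply (continuous_mult (K := R_AbsRing)); [exact H1|].
        apply (continuous_mult (K := R_AbsRing)); [exact H1|]. apply continuous_const.
      + apply (continuous_mult (K := R_AbsRing)); [exact H2|].
        apply (continuous_mult (K := R_AbsRing)); [exact H2|]. apply continuous_const.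
    - apply continuous_Rinv. exact Hn. }
  split; unfold Cinv; simpl fst; simpl snd; unfold Rdiv.
  - now apply (continuous_mult (K := R_AbsRing)).
  - apply (continuous_mult (K := R_AbsRing)); [|exact Hden].
    now apply (continuous_opp (V := RV)).
Qed.

Definition CI (h : R -> C) (a b : R) : C :=
  (RInt (fun t => fst (h t)) a b, RInt (fun t => snd (h t)) a b).

Definition pcont_on (h : R -> C) (a b : R) : Prop := forall t, a <= t <= b -> pcont h t.

Lemma ex_RInt_fst (h : R -> C) (a b : R) : a <= b -> pcont_on h a b ->
  ex_RInt (fun t => fst (h t)) a b.
Proof.
  intros Hab H. apply (ex_RInt_continuous (V := RB)). intros t Ht.
  rewrite Rmin_left, Rmax_right in Ht by lra. now apply H.
Qed.

Lemma ex_RInt_snd (h : R -> C) (a b : R) : a <= b -> pcont_on h a b ->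
  ex_RInt (fun t => snd (h t)) a b.
Proof.
  intros Hab H. apply (ex_RInt_continuous (V := RB)). intros t Ht.
  rewrite Rmin_left, Rmax_right in Ht by lra. now apply H.
Qed.

Lemma CI_ext (g h : R -> C) (a b : R) : a <= b ->
  (forall t, a <= t <= b -> g t = h t) -> CI g a b = CI h a b.
Proof.
  intros Hab H. unfold CI. f_equal; apply RInt_ext; intros t Ht;
    rewrite Rmin_left, Rmax_right in Ht by lra; rewrite H; auto; lra.
Qed.

Lemma CI_plus (g h : R -> C) (a b : R) : a <= b -> pcont_on g a b -> pcont_on h a b ->
  CI (fun t => g t + h t)%C a b = (CI g a b + CI h a b)%C.
Proof.
  intros Hab Hg Hh. apply injective_projections.
  - exact (RInt_plus (V := RB) (fun t => fst (g t)) (fun t => fst (h t)) a b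
      (ex_RInt_fst g a b Hab Hg) (ex_RInt_fst h a b Hab Hh)).
  - exact (RInt_plus (V := RB) (fun t => snd (g t)) (fun t => snd (h t)) a b
      (ex_RInt_snd g a b Hab Hg) (ex_RInt_snd h a b Hab Hh)).
Qed.

Lemma CI_minus (g h : R -> C) (a b : R) : a <= b -> pcont_on g a b -> pcont_on h a b ->
  CI (fun t => g t - h t)%C a b = (CI g a b - CI h a b)%C.
Proof.
  intros Hab Hg Hh. apply injective_projections.
  - exact (RInt_minus (V := RB) (fun t => fst (g t)) (fun t => fst (h t)) a b
      (ex_RInt_fst g a b Hab Hg) (ex_RInt_fst h a b Hab Hh)).
  - exact (RInt_minus (V := RB) (fun t => snd (g t)) (fun t => snd (h t)) a b
      (ex_RInt_snd g a b Hab Hg) (ex_RInt_snd h a b Hab Hh)).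
Qed.

Lemma CI_scal (c : C) (h : R -> C) (a b : R) : a <= b -> pcont_on h a b ->
  CI (fun t => c * h t)%C a b = (c * CI h a b)%C.
Proof.
  intros Hab Hh. assert (H1 := ex_RInt_fst h a b Hab Hh). assert (H2 := ex_RInt_snd h a b Hab Hh).
  apply injective_projections; apply is_RInt_unique.
  - apply (is_RInt_minus (V := RV) (fun t => scal (fst c) (fst (h t)))
      (fun t => scal (snd c) (snd (h t))));
      apply (is_RInt_scal (V := RV)); now apply (RInt_correct (V := RB)).
  - apply (is_RInt_plus (V := RV) (fun t => scal (fst c) (snd (h t)))
      (fun t => scal (snd c) (fst (h t))));
      apply (is_RInt_scal (V := RV)); now apply (RInt_correct (V := RB)).
Qed.

Lemma CI_const (c : C) (a b : R) : CI (fun _ => c) a b = (RtoC (b - a) * c)%C.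
Proof.
  unfold CI. rewrite !RInt_const. unfold scal, Cmult; simpl; unfold mult; simpl.
  f_equal; ring.
Qed.

Lemma CI_Chasles (h : R -> C) (a b c : R) : a <= b <= c -> pcont_on h a c ->
  (CI h a b + CI h b c)%C = CI h a c.
Proof.
  intros Habc H. assert (pcont_on h a b) by (intros t Ht; apply H; lra).
  assert (pcont_on h b c) by (intros t Ht; apply H; lra).
  apply injective_projections.
  - apply (RInt_Chasles (V := RB) (fun t => fst (h t)) a b c);
      apply ex_RInt_fst; tauto || lra.
  - apply (RInt_Chasles (V := RB) (fun t => snd (h t)) a b c);
      apply ex_RInt_snd; tauto || lra.
Qed.

(* Bounding the two components separately costs the (harmless) factor 2. *)
Lemma Cmod_CI_le (h : R -> C) (g : R -> R) (a b : R) : a <= b -> pcont_on h a b ->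
  ex_RInt g a b -> (forall t, a <= t <= b -> Cmod (h t) <= g t) ->
  Cmod (CI h a b) <= 2 * RInt g a b.
Proof.
  intros Hab Hh Hg Hle.
  le_trans_by Cmod_le_abs. unfold CI; simpl.
  assert (H : forall k, ex_RInt k a b -> (forall t, a <= t <= b -> Rabs (k t) <= g t) ->
    Rabs (RInt k a b) <= RInt g a b).
  { intros k Hk Hkg. apply Rle_trans with (RInt (fun t => Rabs (k t)) a b).
    - now apply abs_RInt_le.
    - apply RInt_le; [exact Hab| |exact Hg|intros; apply Hkg; lra].
      now apply ex_RInt_norm. }
  assert (H1 := H (fun t => fst (h t)) (ex_RInt_fst h a b Hab Hh)
    (fun t Ht => Rle_trans _ _ _ (Rabs_fst_le_Cmod _) (Hle t Ht))).
  assert (H2 := H (fun t => snd (h t)) (ex_RInt_snd h a b Hab Hh)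
    (fun t Ht => Rle_trans _ _ _ (Rabs_snd_le_Cmod _) (Hle t Ht))).
  lra.
Qed.

Lemma Cmod_CI_le_const (h : R -> C) (M a b : R) : a <= b -> pcont_on h a b ->
  (forall t, a <= t <= b -> Cmod (h t) <= M) -> Cmod (CI h a b) <= 2 * ((b - a) * M).
Proof.
  intros Hab Hh HM. replace ((b - a) * M) with (RInt (fun _ => M) a b).
  - apply Cmod_CI_le; auto. apply ex_RInt_const.
  - rewrite RInt_const. reflexivity.
Qed.

Definition cis (t : R) : C := (cos t, sin t).

Lemma Cmod_cis (t : R) : Cmod (cis t) = 1.
Proof.
  unfold Cmod, cis; simpl fst; simpl snd.
  replace (cos t ^ 2 + sin t ^ 2) with 1; [apply sqrt_1|].
  generalize (sin2_cos2 t). unfold Rsqr. simpl. lra.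
Qed.

Lemma cis_0 : cis 0 = 1%C.
Proof. unfold cis. now rewrite cos_0, sin_0. Qed.

Lemma cis_plus (s t : R) : cis (s + t) = (cis s * cis t)%C.
Proof.
  unfold cis, Cmult; simpl. rewrite cos_plus, sin_plus. f_equal. ring.
Qed.

Lemma cis_pow (t : R) (n : nat) : Cpow (cis t) n = cis (INR n * t).
Proof.
  induction n as [|n IH].
  - simpl. now rewrite Rmult_0_l, cis_0.
  - change (Cpow (cis t) (S n)) with (cis t * Cpow (cis t) n)%C.
    rewrite IH, S_INR, <- cis_plus. f_equal. ring.
Qed.

Lemma cis_neq_0 (t : R) : cis t <> 0%C.
Proof. apply Cmod_gt_0. rewrite Cmod_cis. lra. Qed.

Lemma cis_opp (t : R) : cis (- t) = (/ cis t)%C.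
Proof.
  assert (H : (cis (- t) * cis t)%C = 1%C).
  { rewrite <- cis_plus, Rplus_opp_l. apply cis_0. }
  assert (Hn := cis_neq_0 t).
  replace (cis (- t)) with (cis (- t) * cis t / cis t)%C by (field; exact Hn).
  rewrite H. field. exact Hn.
Qed.

Lemma pcont_cis (a t : R) : pcont (fun s => cis (a * s)) t.
Proof.
  split; simpl; apply continuous_of_derive; auto_derive; trivial.
Qed.

(** A chord is at most its arc: the square of the left side is [2 - 2 cos (s - t)]. *)
Lemma Cmod_cis_minus_le (s t : R) : Cmod (cis s - cis t) <= Rabs (s - t).
Proof.
  unfold Cmod, cis; simpl fst; simpl snd. rewrite <- (sqrt_Rsqr_abs (s - t)).
  apply sqrt_le_1_alt. unfold Rsqr.
  assert (H := cos_ge_parabola (s - t)). rewrite cos_minus in H.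
  assert (H1 := sin2_cos2 s). assert (H2 := sin2_cos2 t). unfold Rsqr in *. nra.
Qed.

Lemma CI_cis_derive (a x y : R) :
  CI (fun t => Ci * a * cis (a * t))%C x y = (cis (a * y) - cis (a * x))%C.
Proof.
  apply injective_projections; apply is_RInt_unique.
  - apply (is_RInt_derive (V := RB) (fun t => cos (a * t))); intros t _; simpl.
    + auto_derive; [trivial|]. simpl. ring.
    + apply continuous_of_derive. auto_derive. trivial.
  - apply (is_RInt_derive (V := RB) (fun t => sin (a * t))); intros t _; simpl.
    + auto_derive; [trivial|]. simpl. ring.
    + apply continuous_of_derive. auto_derive. trivial.
Qed.

(** * Bisection and Cauchy's formula for complex differentiable functions *)

Lemma nested_intervals (x w : nat -> R) :
  (forall n, x n <= x (S n)) -> (forall n, x (S n) + w (S n) <= x n + w n) ->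
  (forall n, 0 <= w n) -> exists l, forall n, x n <= l <= x n + w n.
Proof.
  intros Hx Hw Hpos.
  assert (Hmono : forall n m, (n <= m)%nat -> x n <= x m /\ x m + w m <= x n + w n).
  { intros n m Hnm. induction Hnm as [|m Hnm IH]; [lra|].
    specialize (Hx m). specialize (Hw m). lra. }
  assert (Hcross : forall n m, x n <= x m + w m).
  { intros n m. destruct (Nat.le_ge_cases n m) as [H|H].
    - generalize (proj1 (Hmono n m H)) (Hpos m). lra.
    - generalize (proj2 (Hmono m n H)) (Hpos n). lra. }
  destruct (completeness (fun y => exists n, y = x n)) as [l [Hub Hlub]].
  - exists (x 0%nat + w 0%nat). intros y [n ->]. apply Hcross.
  - exists (x 0%nat). now exists 0%nat.
  - exists l. intros n. split.
    + apply Hub. now exists n.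
    + apply Hlub. intros y [m ->]. apply Hcross.
Qed.

Lemma half_pow_small (eps : R) : 0 < eps -> exists n, / 2 ^ n < eps.
Proof.
  intros Heps. destruct (pow_lt_1_zero (/ 2)) with (y := eps) as [N HN].
  - rewrite Rabs_pos_eq; lra.
  - exact Heps.
  - exists N. specialize (HN N (le_n _)). rewrite pow_inv in HN by lra.
    eapply Rle_lt_trans; [apply Rle_abs|exact HN].
Qed.

(** Goursat's subdivision for an arbitrary property of rectangles: if [P] fails, it fails on a
    quarter, and nested failing quarters shrink to a point, against the local hypothesis there. All
    rectangles keep the proportion of [h] to [k], so a single scale [q] measures them. *)
Lemma bisection_2d (P : R -> R -> R -> R -> Prop) (a c h k : R) :
  0 < h -> 0 < k ->
  (forall x y h' k', a <= x -> x + 2 * h' <= a + h -> c <= y -> y + 2 * k' <= c + k ->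
     0 < h' -> 0 < k' ->
     P x y h' k' -> P (x + h') y h' k' -> P x (y + k') h' k' -> P (x + h') (y + k') h' k' ->
     P x y (2 * h') (2 * k')) ->
  (forall x y, a <= x <= a + h -> c <= y <= c + k -> exists delta, 0 < delta /\
     forall x' y' q, 0 < q < delta -> a <= x' -> x' + q * h <= a + h ->
       x' <= x <= x' + q * h -> y' <= y <= y' + q * k -> P x' y' (q * h) (q * k)) ->
  P a c h k.
Proof.
  intros Hh Hk Hquad Hloc. apply NNPP. intros Hneg.
  set (q := fun n : nat => / 2 ^ n).
  assert (Hq : forall n, 0 < q n) by (intros n; apply Rinv_0_lt_compat, pow_lt; lra).
  assert (HqS : forall n, q n = 2 * q (S n)).
  { intros n. unfold q. simpl. field. apply pow_nonzero. lra. }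
  set (Inv := fun (n : nat) (p : R * R) => a <= fst p /\ fst p + q n * h <= a + h /\
    c <= snd p /\ snd p + q n * k <= c + k /\ ~ P (fst p) (snd p) (q n * h) (q n * k)).
  set (Next := fun (n : nat) (p p' : R * R) =>
    (fst p' = fst p \/ fst p' = fst p + q (S n) * h) /\
    (snd p' = snd p \/ snd p' = snd p + q (S n) * k) /\ Inv (S n) p').
  assert (Hstep : forall n p, Inv n p -> exists p', Next n p p').
  { intros n [x y] [H1 [H2 [H3 [H4 H5]]]]. simpl in *.
    assert (Hh' : 0 < q (S n) * h) by (apply Rmult_lt_0_compat; auto).
    assert (Hk' : 0 < q (S n) * k) by (apply Rmult_lt_0_compat; auto).
    assert (Hqh : q n * h = 2 * (q (S n) * h)) by (rewrite HqS; ring).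
    assert (Hqk : q n * k = 2 * (q (S n) * k)) by (rewrite HqS; ring).
    rewrite Hqh, Hqk in H5. rewrite Hqh in H2. rewrite Hqk in H4.
    apply NNPP. intros Hno. apply H5.
    apply Hquad; auto; apply NNPP; intros Hn; apply Hno;
      eexists (_, _); (split; [|split; [|repeat split; [| | | |exact Hn]]]); simpl; auto; lra. }
  (* Successive choice of a failing quarter. *)
  set (step := fun n p => epsilon (inhabits p) (Next n p)).
  set (seq := fix seq n := match n with O => (a, c) | S m => step m (seq m) end).
  assert (Hinv : forall n, Inv n (seq n)).
  { induction n as [|n IH].
    - unfold Inv, q; simpl. rewrite Rinv_1, !Rmult_1_l. repeat split; try lra. exact Hneg.
    - exact (proj2 (proj2 (epsilon_spec (inhabits (seq n)) _ (Hstep n _ IH)))). }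
  assert (Hnext : forall n, Next n (seq n) (seq (S n))).
  { intros n. exact (epsilon_spec (inhabits (seq n)) _ (Hstep n _ (Hinv n))). }
  destruct (nested_intervals (fun n => fst (seq n)) (fun n => q n * h)) as [x Hx].
  { intros n. cbn beta. destruct (Hnext n) as [[H|H] _]; cbn beta; rewrite H; generalize (Hq (S n)); nra. }
  { intros n. rewrite (HqS n). destruct (Hnext n) as [[H|H] _]; cbn beta; rewrite H; generalize (Hq (S n)); nra. }
  { intros n. cbn beta. generalize (Hq n). nra. }
  destruct (nested_intervals (fun n => snd (seq n)) (fun n => q n * k)) as [y Hy].
  { intros n. cbn beta. destruct (Hnext n) as [_ [[H|H] _]]; cbn beta; rewrite H; generalize (Hq (S n)); nra. }
  { intros n. rewrite (HqS n). destruct (Hnext n) as [_ [[H|H] _]]; cbn beta; rewrite H; generalize (Hq (S n)); nra. }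
  { intros n. cbn beta. generalize (Hq n). nra. }
  destruct (Hloc x y) as [delta [Hdelta Hl]].
  - specialize (Hx 0%nat). specialize (Hinv 0%nat). unfold Inv in Hinv. simpl in Hx, Hinv. lra.
  - specialize (Hy 0%nat). specialize (Hinv 0%nat). unfold Inv in Hinv. simpl in Hy, Hinv. lra.
  - destruct (half_pow_small delta Hdelta) as [n Hn].
    destruct (Hinv n) as [H1 [H2 [H3 [H4 H5]]]]. apply H5. apply Hl; auto.
Qed.

(** Differentiability at one point, with nothing assumed on the continuity of the derivative; the
    product form avoids dividing by [w - z]. *)
Definition cdiff (f : C -> C) (z : C) : Prop :=
  exists l : C, forall eps, 0 < eps -> exists delta, 0 < delta /\
    forall w, Cmod (w - z) < delta -> Cmod (f w - f z - l * (w - z)) <= eps * Cmod (w - z).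

Definition ccont (f : C -> C) (z : C) : Prop :=
  forall eps, 0 < eps -> exists delta, 0 < delta /\
    forall w, Cmod (w - z) < delta -> Cmod (f w - f z) < eps.

Lemma cdiff_ccont (f : C -> C) (z : C) : cdiff f z -> ccont f z.
Proof.
  intros [l Hl] eps Heps. destruct (Hl 1 Rlt_0_1) as [d [Hd H]].
  assert (Hl0 := Cmod_ge_0 l).
  exists (Rmin d (eps / (Cmod l + 2))). split.
  - apply Rmin_pos; [exact Hd|]. apply Rdiv_lt_0_compat; lra.
  - intros w Hw. specialize (H w (lt_Rmin_l Hw)).
    assert (Hw2 := lt_Rmin_r Hw).
    replace (f w - f z)%C with ((f w - f z - l * (w - z)) + l * (w - z))%C by ring.
    lt_trans_by Cmod_triangle. rewrite Cmod_mult.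
    assert (Cmod (w - z) * (Cmod l + 2) < eps).
    { apply Rlt_div_r in Hw2; lra. }
    generalize (Cmod_ge_0 (w - z)). nra.
Qed.

Lemma pcont_comp (f : C -> C) (h : R -> C) (t : R) :
  ccont f (h t) -> pcont h t -> pcont (fun s => f (h s)) t.
Proof.
  intros Hf Hh. apply pcont_eps. intros eps Heps.
  destruct (Hf eps Heps) as [d [Hd H]].
  destruct (proj1 (pcont_eps h t) Hh d Hd) as [d' [Hd' H']].
  exists d'. split; [exact Hd'|]. intros s Hs. apply H. now apply H'.
Qed.

Lemma pcont_ext (g h : R -> C) (t : R) :
  (forall s, g s = h s) -> pcont g t -> pcont h t.
Proof.
  intros H [H1 H2].
  split.
  - apply continuous_ext with (fun s => fst (g s)); [intros s; now rewrite H|exact H1].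
  - apply continuous_ext with (fun s => snd (g s)); [intros s; now rewrite H|exact H2].
Qed.

Lemma pcont_cis1 (t : R) : pcont cis t.
Proof.
  apply pcont_ext with (fun s => cis (1 * s)); [intros s; now rewrite Rmult_1_l|].
  apply pcont_cis.
Qed.

Lemma RtoC_neq_0 (x : R) : x <> 0 -> RtoC x <> 0%C.
Proof. intros H H0. apply H. now apply RtoC_inj. Qed.

Section Cauchy.
Context (f : C -> C) (r : R) (z0 : C).
Hypothesis Hz0 : Cmod z0 < r.
Hypothesis Hf : forall w, Cmod w <= r -> cdiff f w.

(** [ph s t] contracts the point [r e^{it}] of the circle towards [z0]. As [ph - z0 = s u(t)], the
    form [dw / (w - z0)] becomes [ds / s + kap dt] with [kap = u' / u]: hence the factor [/ s] in
    [horiz] and [kap] in [vert]. *)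
Let u (t : R) : C := (r * cis t - z0)%C.
Let ph (s t : R) : C := (z0 + s * u t)%C.
Let kap (t : R) : C := (Ci * r * cis t / u t)%C.
Let horiz (s0 s1 t : R) : C := CI (fun s => f (ph s t) * RtoC (/ s))%C s0 s1.
Let vert (s t0 t1 : R) : C := CI (fun t => f (ph s t) * kap t)%C t0 t1.
(* Boundary integral of the pull-back of [f(w) dw / (w - z0)] along [ph] over
   the parameter rectangle [s, s + h] x [t, t + k]. *)
Let bdry (s t h k : R) : C :=
  (horiz s (s + h) t - horiz s (s + h) (t + k) + vert (s + h) t (t + k) - vert s t (t + k))%C.

Let r_pos : 0 < r.
Proof. generalize (Cmod_ge_0 z0); lra. Qed.

Let u_lower (t : R) : r - Cmod z0 <= Cmod (u t).
Proof.
  unfold u. eapply Rle_trans; [|apply Cmod_triangle_rev].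
  rewrite Cmod_mult, Cmod_cis, Cmod_R, Rabs_pos_eq by lra. lra.
Qed.

Let u_upper (t : R) : Cmod (u t) <= 2 * r.
Proof.
  unfold u. le_trans_by Cmod_triangle_minus.
  rewrite Cmod_mult, Cmod_cis, Cmod_R, Rabs_pos_eq by lra. lra.
Qed.

Let u_neq_0 (t : R) : u t <> 0%C.
Proof. apply Cmod_gt_0. generalize (u_lower t). lra. Qed.

Let ph_in_disk (s t : R) : 0 <= s <= 1 -> Cmod (ph s t) <= r.
Proof.
  intros Hs. unfold ph, u.
  replace (z0 + s * (r * cis t - z0))%C with
    (RtoC (1 - s) * z0 + s * (r * cis t))%C.
  2:{ rewrite RtoC_minus. ring. }
  le_trans_by Cmod_triangle.
  rewrite !Cmod_mult, Cmod_cis, !Cmod_R, !Rabs_pos_eq by lra. nra.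
Qed.

Let u_cont (t : R) : pcont u t.
Proof.
  apply pcont_minus; [|apply pcont_const].
  apply pcont_scal; apply pcont_cis1.
Qed.

Let kap_cont (t : R) : pcont kap t.
Proof.
  apply pcont_mult.
  - apply pcont_scal; apply pcont_cis1.
  - apply pcont_inv; [apply u_cont|apply u_neq_0].
Qed.

Let kap_bound (t : R) : Cmod (kap t) <= r / (r - Cmod z0).
Proof.
  unfold kap. rewrite Cmod_div by apply u_neq_0.
  rewrite !Cmod_mult, Cmod_cis, Cmod_Ci, Cmod_R, Rabs_pos_eq by lra.
  rewrite Rmult_1_l, Rmult_1_r. apply Rmult_le_compat_l; [lra|].
  apply Rinv_le_contravar; [lra|apply u_lower].
Qed.

Let inv_cont (s : R) : s <> 0 -> pcont (fun s => RtoC (/ s)) s.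
Proof. intros Hs. apply pcont_real. now apply continuous_Rinv. Qed.

Let ph_cont_s (s t : R) : pcont (fun s => ph s t) s.
Proof.
  apply pcont_plus; [apply pcont_const|].
  apply pcont_mult; [|apply pcont_const]. apply pcont_real. apply continuous_id.
Qed.

Let ph_cont_t (s t : R) : pcont (fun t => ph s t) t.
Proof.
  apply pcont_plus; [apply pcont_const|].
  apply pcont_scal. apply u_cont.
Qed.

Let horiz_cont (s0 s1 t : R) : 0 < s0 -> s1 <= 1 ->
  pcont_on (fun s => f (ph s t) * RtoC (/ s))%C s0 s1.
Proof.
  intros H0 H1 s Hs. apply pcont_mult.
  - apply (pcont_comp f (fun s => ph s t)); [|apply ph_cont_s].
    apply cdiff_ccont, Hf, ph_in_disk. lra.
  - apply inv_cont. lra.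
Qed.

Let vert_cont (s t0 t1 : R) : 0 <= s <= 1 ->
  pcont_on (fun t => f (ph s t) * kap t)%C t0 t1.
Proof.
  intros H0 t Ht. apply pcont_mult; [|apply kap_cont].
  apply (pcont_comp f (fun t => ph s t)); [|apply ph_cont_t].
  apply cdiff_ccont, Hf, ph_in_disk. lra.
Qed.

(** Edges inside the large rectangle are traversed twice in opposite directions and cancel. *)
Let bdry_quad (s t h k : R) : 0 < s -> s + 2 * h <= 1 -> 0 < h -> 0 < k ->
  bdry s t (2 * h) (2 * k) =
  (bdry s t h k + bdry (s + h) t h k + bdry s (t + k) h k + bdry (s + h) (t + k) h k)%C.
Proof.
  intros Hs Hsh Hh Hk. unfold bdry.
  replace (s + h + h) with (s + 2 * h) by ring. replace (t + k + k) with (t + 2 * k) by ring.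
  assert (HA : forall t', horiz s (s + 2 * h) t' = (horiz s (s + h) t' + horiz (s + h) (s + 2 * h) t')%C).
  { intros t'. unfold horiz. symmetry. apply CI_Chasles; [lra|]. apply horiz_cont; lra. }
  assert (HB : forall s', 0 <= s' <= 1 -> vert s' t (t + 2 * k) = (vert s' t (t + k) + vert s' (t + k) (t + 2 * k))%C).
  { intros s' Hs'. unfold vert. symmetry. apply CI_Chasles; [lra|]. apply vert_cont; lra. }
  rewrite !HA, !HB by lra. ring.
Qed.

Let ph_lipschitz (s t s' t' : R) : 0 <= s <= 1 ->
  Cmod (ph s' t' - ph s t) <= 2 * r * Rabs (s' - s) + r * Rabs (t' - t).
Proof.
  intros Hs. replace (ph s' t' - ph s t)%C with
    (RtoC (s' - s) * u t' + s * (r * (cis t' - cis t)))%C.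
  2:{ unfold ph, u. rewrite RtoC_minus. ring. }
  le_trans_by Cmod_triangle.
  rewrite !Cmod_mult, !Cmod_R, (Rabs_pos_eq s), (Rabs_pos_eq r) by lra.
  assert (H1 := Cmod_cis_minus_le t' t). assert (H2 := u_upper t').
  assert (H3 := Rabs_pos (s' - s)). assert (H4 := Cmod_ge_0 (cis t' - cis t)).
  apply Rplus_le_compat; [nra|].
  apply Rle_trans with (1 * (r * Cmod (cis t' - cis t))); [|nra].
  apply Rmult_le_compat_r; [nra|lra].
Qed.

Let CI_u' (a b : R) : a <= b -> CI (fun t => Ci * r * cis t)%C a b = (u b - u a)%C.
Proof.
  intros Hab.
  rewrite (CI_ext _ (fun t => r * (Ci * 1 * cis (1 * t)))%C);
    [|exact Hab|intros t _; rewrite Rmult_1_l; ring].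
  rewrite CI_scal, CI_cis_derive, !Rmult_1_l; [unfold u; ring|exact Hab|].
  intros t _. apply pcont_scal; apply pcont_cis.
Qed.

(** The affine part contributes nothing. In its constant term, [ds / s] does not involve [t] and
    [kap dt] does not involve [s], so opposite edges cancel without any logarithm; in its linear
    term, [u ds + s u' dt] integrates to differences of [s u]. *)
Let bdry_affine (alpha l : C) (rho : R -> R -> C) (s t h k : R) :
  0 < s -> s + h <= 1 -> 0 < h -> 0 < k ->
  (forall s' t', 0 < s' <= 1 -> f (ph s' t') = (alpha + l * (s' * u t') + rho s' t')%C) ->
  bdry s t h k =
  (CI (fun s' => rho s' t * RtoC (/ s')) s (s + h) - CI (fun s' => rho s' (t + k)%R * RtoC (/ s')) s (s + h)
   + CI (fun t' => rho (s + h)%R t' * kap t') t (t + k) - CI (fun t' => rho s t' * kap t') t (t + k))%C.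
Proof.
  intros Hs Hsh Hh Hk Hrho.
  assert (Hrho' : forall s' t', 0 < s' <= 1 -> rho s' t' = (f (ph s' t') - (alpha + l * (s' * u t')))%C).
  { intros s' t' Hs'. rewrite Hrho by exact Hs'. ring. }
  assert (HA : forall t', horiz s (s + h) t' =
    (alpha * CI (fun s' => RtoC (/ s')) s (s + h) + l * u t' * RtoC h
     + CI (fun s' => rho s' t' * RtoC (/ s')) s (s + h))%C).
  { intros t'.
    rewrite (CI_ext (fun s' => rho s' t' * RtoC (/ s'))%C
      (fun s' => f (ph s' t') * RtoC (/ s') - (alpha * RtoC (/ s') + l * u t'))%C); [|lra|].
    - rewrite CI_minus; [|lra|apply horiz_cont; lra|].
      + rewrite CI_plus; [|lra| |].
        * rewrite CI_scal; [|lra|intros s' Hs'; apply inv_cont; lra].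
          rewrite CI_const. replace (s + h - s) with h by ring. unfold horiz. ring.
        * intros s' Hs'. apply pcont_scal; apply inv_cont; lra.
        * intros s' Hs'. apply pcont_const.
      + intros s' Hs'. apply pcont_plus; [|apply pcont_const].
        apply pcont_scal; apply inv_cont; lra.
    - intros s' Hs'. rewrite Hrho' by lra. rewrite RtoC_inv by lra.
      assert (RtoC s' <> 0%C) by (apply RtoC_neq_0; lra). field. assumption. }
  assert (HB : forall s', 0 < s' <= 1 -> vert s' t (t + k) =
    (alpha * CI kap t (t + k) + l * s' * (u (t + k)%R - u t)
     + CI (fun t' => rho s' t' * kap t') t (t + k))%C).
  { intros s' Hs'.
    rewrite (CI_ext (fun t' => rho s' t' * kap t')%C
      (fun t' => f (ph s' t') * kap t' - (alpha * kap t' + l * s' * (Ci * r * cis t')))%C); [|lra|].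
    - assert (Hc1 : pcont_on (fun t' => Ci * r * cis t')%C t (t + k)).
      { intros t' _. apply pcont_scal; apply pcont_cis1. }
      assert (Hc2 : pcont_on kap t (t + k)) by (intros t' _; apply kap_cont).
      rewrite CI_minus; [|lra|apply vert_cont; lra|].
      + rewrite CI_plus; [|lra| |].
        * rewrite !CI_scal by (lra || assumption). rewrite CI_u' by lra. unfold vert. ring.
        * intros t' Ht'. apply pcont_scal; now apply Hc2.
        * intros t' Ht'. apply pcont_scal; now apply Hc1.
      + intros t' Ht'. apply pcont_plus;
          (apply pcont_scal); [now apply Hc2|now apply Hc1].
    - intros t' _. rewrite Hrho' by exact Hs'. unfold kap. field. apply u_neq_0. }
  unfold bdry. rewrite !HA, !HB by lra. rewrite RtoC_plus. ring.
Qed.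

(** Goursat's estimate: near a point the affine remainder is at most [eta] times the distance, and
    edges have length of order [q], so the boundary integral is of order [eta q^2], like the area.
    Keeping [s >= sg > 0] avoids the pole of [1 / s]. *)
Let bdry_small (sg T eps : R) : 0 < sg < 1 -> 0 < T -> 0 < eps ->
  Cmod (bdry sg (- T) (1 - sg) (2 * T)) <= eps * ((1 - sg) * (2 * T)).
Proof.
  intros Hsg HT Heps.
  set (h := 1 - sg). set (k := 2 * T).
  assert (Hh : 0 < h) by (unfold h; lra). assert (Hk : 0 < k) by (unfold k; lra).
  refine (bisection_2d (fun x y h k => Cmod (bdry x y h k) <= eps * (h * k)) sg (- T) h k Hh Hk _ _).
  - intros x y h' k' Hx Hxh _ _ Hh' Hk' H1 H2 H3 H4.
    rewrite bdry_quad; [|lra|unfold h in Hxh; lra|lra|lra].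
    assert (H := Cmod_triangle (bdry x y h' k' + bdry (x + h') y h' k' + bdry x (y + k') h' k')
      (bdry (x + h') (y + k') h' k')).
    assert (H' := Cmod_triangle (bdry x y h' k' + bdry (x + h') y h' k') (bdry x (y + k') h' k')).
    assert (H'' := Cmod_triangle (bdry x y h' k') (bdry (x + h') y h' k')).
    replace (eps * (2 * h' * (2 * k'))) with (4 * (eps * (h' * k'))) by ring. lra.
  - intros x y Hx _.
    assert (Hx1 : 0 <= x <= 1) by (unfold h in Hx; lra).
    destruct (Hf _ (ph_in_disk x y Hx1)) as [l Hl].
    (* [K] bounds [kap], and [q D] bounds the distance between the images of two points of a
       parameter rectangle of scale [q]. *)
    set (K := r / (r - Cmod z0)). set (D := 2 * r * h + r * k).
    assert (HK : 0 < K) by (apply Rdiv_lt_0_compat; lra).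
    assert (HD : 0 < D) by (unfold D; nra).
    (* [eta E q^2] is the sum of the bounds for the four edges; [eta] makes it equal to [eps] times
       the area [q h q k]. *)
    set (E := 4 * D * (h / sg + k * K)).
    assert (Hhs : 0 < h / sg) by (apply Rdiv_lt_0_compat; lra).
    assert (HE : 0 < E) by (unfold E; apply Rmult_lt_0_compat; nra).
    set (eta := eps * (h * k) / E).
    assert (Heta : 0 < eta) by (apply Rdiv_lt_0_compat; [apply Rmult_lt_0_compat; nra|exact HE]).
    destruct (Hl eta Heta) as [d [Hd Hld]].
    exists (d / D). split; [now apply Rdiv_lt_0_compat|].
    intros x' y' q [Hq Hqd] Hx' Hxh' Hxx Hyy.
    assert (HqD : q * D < d) by (apply Rlt_div_r; lra).
    assert (Hqh : 0 < q * h) by nra. assert (Hqk : 0 < q * k) by nra.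
    set (rho := fun s t => (f (ph s t) - f (ph x y) - l * (ph s t - ph x y))%C).
    assert (Hrho : forall s t, x' <= s <= x' + q * h -> y' <= t <= y' + q * k ->
      Cmod (rho s t) <= eta * (q * D)).
    { intros s t Hs Ht.
      assert (Hdist : Cmod (ph s t - ph x y) <= q * D).
      { eapply Rle_trans; [now apply ph_lipschitz|].
        assert (Rabs (s - x) <= q * h) by (apply Rabs_le; lra).
        assert (Rabs (t - y) <= q * k) by (apply Rabs_le; lra). unfold D. nra. }
      eapply Rle_trans; [apply Hld; lra|]. nra. }
    assert (Hrc_s : forall t, pcont_on (fun s => rho s t * RtoC (/ s))%C x' (x' + q * h)).
    { intros t s Hs. unfold h in *. apply pcont_mult; [|apply inv_cont; lra].
      apply pcont_minus; [apply pcont_minus; [|apply pcont_const]|].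
      - apply (pcont_comp f (fun s => ph s t)); [|apply ph_cont_s].
        apply cdiff_ccont, Hf, ph_in_disk. lra.
      - apply pcont_scal.
        apply pcont_minus; [apply ph_cont_s|apply pcont_const]. }
    assert (Hrc_t : forall s, 0 <= s <= 1 -> pcont_on (fun t => rho s t * kap t)%C y' (y' + q * k)).
    { intros s Hs t _. apply pcont_mult; [|apply kap_cont].
      apply pcont_minus; [apply pcont_minus; [|apply pcont_const]|].
      - apply (pcont_comp f (fun t => ph s t)); [|apply ph_cont_t].
        apply cdiff_ccont, Hf, ph_in_disk. lra.
      - apply pcont_scal.
        apply pcont_minus; [apply ph_cont_t|apply pcont_const]. }
    assert (Hbs : forall t, y' <= t <= y' + q * k ->
      Cmod (CI (fun s => rho s t * RtoC (/ s))%C x' (x' + q * h)) <= 2 * (q * h * (eta * (q * D) / sg))).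
    { intros t Ht. replace (q * h) with (x' + q * h - x') at 2 by ring.
      apply Cmod_CI_le_const; [lra|apply Hrc_s|]. intros s Hs.
      rewrite Cmod_mult, Cmod_R, Rabs_pos_eq by (left; apply Rinv_0_lt_compat; lra).
      apply Rmult_le_compat; [apply Cmod_ge_0|left; apply Rinv_0_lt_compat; lra|now apply Hrho|].
      apply Rinv_le_contravar; lra. }
    assert (Hbt : forall s, x' <= s <= x' + q * h ->
      Cmod (CI (fun t => rho s t * kap t)%C y' (y' + q * k)) <= 2 * (q * k * (eta * (q * D) * K))).
    { intros s Hs. replace (q * k) with (y' + q * k - y') at 2 by ring. unfold h in *.
      apply Cmod_CI_le_const; [lra|apply Hrc_t; lra|]. intros t Ht.
      rewrite Cmod_mult.
      apply Rmult_le_compat; [apply Cmod_ge_0|apply Cmod_ge_0|now apply Hrho|apply kap_bound]. }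
    (* With [w0 = ph x y], the affine part [f(w0) + l (w - w0)] is expanded about [z0], whence the
       constant [f(w0) + l (z0 - w0)]. *)
    rewrite (bdry_affine (f (ph x y) + l * (z0 - ph x y))%C l rho);
      [|lra|unfold h in *; lra|exact Hqh|exact Hqk|].
    2:{ intros s t _. unfold rho, ph. ring. }
    le_trans_by Cmod_triangle_minus.
    eapply Rle_trans; [apply Rplus_le_compat_r, Cmod_triangle|].
    eapply Rle_trans; [apply Rplus_le_compat_r, Rplus_le_compat_r, Cmod_triangle_minus|].
    assert (H1 := Hbs y' ltac:(lra)). assert (H2 := Hbs (y' + q * k) ltac:(lra)).
    assert (H3 := Hbt x' ltac:(lra)). assert (H4 := Hbt (x' + q * h) ltac:(lra)).
    apply Rle_trans with (eta * E * (q * q)).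
    + unfold E. replace (eta * (4 * D * (h / sg + k * K)) * (q * q)) with
        (2 * (2 * (q * h * (eta * (q * D) / sg))) + 2 * (2 * (q * k * (eta * (q * D) * K)))) by (field; lra).
      lra.
    + unfold eta. right. field. lra.
Qed.

Let bdry_zero (sg T : R) : 0 < sg < 1 -> 0 < T -> bdry sg (- T) (1 - sg) (2 * T) = 0%C.
Proof.
  intros Hsg HT. apply Cmod_eps_0 with ((1 - sg) * (2 * T)). intros eps Heps.
  replace ((1 - sg) * (2 * T) * eps) with (eps * ((1 - sg) * (2 * T))) by ring.
  apply bdry_small; assumption.
Qed.

Let ph_periodic (s : R) : ph s PI = ph s (- PI).
Proof.
  unfold ph, u, cis. now rewrite cos_neg, sin_neg, sin_PI, Ropp_0.
Qed.

(** The edges [t = - PI] and [t = PI] have the same image and cancel in the vanishing boundary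
    integral; only the two closed contours remain. *)
Let vert_const (sg : R) : 0 < sg < 1 -> vert 1 (- PI) PI = vert sg (- PI) PI.
Proof.
  intros Hsg. assert (HPI := PI_RGT_0). assert (H := bdry_zero sg PI Hsg HPI).
  unfold bdry in H. replace (sg + (1 - sg)) with 1 in H by ring.
  replace (- PI + 2 * PI) with PI in H by ring.
  replace (horiz sg 1 PI) with (horiz sg 1 (- PI)) in H.
  - replace (vert 1 (- PI) PI) with
      (horiz sg 1 (- PI) - horiz sg 1 (- PI) + vert 1 (- PI) PI - vert sg (- PI) PI + vert sg (- PI) PI)%C by ring.
    rewrite H. ring.
  - apply CI_ext; [lra|]. intros s _. now rewrite ph_periodic.
Qed.

(** Contracting the contour to [z0] replaces [f] by [f z0]. The remaining index integral is left as
    it stands; [CI_kernel_one] evaluates it. *)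
Lemma cauchy_homotopy :
  CI (fun t => f (r * cis t) * (Ci * r * cis t / (r * cis t - z0)))%C (- PI) PI =
  (f z0 * CI (fun t => Ci * r * cis t / (r * cis t - z0))%C (- PI) PI)%C.
Proof.
  assert (HPI := PI_RGT_0).
  set (K := r / (r - Cmod z0)).
  assert (HK : 0 < K) by (apply Rdiv_lt_0_compat; lra).
  assert (Hkc : pcont_on kap (- PI) PI) by (intros t _; apply kap_cont).
  assert (H1 : CI (fun t => f (r * cis t) * (Ci * r * cis t / (r * cis t - z0)))%C (- PI) PI
    = vert 1 (- PI) PI).
  { apply CI_ext; [lra|]. intros t _. unfold kap. f_equal. f_equal. unfold ph, u. ring. }
  rewrite H1. change (vert 1 (- PI) PI = (f z0 * CI kap (- PI) PI)%C).
  assert (Hdiff : (vert 1 (- PI) PI - f z0 * CI kap (- PI) PI)%C = 0%C).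
  { apply Cmod_eps_0 with (2 * (2 * PI * K)). intros eps Heps.
    destruct (cdiff_ccont f z0 (Hf z0 (Rlt_le _ _ Hz0)) eps Heps) as [d [Hd Hd1]].
    (* The contracted circle [s = sg] must lie within [d] of [z0], and [|u| <= 2 r]. *)
    set (sg := Rmin (/ 2) (d / (4 * r))).
    assert (Hsg : 0 < sg < 1).
    { unfold sg. split; [apply Rmin_pos; [lra|apply Rdiv_lt_0_compat; lra]|].
      eapply Rle_lt_trans; [apply Rmin_l|lra]. }
    assert (Hsgd : sg * (2 * r) < d).
    { apply Rle_lt_trans with (d / (4 * r) * (2 * r)).
      - apply Rmult_le_compat_r; [lra|apply Rmin_r].
      - replace (d / (4 * r) * (2 * r)) with (d / 2) by (field; lra). lra. }
    rewrite (vert_const sg Hsg). unfold vert.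
    rewrite <- CI_scal by (lra || assumption).
    rewrite <- CI_minus; [|lra|apply vert_cont; lra|].
    2:{ intros t Ht. apply pcont_scal; now apply Hkc. }
    replace (2 * (2 * PI * K) * eps) with (2 * ((PI - - PI) * (eps * K))) by ring.
    apply Cmod_CI_le_const; [lra| |].
    - intros t Ht. apply pcont_minus.
      + apply (vert_cont sg (- PI) PI); [lra|exact Ht].
      + apply pcont_scal; now apply Hkc.
    - intros t Ht. replace (f (ph sg t) * kap t - f z0 * kap t)%C with ((f (ph sg t) - f z0) * kap t)%C by ring.
      rewrite Cmod_mult. apply Rmult_le_compat; try apply Cmod_ge_0; [|apply kap_bound].
      left. apply Hd1. unfold ph. replace (z0 + sg * u t - z0)%C with (sg * u t)%C by ring.
      rewrite Cmod_scale by lra.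
      eapply Rle_lt_trans; [|exact Hsgd]. apply Rmult_le_compat_l; [lra|apply u_upper]. }
  replace (vert 1 (- PI) PI) with (vert 1 (- PI) PI - f z0 * CI kap (- PI) PI + f z0 * CI kap (- PI) PI)%C by ring.
  rewrite Hdiff. ring.
Qed.

End Cauchy.

(** * Taylor expansion *)

Lemma sum_n_C_S (c : nat -> C) (M : nat) :
  sumC c (S M) = (sumC c M + c (S M))%C.
Proof. now rewrite sum_Sn. Qed.

Lemma sum_n_C_components (c : nat -> C) (M : nat) :
  sumC c M =
  (sum_n (fun n => fst (c n)) M, sum_n (fun n => snd (c n)) M).
Proof.
  induction M as [|M IH].
  - rewrite !sum_O. apply surjective_pairing.
  - rewrite sum_n_C_S, IH, !sum_n_S. reflexivity.
Qed.

Lemma is_series_C_eps (c : nat -> C) (l : C) :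
  is_seriesC c l <->
  forall eps, 0 < eps -> exists N, forall M, (N <= M)%nat ->
    Cmod (sumC c M - l) < eps.
Proof.
  unfold is_series. split.
  - intros H eps Heps. assert (He2 : 0 < eps / 2) by lra.
    assert (H' := proj1 (filterlim_locally (F := eventually)
      (sumC c) l) H (mkposreal _ He2)).
    destruct H' as [N HN]. exists N. intros M HM. destruct (HN M HM) as [H1 H2].
    lt_trans_by Cmod_minus_le_abs.
    change (Rabs (fst (sumC c M) - fst l) < eps / 2) in H1.
    change (Rabs (snd (sumC c M) - snd l) < eps / 2) in H2. lra.
  - intros H. apply (filterlim_locally (F := eventually) (sumC c) l).
    intros eps. destruct (H eps (cond_pos eps)) as [N HN]. exists N. intros M HM.
    specialize (HN M HM). split.
    + exact (Rle_lt_trans _ _ _ (Rabs_fst_minus _ _) HN).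
    + exact (Rle_lt_trans _ _ _ (Rabs_snd_minus _ _) HN).
Qed.

Lemma is_series_R_eps (a : nat -> R) (l : R) :
  is_series a l <-> forall eps, 0 < eps -> exists N, forall M, (N <= M)%nat ->
    Rabs (sum_n a M - l) < eps.
Proof.
  change (is_series a l) with (is_lim_seq (sum_n a) l).
  rewrite <- is_lim_seq_spec. split.
  - intros H eps Heps. exact (H (mkposreal eps Heps)).
  - intros H eps. exact (H eps (cond_pos eps)).
Qed.

Lemma is_series_C_iff (c : nat -> C) (l : C) :
  is_seriesC c l <->
  is_series (fun n => fst (c n)) (fst l) /\ is_series (fun n => snd (c n)) (snd l).
Proof.
  rewrite is_series_C_eps, !is_series_R_eps. split.
  - intros H. split; intros eps Heps; destruct (H eps Heps) as [N HN]; exists N; intros M HM;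
      specialize (HN M HM); rewrite sum_n_C_components in HN;
      (eapply Rle_lt_trans; [|exact HN]).
    + exact (Rabs_fst_minus (_, _) l).
    + exact (Rabs_snd_minus (_, _) l).
  - intros [H1 H2] eps Heps.
    destruct (H1 (eps / 2) ltac:(lra)) as [N1 HN1]. destruct (H2 (eps / 2) ltac:(lra)) as [N2 HN2].
    exists (N1 + N2)%nat. intros M HM. specialize (HN1 M ltac:(lia)). specialize (HN2 M ltac:(lia)).
    rewrite sum_n_C_components. lt_trans_by Cmod_minus_le_abs.
    cbn [fst snd]. lra.
Qed.

Lemma is_series_C_unique (c : nat -> C) (l l' : C) :
  is_seriesC c l ->
  is_seriesC c l' -> l = l'.
Proof.
  rewrite !is_series_C_iff. intros [H1 H2] [H3 H4].
  apply injective_projections.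
  - now rewrite <- (is_series_unique _ _ H1), <- (is_series_unique _ _ H3).
  - now rewrite <- (is_series_unique _ _ H2), <- (is_series_unique _ _ H4).
Qed.

Lemma Cpow_RtoC (x : R) (n : nat) : Cpow x n = RtoC (x ^ n).
Proof.
  induction n as [|n IH]; [reflexivity|].
  change (x * Cpow x n = RtoC (x * x ^ n))%C. now rewrite IH, RtoC_mult.
Qed.

Lemma Cpow_S (z : C) (n : nat) : Cpow z (S n) = (z * Cpow z n)%C.
Proof. reflexivity. Qed.

Lemma Cpow_mult (z w : C) (n : nat) : Cpow (z * w) n = (Cpow z n * Cpow w n)%C.
Proof.
  induction n as [|n IH]; [simpl; ring|]. rewrite !Cpow_S, IH. ring.
Qed.

Lemma is_pseries_C (a : nat -> C) (z l : C) :
  is_pseriesC a z l <->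
  is_seriesC (fun n => Cpow z n * a n)%C l.
Proof.
  unfold is_pseries.
  assert (H : forall n, scal (V := C_NormedModule) (pow_n (K := C_AbsRing) z n) (a n) = (Cpow z n * a n)%C).
  { reflexivity. }
  split; apply is_series_ext; intros n; [|symmetry]; apply H.
Qed.

Lemma path_bounded (h : R -> C) (a b : R) : a <= b -> pcont_on h a b ->
  exists M, 0 <= M /\ forall t, a <= t <= b -> Cmod (h t) <= M.
Proof.
  intros Hab Hh.
  destruct (continuity_ab_maj (fun t => Rabs (fst (h t)) + Rabs (snd (h t))) a b Hab) as [x [Hx _]].
  - intros t Ht. destruct (Hh t Ht) as [H1 H2].
    apply continuity_pt_filterlim.
    apply (continuous_plus (V := RV) (fun t => Rabs (fst (h t))) (fun t => Rabs (snd (h t)))).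
    + apply (continuous_comp (fun t => fst (h t)) Rabs); [exact H1|apply continuous_Rabs].
    + apply (continuous_comp (fun t => snd (h t)) Rabs); [exact H2|apply continuous_Rabs].
  - exists (Rabs (fst (h x)) + Rabs (snd (h x))). split.
    + generalize (Rabs_pos (fst (h x))) (Rabs_pos (snd (h x))). lra.
    + intros t Ht. le_trans_by Cmod_le_abs. now apply Hx.
Qed.

Lemma pcont_cis_neg (n : nat) (t : R) : pcont (fun t => cis (- (INR n * t))) t.
Proof.
  apply pcont_ext with (fun t => cis (- INR n * t)); [intros s; f_equal; ring|].
  apply pcont_cis.
Qed.

Local Notation fterm h n := (fun t => h t * cis (- (INR n * t)))%C (only parsing).

(** The kernel is [1 / (1 - w e^{-it})] with [w = z0 / r] of modulus below 1, so its geometric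
    series converges uniformly in [t]. Applied to [h = 1] this gives the index integral; applied to
    the values of [f] on a circle, the Taylor series. *)
Lemma CI_cauchy_kernel (h : R -> C) (r : R) (z0 : C) :
  Cmod z0 < r -> pcont_on h (- PI) PI ->
  is_seriesC
    (fun n => Cpow (z0 / RtoC r) n * CI (fterm h n) (- PI) PI)%C
    (CI (fun t => h t * (r * cis t / (r * cis t - z0)))%C (- PI) PI).
Proof.
  intros Hz0 Hh. assert (HPI := PI_RGT_0). assert (Hz := Cmod_ge_0 z0).
  assert (Hr : RtoC r <> 0%C) by (apply RtoC_neq_0; lra).
  set (w := (z0 / RtoC r)%C). set (rho := Cmod z0 / r).
  assert (Hw : Cmod w = rho).
  { unfold w, rho. rewrite Cmod_div by exact Hr. now rewrite Cmod_R, Rabs_pos_eq by lra. }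
  assert (Hrho : 0 <= rho < 1).
  { unfold rho. split; [apply Rdiv_le_0_compat; lra|].
    apply Rlt_div_l; lra. }
  assert (Hden : forall t, (r * cis t - z0)%C <> 0%C).
  { intros t. apply Cmod_gt_0. eapply Rlt_le_trans; [|apply Cmod_triangle_rev].
    rewrite Cmod_mult, Cmod_cis, Cmod_R, Rabs_pos_eq by lra. lra. }
  assert (Hq : forall t n, (Cpow w n * cis (- (INR n * t)))%C = Cpow (w * cis (- t)) n).
  { intros t n. rewrite Cpow_mult, cis_pow. f_equal. f_equal. ring. }
  assert (Hone : forall t, (1 - w * cis (- t))%C <> 0%C /\
    (r * cis t / (r * cis t - z0) = / (1 - w * cis (- t)))%C).
  { intros t. assert (Hc := cis_neq_0 t). assert (Hd := Hden t).
    assert (He : (1 - w * cis (- t))%C = ((r * cis t - z0) / (r * cis t))%C).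
    { unfold w. rewrite cis_opp. field. split; assumption. }
    rewrite He. split.
    - intros H0. apply Hd.
      replace (r * cis t - z0)%C with ((r * cis t - z0) / (r * cis t) * (r * cis t))%C
        by (field; split; assumption).
      rewrite H0. ring.
    - field. repeat split; assumption. }
  (* With the exact remainder of the geometric sum, only finite sums have to be integrated term by
     term. *)
  assert (Hgeo : forall q M, (1 - q)%C <> 0%C ->
    (/ (1 - q))%C = (sumC (fun n => Cpow q n) M + Cpow q (S M) / (1 - q))%C).
  { intros q M Hne. induction M as [|M IH].
    - rewrite sum_O. simpl. field. exact Hne.
    - rewrite sum_n_C_S. rewrite IH at 1. rewrite (Cpow_S q (S M)). field. exact Hne. }
  assert (Hterm : forall n, pcont_on (fterm h n) (- PI) PI).
  { intros n t Ht. apply pcont_mult; [now apply Hh|apply pcont_cis_neg]. }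
  assert (Hsumc : forall M, pcont_on (fun t => sumC
    (fun n => Cpow w n * (h t * cis (- (INR n * t))))%C M) (- PI) PI).
  { intros M t Ht. induction M as [|M IH].
    - apply pcont_ext with (fun t => Cpow w 0 * (h t * cis (- (INR 0 * t))))%C.
      + intros s. now rewrite sum_O.
      + apply pcont_scal; now apply Hterm.
    - eapply pcont_ext; [intros s; symmetry; apply sum_n_C_S|].
      apply pcont_plus; [exact IH|]. apply pcont_scal; now apply Hterm. }
  assert (Hsum : forall M, sumC (fun n => Cpow w n * CI (fterm h n) (- PI) PI)%C M
    = CI (fun t => sumC (fun n => Cpow w n * (h t * cis (- (INR n * t))))%C M) (- PI) PI).
  { induction M as [|M IH].
    - rewrite sum_O. rewrite <- CI_scal; [|lra|apply Hterm].
      apply CI_ext; [lra|]. intros t _. now rewrite sum_O.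
    - rewrite sum_n_C_S, IH. rewrite <- CI_scal; [|lra|apply Hterm].
      rewrite <- CI_plus; [|lra|apply Hsumc|].
      + apply CI_ext; [lra|]. intros t _. now rewrite sum_n_C_S.
      + intros t Ht. apply pcont_scal; now apply Hterm. }
  assert (Hkc : pcont_on (fun t => h t * (r * cis t / (r * cis t - z0)))%C (- PI) PI).
  { intros t Ht. apply pcont_mult; [now apply Hh|].
    assert (Hrc : pcont (fun t => r * cis t)%C t)
      by (apply pcont_scal; apply pcont_cis1).
    apply pcont_mult; [exact Hrc|]. apply pcont_inv; [|apply Hden].
    apply pcont_minus; [exact Hrc|apply pcont_const]. }
  destruct (path_bounded h (- PI) PI ltac:(lra) Hh) as [B [HB HhB]].
  assert (Hdiff : forall M, Cmod (sumC
     (fun n => Cpow w n * CI (fterm h n) (- PI) PI)%C M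
     - CI (fun t => h t * (r * cis t / (r * cis t - z0)))%C (- PI) PI)
     <= 2 * (2 * PI * (B * (rho ^ S M / (1 - rho))))).
  { intros M. rewrite Hsum. rewrite <- CI_minus; [|lra|apply Hsumc|exact Hkc].
    replace (2 * PI) with (PI - - PI) by ring.
    apply Cmod_CI_le_const; [lra| |].
    - intros t Ht. apply pcont_minus; [now apply Hsumc|now apply Hkc].
    - intros t Ht. destruct (Hone t) as [Hne Heq]. rewrite Heq.
      rewrite (Hgeo _ M Hne).
      assert (Hs : sumC (fun n => Cpow w n * (h t * cis (- (INR n * t))))%C M
        = (h t * sumC (fun n => Cpow (w * cis (- t)) n) M)%C).
      { clear -Hq. induction M as [|M IH].
        - rewrite !sum_O. rewrite <- Hq. C_ring.
        - rewrite !sum_n_C_S, IH, <- Hq. C_ring. }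
      rewrite Hs. replace (h t * _ - _)%C with (- (h t * (Cpow (w * cis (- t)) (S M) / (1 - w * cis (- t)))))%C by ring.
      rewrite Cmod_opp, Cmod_mult, Cmod_div by exact Hne.
      rewrite Cmod_pow, Cmod_mult, Cmod_cis, Hw, Rmult_1_r.
      apply Rmult_le_compat; [apply Cmod_ge_0| |now apply HhB|].
      + apply Rmult_le_pos; [apply pow_le; lra|]. left. apply Rinv_0_lt_compat. now apply Cmod_gt_0.
      + apply Rmult_le_compat_l; [apply pow_le; lra|]. apply Rinv_le_contravar; [lra|].
        eapply Rle_trans; [|apply Cmod_triangle_rev]. rewrite Cmod_1, Cmod_mult, Cmod_cis, Hw. lra. }
  apply is_series_C_eps. intros eps Heps.
  set (K := 2 * (2 * PI * (B * (/ (1 - rho)))) + 1).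
  assert (HK : 0 < K).
  { unfold K. assert (0 < / (1 - rho)) by (apply Rinv_0_lt_compat; lra).
    assert (0 <= B * / (1 - rho)) by (apply Rmult_le_pos; lra). nra. }
  destruct (pow_lt_1_zero rho) with (y := eps / K) as [N HN].
  - rewrite Rabs_pos_eq; lra.
  - now apply Rdiv_lt_0_compat.
  - exists N. intros M HM. lt_trans_by Hdiff.
    specialize (HN (S M) ltac:(lia)). rewrite Rabs_pos_eq in HN by (apply pow_le; lra).
    assert (Hp : 0 <= rho ^ S M) by (apply pow_le; lra).
    apply Rle_lt_trans with (K * rho ^ S M).
    + unfold K. replace (2 * (2 * PI * (B * (rho ^ S M / (1 - rho))))) with
        (2 * (2 * PI * (B * / (1 - rho))) * rho ^ S M) by (field; lra). nra.
    + apply Rmult_lt_compat_l with (r := K) in HN; [|exact HK].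
      replace (K * (eps / K)) with eps in HN by (field; lra). exact HN.
Qed.

Lemma CI_cis_neg (n : nat) : (1 <= n)%nat -> CI (fun t => cis (- (INR n * t))) (- PI) PI = 0%C.
Proof.
  intros Hn. assert (HPI := PI_RGT_0). assert (Hn0 : INR n <> 0) by (apply not_0_INR; lia).
  assert (Hs : forall m, sin (INR m * PI) = 0).
  { induction m as [|m IH]; [simpl; rewrite Rmult_0_l; apply sin_0|].
    rewrite S_INR. replace ((INR m + 1) * PI) with (INR m * PI + PI) by ring.
    rewrite neg_sin, IH. ring. }
  rewrite (CI_ext _ (fun t => cis (- INR n * t))); [|lra|intros t _; f_equal; ring].
  assert (H := CI_cis_derive (- INR n) (- PI) PI).
  rewrite CI_scal in H; [|lra|intros t _; apply pcont_cis].
  set (I := CI _ _ _) in *.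
  assert (Ha : (Ci * RtoC (- INR n))%C <> 0%C).
  { apply Cmod_gt_0. rewrite Cmod_mult, Cmod_Ci, Cmod_R, Rabs_Ropp, Rmult_1_l. now apply Rabs_pos_lt. }
  set (D := (Ci * RtoC (- INR n))%C) in *.
  replace I with (/ D * (D * I))%C by (field; exact Ha).
  rewrite H. replace (- INR n * - PI) with (INR n * PI) by ring.
  replace (- INR n * PI) with (- (INR n * PI)) by ring.
  unfold cis. rewrite cos_neg, sin_neg, Hs, Ropp_0. ring.
Qed.

(** In the expansion of the kernel for the constant function 1 only the term [n = 0] survives. *)
Lemma CI_kernel_one (r : R) (z0 : C) : Cmod z0 < r ->
  CI (fun t => r * cis t / (r * cis t - z0))%C (- PI) PI = RtoC (2 * PI).
Proof.
  intros Hz0. assert (HPI := PI_RGT_0).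
  assert (H := CI_cauchy_kernel (fun _ => 1%C) r z0 Hz0 (fun t _ => pcont_const 1%C t)).
  rewrite (CI_ext (fun t => r * cis t / (r * cis t - z0))%C
    (fun t => 1 * (r * cis t / (r * cis t - z0)))%C); [|lra|intros; ring].
  apply (is_series_C_unique _ _ _ H).
  apply is_series_C_eps. intros eps Heps. exists 0%nat. intros M _.
  assert (Hs : sumC (fun n =>
    (Cpow (z0 / RtoC r) n * CI (fun t => 1 * cis (- (INR n * t))) (- PI) PI)%C) M = RtoC (2 * PI)).
  { assert (Hc : forall n, CI (fun t => 1 * cis (- (INR n * t)))%C (- PI) PI = CI (fun t => cis (- (INR n * t))) (- PI) PI).
    { intros n. apply CI_ext; [lra|]. intros; ring. }
    induction M as [|M IH].
    - rewrite sum_O, Hc. rewrite (CI_ext _ (fun _ => 1%C)); [|lra|].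
      + rewrite CI_const. replace (PI - - PI) with (2 * PI) by ring. simpl Cpow. C_ring.
      + intros t _. simpl INR. rewrite Rmult_0_l, Ropp_0. apply cis_0.
    - rewrite sum_n_C_S, IH, Hc, CI_cis_neg by lia. C_ring. }
  rewrite Hs. unfold Cminus. rewrite Cplus_opp_r. now rewrite Cmod_0.
Qed.

Lemma circle_cont (f : C -> C) (r : R) (a b : R) :
  (forall t, ccont f (r * cis t)%C) -> pcont_on (fun t => f (r * cis t)%C) a b.
Proof.
  intros Hf t _. apply (pcont_comp f (fun t => r * cis t)%C); [apply Hf|].
  apply pcont_scal; apply pcont_cis1.
Qed.

(** Not normalised: when [f] is the sum of [a_n z^n] on a larger disk, this is [2 PI r^n a_n]. *)
Definition fourier (f : C -> C) (r : R) (n : nat) : C :=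
  CI (fun t => f (r * cis t) * cis (- (INR n * t)))%C (- PI) PI.

Lemma Cmod_circle (r t : R) : 0 <= r -> Cmod (r * cis t) = r.
Proof. intros Hr. rewrite Cmod_mult, Cmod_cis, Cmod_R, Rabs_pos_eq by exact Hr. ring. Qed.

(** The factor [Ci] cancels on both sides of [cauchy_homotopy], so the kernel integral is
    [2 PI f z]; it is then expanded in powers of [z / r]. *)
Lemma cdiff_pseries (f : C -> C) (r : R) (z : C) :
  0 < r -> (forall w, Cmod w <= r -> cdiff f w) -> Cmod z < r ->
  is_pseriesC
    (fun n => RtoC (/ (2 * PI * r ^ n)) * fourier f r n)%C z (f z).
Proof.
  intros Hr Hf Hz. assert (HPI := PI_RGT_0).
  assert (H2PI : RtoC (2 * PI) <> 0%C) by (apply RtoC_neq_0; lra).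
  assert (Hrc : RtoC r <> 0%C) by (apply RtoC_neq_0; lra).
  assert (Hcirc : pcont_on (fun t => f (r * cis t)%C) (- PI) PI).
  { apply circle_cont. intros t. apply cdiff_ccont, Hf. rewrite Cmod_circle; lra. }
  assert (Hden : forall t, (r * cis t - z)%C <> 0%C).
  { intros t. apply Cmod_gt_0. eapply Rlt_le_trans; [|apply Cmod_triangle_rev].
    rewrite Cmod_circle by lra. lra. }
  assert (Hk : pcont_on (fun t => r * cis t / (r * cis t - z))%C (- PI) PI).
  { intros t _.
    assert (Hrcc : pcont (fun t => r * cis t)%C t)
      by (apply pcont_scal; apply pcont_cis1).
    apply pcont_mult; [exact Hrcc|]. apply pcont_inv; [|apply Hden].
    apply pcont_minus; [exact Hrcc|apply pcont_const]. }
  assert (Hint : CI (fun t => f (r * cis t) * (r * cis t / (r * cis t - z)))%C (- PI) PI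
    = (RtoC (2 * PI) * f z)%C).
  { assert (H := cauchy_homotopy f r z Hz Hf).
    rewrite (CI_ext (fun t => Ci * r * cis t / (r * cis t - z))%C
      (fun t => Ci * (r * cis t / (r * cis t - z)))%C) in H;
      [|lra|intros t _; unfold Cdiv; ring].
    rewrite CI_scal in H by (lra || exact Hk). rewrite CI_kernel_one in H by exact Hz.
    rewrite (CI_ext _ (fun t => Ci * (f (r * cis t) * (r * cis t / (r * cis t - z))))%C) in H;
      [|lra|intros t _; unfold Cdiv; ring].
    rewrite CI_scal in H; [|lra|].
    2:{ intros t Ht. apply pcont_mult; [now apply Hcirc|now apply Hk]. }
    assert (HCi : Ci <> 0%C) by (apply Cmod_gt_0; rewrite Cmod_Ci; lra).
    set (I := CI _ _ _) in *.
    replace I with (/ Ci * (Ci * I))%C by (field; exact HCi). rewrite H. field. exact HCi. }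
  apply is_pseries_C.
  assert (Hser := CI_cauchy_kernel (fun t => f (r * cis t)%C) r z Hz Hcirc).
  cbn beta in Hser. rewrite Hint in Hser.
  apply (is_series_scal (K := C_AbsRing) (V := C_NormedModule) (/ RtoC (2 * PI))%C) in Hser.
  replace (scal (V := C_NormedModule) (/ RtoC (2 * PI))%C (RtoC (2 * PI) * f z)%C) with (f z) in Hser.
  - revert Hser. apply is_series_ext. intros n.
    change (scal (V := C_NormedModule) ?a ?b) with (Cmult a b).
    change (@eq C (/ RtoC (2 * PI) * (Cpow (z / RtoC r) n * fourier f r n))%C
      (Cpow z n * (RtoC (/ (2 * PI * r ^ n)) * fourier f r n))%C).
    assert (Hrn : r ^ n <> 0) by (apply pow_nonzero; lra).
    replace (Cpow (z / RtoC r) n) with (Cpow z n * RtoC (/ r ^ n))%C.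
    + rewrite <- RtoC_inv by lra.
      replace (/ (2 * PI * r ^ n)) with (/ (2 * PI) * / r ^ n) by (field; lra).
      rewrite RtoC_mult. ring.
    + unfold Cdiv. rewrite Cpow_mult, <- RtoC_inv, Cpow_RtoC by lra. now rewrite pow_inv.
  - change (f z = (/ RtoC (2 * PI) * (RtoC (2 * PI) * f z))%C). field. exact H2PI.
Qed.

Lemma CV_radius_gt (a : nat -> R) (rho x : R) :
  (forall y, 0 < y < rho -> ex_series (fun n => a n * y ^ n)) -> Rabs x < rho ->
  Rbar_lt (Rabs x) (CV_radius a).
Proof.
  intros H Hx. assert (Hp := Rabs_pos x).
  apply Rbar_lt_le_trans with (Finite ((Rabs x + rho) / 2)); [simpl; lra|].
  apply Rbar_not_lt_le. intros Hlt.
  apply (CV_disk_outside a ((Rabs x + rho) / 2)).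
  - rewrite (Rabs_pos_eq ((Rabs x + rho) / 2)) by lra. exact Hlt.
  - apply ex_series_lim_0. apply H. lra.
Qed.

Lemma CV_radius_pos (a : nat -> R) (rho : R) :
  0 < rho -> (forall x, 0 < x < rho -> ex_series (fun n => a n * x ^ n)) ->
  Rbar_lt 0 (CV_radius a).
Proof. intros Hrho H. rewrite <- Rabs_R0. apply (CV_radius_gt a rho); [exact H|now rewrite Rabs_R0]. Qed.

Lemma real_pseries_unique (a b : nat -> R) (F : R -> R) (rho : R) :
  0 < rho ->
  (forall x, Rabs x < rho -> is_series (fun n => a n * x ^ n) (F x)) ->
  (forall x, Rabs x < rho -> is_series (fun n => b n * x ^ n) (F x)) ->
  forall n, a n = b n.
Proof.
  intros Hrho Ha Hb n. apply PSeries_ext_recip.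
  - apply CV_radius_pos with rho; [exact Hrho|]. intros x Hx. eexists. apply Ha.
    rewrite Rabs_pos_eq; lra.
  - apply CV_radius_pos with rho; [exact Hrho|]. intros x Hx. eexists. apply Hb.
    rewrite Rabs_pos_eq; lra.
  - exists (mkposreal rho Hrho). intros x Hx. rewrite !PSeries_sum.
    assert (Hx' : Rabs x < rho).
    { change (Rabs (x - 0) < rho) in Hx. now rewrite Rminus_0_r in Hx. }
    now rewrite (is_series_unique _ _ (Ha x Hx')), (is_series_unique _ _ (Hb x Hx')).
Qed.

Lemma pseries_C_real_arg (a : nat -> C) (x : R) (l : C) :
  is_pseriesC a (RtoC x) l ->
  is_series (fun n => fst (a n) * x ^ n) (fst l) /\ is_series (fun n => snd (a n) * x ^ n) (snd l).
Proof.
  rewrite is_pseries_C, is_series_C_iff. intros [H1 H2]. split.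
  - revert H1. apply is_series_ext. intros n. rewrite Cpow_RtoC. simpl. ring.
  - revert H2. apply is_series_ext. intros n. rewrite Cpow_RtoC. simpl. ring.
Qed.

(** On the real axis the real and imaginary parts of the coefficients separate, which reduces the
    claim to real power series. *)
Lemma pseries_C_unique (a b : nat -> C) (F : C -> C) (rho : R) :
  0 < rho ->
  (forall z, Cmod z < rho -> is_pseriesC a z (F z)) ->
  (forall z, Cmod z < rho -> is_pseriesC b z (F z)) ->
  forall n, a n = b n.
Proof.
  intros Hrho Ha Hb n. apply injective_projections.
  - apply (real_pseries_unique (fun n => fst (a n)) (fun n => fst (b n)) (fun x => fst (F x)) rho Hrho);
      intros x Hx; apply pseries_C_real_arg; [apply Ha|apply Hb]; now rewrite Cmod_R.
  - apply (real_pseries_unique (fun n => snd (a n)) (fun n => snd (b n)) (fun x => snd (F x)) rho Hrho);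
      intros x Hx; apply pseries_C_real_arg; [apply Ha|apply Hb]; now rewrite Cmod_R.
Qed.

Section Taylor.
Context (R0 : R) (F : C -> C).
Hypothesis HR0 : 0 < R0.
Hypothesis HF : forall w, Cmod w < R0 -> cdiff F w.

Lemma fourier_radius_indep (r s : R) (n : nat) : 0 < r <= s -> s < R0 ->
  (RtoC (/ (2 * PI * r ^ n)) * fourier F r n)%C = (RtoC (/ (2 * PI * s ^ n)) * fourier F s n)%C.
Proof.
  intros Hr Hs.
  apply (pseries_C_unique (fun n => RtoC (/ (2 * PI * r ^ n)) * fourier F r n)%C
    (fun n => RtoC (/ (2 * PI * s ^ n)) * fourier F s n)%C F r); [lra| |];
    intros z Hz; apply cdiff_pseries; try lra; intros w Hw; apply HF; lra.
Qed.

(** [taylor] is a chosen sequence, so one sequence valid on the whole disk must be exhibited: the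
    coefficients at radius [R0 / 2] serve, because they agree with those at a radius [s] beyond
    [|z|]. *)
Lemma taylor_correct (z : C) : Cmod z < R0 ->
  is_pseriesC (taylor R0 F) z (F z).
Proof.
  revert z. unfold taylor. apply epsilon_spec.
  exists (fun n => RtoC (/ (2 * PI * (R0 / 2) ^ n)) * fourier F (R0 / 2) n)%C.
  intros z Hz. assert (Hz0 := Cmod_ge_0 z).
  set (s := Rmax (R0 / 2) ((Cmod z + R0) / 2)).
  assert (Hs : R0 / 2 <= s < R0 /\ Cmod z < s).
  { unfold s. assert (H1 := Rmax_l (R0 / 2) ((Cmod z + R0) / 2)).
    assert (H2 := Rmax_r (R0 / 2) ((Cmod z + R0) / 2)).
    repeat split; [exact H1|apply Rmax_lub_lt; lra|lra]. }
  assert (H := cdiff_pseries F s z ltac:(lra) (fun w Hw => HF w (Rle_lt_trans _ _ _ Hw (proj2 (proj1 Hs)))) (proj2 Hs)).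
  rewrite is_pseries_C in *. revert H. apply is_series_ext. intros n.
  now rewrite (fourier_radius_indep (R0 / 2) s n) by lra.
Qed.

Lemma taylor_fourier (r : R) (n : nat) : 0 < r < R0 ->
  taylor R0 F n = (RtoC (/ (2 * PI * r ^ n)) * fourier F r n)%C.
Proof.
  intros Hr.
  apply (pseries_C_unique (taylor R0 F) (fun n => RtoC (/ (2 * PI * r ^ n)) * fourier F r n)%C F r); [lra| |].
  - intros z Hz. apply taylor_correct. lra.
  - intros z Hz. apply cdiff_pseries; [lra| |exact Hz]. intros w Hw. apply HF. lra.
Qed.
End Taylor.

(** * Complex differentiability *)

(** Continuity relative to [D]: at a boundary point nothing is known of [f] outside the closed
    disk. *)
Definition cont_in (D : C -> Prop) (f : C -> C) (z : C) : Prop :=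
  forall eps, 0 < eps -> exists delta, 0 < delta /\
    forall w, D w -> Cmod (w - z) < delta -> Cmod (f w - f z) < eps.

Lemma ccont_cont_in (D : C -> Prop) (f : C -> C) (z : C) : ccont f z -> cont_in D f z.
Proof.
  intros H eps Heps. destruct (H eps Heps) as [d [Hd H']]. exists d. split; auto.
Qed.

Lemma cont_in_ccont (f : C -> C) (z : C) : cont_in (fun _ => True) f z -> ccont f z.
Proof.
  intros H eps Heps. destruct (H eps Heps) as [d [Hd H']]. exists d. split; auto.
Qed.

Lemma cont_in_const (D : C -> Prop) (c z : C) : cont_in D (fun _ => c) z.
Proof.
  intros eps Heps. exists 1. split; [lra|]. intros w _ _. unfold Cminus. now rewrite Cplus_opp_r, Cmod_0.
Qed.

Lemma cont_in_plus (D : C -> Prop) (f g : C -> C) (z : C) :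
  cont_in D f z -> cont_in D g z -> cont_in D (fun w => f w + g w)%C z.
Proof.
  intros Hf Hg eps Heps.
  destruct (Hf (eps / 2) ltac:(lra)) as [d1 [Hd1 H1]].
  destruct (Hg (eps / 2) ltac:(lra)) as [d2 [Hd2 H2]].
  exists (Rmin d1 d2). split; [now apply Rmin_pos|]. intros w Hw Hwz.
  specialize (H1 w Hw (lt_Rmin_l Hwz)).
  specialize (H2 w Hw (lt_Rmin_r Hwz)).
  replace (f w + g w - (f z + g z))%C with ((f w - f z) + (g w - g z))%C by ring.
  lt_trans_by Cmod_triangle. lra.
Qed.

Lemma cont_in_mult (D : C -> Prop) (f g : C -> C) (z : C) :
  cont_in D f z -> cont_in D g z -> cont_in D (fun w => f w * g w)%C z.
Proof.
  intros Hf Hg eps Heps.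
  assert (Hfz := Cmod_ge_0 (f z)). assert (Hgz := Cmod_ge_0 (g z)).
  set (K := Cmod (f z) + Cmod (g z) + 1).
  assert (HK : 0 < K) by (unfold K; lra).
  set (e := Rmin 1 (eps / (2 * K))).
  assert (He : 0 < e) by (apply Rmin_pos; [lra|apply Rdiv_lt_0_compat; lra]).
  destruct (Hf e He) as [d1 [Hd1 H1]]. destruct (Hg e He) as [d2 [Hd2 H2]].
  exists (Rmin d1 d2). split; [now apply Rmin_pos|]. intros w Hw Hwz.
  specialize (H1 w Hw (lt_Rmin_l Hwz)).
  specialize (H2 w Hw (lt_Rmin_r Hwz)).
  replace (f w * g w - f z * g z)%C with
    ((f w - f z) * (g w - g z) + (f w - f z) * g z + f z * (g w - g z))%C by ring.
  lt_trans_by Cmod_triangle.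
  eapply Rle_lt_trans; [apply Rplus_le_compat_r, Cmod_triangle|].
  rewrite !Cmod_mult.
  assert (H3 := Cmod_ge_0 (f w - f z)). assert (H4 := Cmod_ge_0 (g w - g z)).
  assert (He1 : e <= 1) by apply Rmin_l.
  assert (HeK : e * K <= eps / 2).
  { apply Rle_trans with (eps / (2 * K) * K).
    - apply Rmult_le_compat_r; [lra|apply Rmin_r].
    - right. field. lra. }
  apply Rle_lt_trans with (e * K); [|lra]. unfold K.
  assert (Cmod (f w - f z) * Cmod (g w - g z) <= e * 1) by (apply Rmult_le_compat; lra).
  assert (Cmod (f w - f z) * Cmod (g z) <= e * Cmod (g z)) by (apply Rmult_le_compat_r; lra).
  assert (Cmod (f z) * Cmod (g w - g z) <= Cmod (f z) * e) by (apply Rmult_le_compat_l; lra).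
  lra.
Qed.

Lemma cont_in_comp (D : C -> Prop) (f g : C -> C) (z : C) :
  ccont f (g z) -> cont_in D g z -> cont_in D (fun w => f (g w)) z.
Proof.
  intros Hf Hg eps Heps. destruct (Hf eps Heps) as [d [Hd H]].
  destruct (Hg d Hd) as [d' [Hd' H']]. exists d'. split; [exact Hd'|].
  intros w Hw Hwz. apply H. now apply H'.
Qed.

(** Differentiability becomes continuity of the slope function [phi], so that the rules for sums,
    products and compositions reduce to algebra. *)
Lemma cdiff_caratheodory (f : C -> C) (z : C) :
  cdiff f z <-> exists phi, ccont phi z /\ forall w, (f w - f z = phi w * (w - z))%C.
Proof.
  split.
  - intros [l Hl].
    exists (fun w => if excluded_middle_informative (w = z) then l else ((f w - f z) / (w - z))%C).
    split.
    + intros eps Heps. destruct (Hl (eps / 2) ltac:(lra)) as [d [Hd H]].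
      exists d. split; [exact Hd|]. intros w Hw.
      destruct (excluded_middle_informative (z = z)) as [_|Hn]; [|now contradiction Hn].
      destruct (excluded_middle_informative (w = z)) as [_|Hwz].
      * unfold Cminus. rewrite Cplus_opp_r, Cmod_0. exact Heps.
      * assert (Hne : (w - z)%C <> 0%C).
        { intros H0. apply Hwz. replace w with (w - z + z)%C by ring. rewrite H0. ring. }
        assert (Hpos := proj1 (Cmod_gt_0 _) Hne).
        replace ((f w - f z) / (w - z) - l)%C with ((f w - f z - l * (w - z)) / (w - z))%C by (field; exact Hne).
        rewrite Cmod_div by exact Hne. apply Rle_lt_trans with (eps / 2); [|lra].
        apply Rle_div_l; [exact Hpos|now apply H].
    + intros w. destruct (excluded_middle_informative (w = z)) as [->|Hwz].
      * ring.
      * field. intros H0. apply Hwz. replace w with (w - z + z)%C by ring. rewrite H0. ring.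
  - intros [phi [Hphi Heq]]. exists (phi z). intros eps Heps.
    destruct (Hphi eps Heps) as [d [Hd H]]. exists d. split; [exact Hd|].
    intros w Hw. rewrite Heq.
    replace (phi w * (w - z) - phi z * (w - z))%C with ((phi w - phi z) * (w - z))%C by ring.
    rewrite Cmod_mult. apply Rmult_le_compat_r; [apply Cmod_ge_0|]. left. now apply H.
Qed.

Lemma cdiff_const (c z : C) : cdiff (fun _ => c) z.
Proof.
  apply cdiff_caratheodory. exists (fun _ => 0%C). split.
  - apply cont_in_ccont, cont_in_const.
  - intros w. ring.
Qed.

Lemma cdiff_plus (f g : C -> C) (z : C) : cdiff f z -> cdiff g z -> cdiff (fun w => f w + g w)%C z.
Proof.
  rewrite !cdiff_caratheodory. intros [p [Hp Hf]] [q [Hq Hg]].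
  exists (fun w => p w + q w)%C. split.
  - apply cont_in_ccont, cont_in_plus; now apply ccont_cont_in.
  - intros w. replace (f w + g w - (f z + g z))%C with ((f w - f z) + (g w - g z))%C by ring.
    rewrite Hf, Hg. ring.
Qed.

Lemma cdiff_mult (f g : C -> C) (z : C) : cdiff f z -> cdiff g z -> cdiff (fun w => f w * g w)%C z.
Proof.
  intros Hcf Hcg. assert (Hcont := cdiff_ccont g z Hcg). revert Hcf Hcg.
  rewrite !cdiff_caratheodory. intros [p [Hp Hf]] [q [Hq Hg]].
  exists (fun w => p w * g w + f z * q w)%C. split.
  - apply cont_in_ccont, cont_in_plus; apply cont_in_mult;
      try (now apply ccont_cont_in); apply cont_in_const.
  - intros w. replace (f w * g w - f z * g z)%C with ((f w - f z) * g w + f z * (g w - g z))%C by ring.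
    rewrite Hf, Hg. ring.
Qed.

Lemma cdiff_comp (f g : C -> C) (z : C) : cdiff f (g z) -> cdiff g z -> cdiff (fun w => f (g w)) z.
Proof.
  intros Hcf Hcg. assert (Hcont := cdiff_ccont g z Hcg). revert Hcf Hcg.
  rewrite !cdiff_caratheodory. intros [p [Hp Hf]] [q [Hq Hg]].
  exists (fun w => p (g w) * q w)%C. split.
  - apply cont_in_ccont, cont_in_mult; [|now apply ccont_cont_in].
    apply cont_in_comp; [exact Hp|now apply ccont_cont_in].
  - intros w. rewrite Hf, Hg. ring.
Qed.

Lemma cdiff_ext_disk (f g : C -> C) (rho : R) (z : C) :
  (forall w, Cmod w < rho -> f w = g w) -> Cmod z < rho -> cdiff f z -> cdiff g z.
Proof.
  intros Hfg Hz [l Hl]. exists l. intros eps Heps. destruct (Hl eps Heps) as [d [Hd H]].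
  exists (Rmin d (rho - Cmod z)). split; [apply Rmin_pos; lra|]. intros w Hw.
  assert (Hw2 : Cmod w < rho).
  { assert (H2 := lt_Rmin_r Hw). assert (H3 := Cmod_triangle_rev w z). lra. }
  rewrite <- !Hfg by assumption. apply H. eapply Rlt_le_trans; [exact Hw|apply Rmin_l].
Qed.

Lemma ex_derive_cdiff (f : C -> C) (z : C) :
  ex_derive (K := C_AbsRing) (V := C_NormedModule) f z -> cdiff f z.
Proof.
  intros [l [_ Hl]]. exists l. intros eps Heps.
  destruct (Hl z (fun P HP => HP) (mkposreal eps Heps)) as [d Hd].
  exists d. split; [apply cond_pos|]. intros w Hw.
  specialize (Hd w Hw).
  change (Cmod (f w - f z - (w - z) * l) <= eps * Cmod (w - z)) in Hd.
  now rewrite (Cmult_comm l).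
Qed.

(** * The complex exponential *)

Lemma Cexp_plus (a b : C) : Cexp (a + b) = (Cexp a * Cexp b)%C.
Proof.
  unfold Cexp, Cmult; simpl. rewrite exp_plus, cos_plus, sin_plus. f_equal; ring.
Qed.

Lemma Cmod_Cexp (a : C) : Cmod (Cexp a) = exp (fst a).
Proof.
  replace (Cexp a) with (RtoC (exp (fst a)) * cis (snd a))%C.
  - rewrite Cmod_mult, Cmod_cis, Cmod_R, Rabs_pos_eq by (left; apply exp_pos). ring.
  - unfold Cexp, cis, RtoC, Cmult; simpl. f_equal; ring.
Qed.

Lemma exp_taylor1 (x : R) : Rabs x <= / 2 -> 0 <= exp x - 1 - x <= 2 * x ^ 2.
Proof.
  intros Hx. apply Rabs_le_between in Hx. split; [generalize (exp_ineq1_le x); lra|].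
  assert (H := exp_ineq1_le (- x)). rewrite exp_Ropp in H.
  assert (Hp := exp_pos x).
  assert (H1 : exp x * (1 - x) <= 1).
  { apply Rmult_le_compat_l with (r := exp x) in H; [|lra]. rewrite Rinv_r in H by lra. lra. }
  (* The product is [1 + x^2 (1 - 2 x)]; thus [1 / (1 - x) <= 1 + x + 2 x^2]. *)
  assert (H2 : (1 + x + 2 * x ^ 2) * (1 - x) >= 1) by nra. nra.
Qed.

Lemma Cexp_taylor1 (h : C) : Cmod h <= / 2 -> Cmod (Cexp h - 1 - h) <= 12 * Cmod h ^ 2.
Proof.
  intros Hh. set (m := Cmod h) in *.
  assert (Hm := Cmod_ge_0 h). fold m in Hm.
  assert (Hx := Rabs_fst_le_Cmod h). assert (Hy := Rabs_snd_le_Cmod h). fold m in Hx, Hy.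
  destruct h as [x y]. simpl in Hx, Hy. clearbody m.
  assert (Hx2 : Rabs x ^ 2 <= m ^ 2) by (apply pow_incr; split; [apply Rabs_pos|exact Hx]).
  assert (Hy2 : Rabs y ^ 2 <= m ^ 2) by (apply pow_incr; split; [apply Rabs_pos|exact Hy]).
  assert (Hxx := Rabs_pos x). assert (Hyy := Rabs_pos y).
  assert (He := exp_taylor1 x ltac:(lra)). rewrite (Rabs_sq x) in He.
  assert (Hc1 := cos_ge_parabola y). rewrite (Rabs_sq y) in Hc1.
  assert (Hcb := COS_bound y). assert (Hsb := SIN_bound y).
  assert (Hs : Rabs (sin y - y) <= 2 * m ^ 2).
  { le_trans_by sin_taylor1. rewrite (Rabs_sq y).
    assert (Rmin 1 (Rabs y) <= 1) by apply Rmin_l. nra. }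
  assert (Hs0 : Rabs (sin y) <= m).
  { replace (sin y) with (sin y - sin 0) by (rewrite sin_0; ring).
    assert (H := Rabs_snd_le_Cmod (cis y - cis 0)). simpl in H.
    eapply Rle_trans; [exact H|]. le_trans_by Cmod_cis_minus_le. now rewrite Rminus_0_r. }
  assert (He1 : Rabs (exp x - 1) <= 2 * m).
  { apply Rabs_le. apply Rabs_le_between in Hx. nra. }
  le_trans_by Cmod_le_abs. simpl fst; simpl snd.
  assert (H1 : Rabs (exp x * cos y + - (1) + - x) <= 4 * m ^ 2).
  { replace (exp x * cos y + - (1) + - x) with ((exp x - 1 - x) * cos y + (1 + x) * (cos y - 1)) by ring.
    apply Rabs_le. apply Rabs_le_between in Hx.
    assert (0 <= 1 + x <= 2) by lra.
    assert (Rabs ((exp x - 1 - x) * cos y) <= 2 * m ^ 2).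
    { rewrite Rabs_mult, Rabs_pos_eq by lra.
      assert (Rabs (cos y) <= 1) by (apply Rabs_le; lra). assert (0 <= Rabs (cos y)) by apply Rabs_pos. nra. }
    apply Rabs_le_between in H0. nra. }
  assert (H2 : Rabs (exp x * sin y + - 0 + - y) <= 4 * m ^ 2).
  { replace (exp x * sin y + - 0 + - y) with ((exp x - 1) * sin y + (sin y - y)) by ring.
    le_trans_by Rabs_triang. rewrite Rabs_mult.
    assert (0 <= Rabs (exp x - 1)) by apply Rabs_pos. assert (0 <= Rabs (sin y)) by apply Rabs_pos. nra. }
  nra.
Qed.

Lemma cdiff_Cexp (a : C) : cdiff Cexp a.
Proof.
  exists (Cexp a). intros eps Heps. set (K := Cmod (Cexp a)).
  assert (HK : 0 <= K) by apply Cmod_ge_0.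
  exists (Rmin (/ 2) (eps / (12 * K + 1))). split.
  - apply Rmin_pos; [lra|]. apply Rdiv_lt_0_compat; lra.
  - intros w Hw. set (h := (w - a)%C) in *. replace w with (a + h)%C by (unfold h; ring).
    rewrite Cexp_plus.
    replace (Cexp a * Cexp h - Cexp a - Cexp a * h)%C with (Cexp a * (Cexp h - 1 - h))%C by ring.
    rewrite Cmod_mult. fold K.
    assert (H1 := lt_Rmin_l Hw). assert (H2 := lt_Rmin_r Hw).
    assert (H3 := Cexp_taylor1 h (Rlt_le _ _ H1)). assert (Hh := Cmod_ge_0 h).
    assert (H4 : Cmod h * (12 * K + 1) <= eps).
    { apply Rlt_div_r in H2; lra. }
    apply Rle_trans with (K * (12 * Cmod h ^ 2)); [apply Rmult_le_compat_l; lra|]. nra.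
Qed.

Lemma filterlim_cont_in (D : C -> Prop) (f : C -> C) (z : C) :
  filterlim f (within D (locally z)) (locally (f z)) -> cont_in D f z.
Proof.
  intros H eps Heps. assert (He : 0 < eps / 2) by lra.
  destruct (proj1 (filterlim_locally f (f z)) H (mkposreal _ He)) as [d Hd].
  exists d. split; [apply cond_pos|]. intros w Hw Hwz.
  (* Balls of the product uniform structure are squares, and the disk lies in the square. *)
  assert (Hball : ball (z : C_UniformSpace) d w).
  { split.
    - exact (Rle_lt_trans _ _ _ (Rabs_fst_minus _ _) Hwz).
    - exact (Rle_lt_trans _ _ _ (Rabs_snd_minus _ _) Hwz). }
  destruct (Hd w Hball Hw) as [H1 H2].
  change (Rabs (fst (f w) - fst (f z)) < eps / 2) in H1.
  change (Rabs (snd (f w) - snd (f z)) < eps / 2) in H2.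
  lt_trans_by Cmod_minus_le_abs. lra.
Qed.

(** * Power series on the closed disk *)

Definition CSer (d : nat -> C) : C :=
  (Series (fun n => fst (d n)), Series (fun n => snd (d n))).

Lemma ex_series_fst (d : nat -> C) (b : nat -> R) :
  (forall n, Cmod (d n) <= b n) -> ex_series b -> ex_series (fun n => fst (d n)).
Proof.
  intros H. apply ex_series_dominated. intros n.
  eapply Rle_trans; [apply Rabs_fst_le_Cmod|apply H].
Qed.

Lemma ex_series_snd (d : nat -> C) (b : nat -> R) :
  (forall n, Cmod (d n) <= b n) -> ex_series b -> ex_series (fun n => snd (d n)).
Proof.
  intros H. apply ex_series_dominated. intros n.
  eapply Rle_trans; [apply Rabs_snd_le_Cmod|apply H].
Qed.

Lemma CSer_correct (d : nat -> C) (b : nat -> R) :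
  (forall n, Cmod (d n) <= b n) -> ex_series b ->
  is_seriesC d (CSer d).
Proof.
  intros H Hb. apply is_series_C_iff. split; simpl; apply Series_correct.
  - now apply ex_series_fst with b.
  - now apply ex_series_snd with b.
Qed.

Lemma Cmod_CSer_le (d : nat -> C) (b : nat -> R) :
  (forall n, Cmod (d n) <= b n) -> ex_series b -> Cmod (CSer d) <= 2 * Series b.
Proof.
  intros H Hb. le_trans_by Cmod_le_abs. unfold CSer; simpl.
  assert (Rabs (Series (fun n => fst (d n))) <= Series b).
  { apply Rabs_Series_le; [|exact Hb]. intros n. eapply Rle_trans; [apply Rabs_fst_le_Cmod|apply H]. }
  assert (Rabs (Series (fun n => snd (d n))) <= Series b).
  { apply Rabs_Series_le; [|exact Hb]. intros n. eapply Rle_trans; [apply Rabs_snd_le_Cmod|apply H]. }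
  lra.
Qed.

Lemma CSer_minus (d e : nat -> C) (b b' : nat -> R) :
  (forall n, Cmod (d n) <= b n) -> ex_series b ->
  (forall n, Cmod (e n) <= b' n) -> ex_series b' ->
  (CSer d - CSer e)%C = CSer (fun n => d n - e n)%C.
Proof.
  intros Hd Hb He Hb'. unfold CSer. apply injective_projections; symmetry.
  - exact (Series_minus _ _ (ex_series_fst d b Hd Hb) (ex_series_fst e b' He Hb')).
  - exact (Series_minus _ _ (ex_series_snd d b Hd Hb) (ex_series_snd e b' He Hb')).
Qed.

Lemma CSer_ext (d e : nat -> C) : (forall n, d n = e n) -> CSer d = CSer e.
Proof. intros H. unfold CSer. f_equal; apply Series_ext; intros n; now rewrite H. Qed.

Lemma CSer_scal (x : C) (d : nat -> C) (b : nat -> R) :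
  (forall n, Cmod (d n) <= b n) -> ex_series b -> CSer (fun n => x * d n)%C = (x * CSer d)%C.
Proof.
  intros Hd Hb.
  assert (H := is_series_scal (K := C_AbsRing) (V := C_NormedModule) x d _ (CSer_correct d b Hd Hb)).
  apply (is_series_C_unique (fun n => x * d n)%C); [|exact H].
  apply CSer_correct with (fun n => Cmod x * b n).
  - intros n. rewrite Cmod_mult. apply Rmult_le_compat_l; [apply Cmod_ge_0|apply Hd].
  - now apply ex_series_scal_R.
Qed.

(** Both sides carry an extra factor [rho], which avoids the exponent [n - 1]. *)
Lemma Cpow_minus_le (z w : C) (rho : R) (n : nat) :
  Cmod z <= rho -> Cmod w <= rho ->
  rho * Cmod (Cpow z n - Cpow w n) <= INR n * rho ^ n * Cmod (z - w).
Proof.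
  intros Hz Hw. assert (Hr : 0 <= rho) by (generalize (Cmod_ge_0 z); lra).
  induction n as [|n IH].
  - simpl Cpow. replace (RtoC 1 - RtoC 1)%C with (RtoC 0) by ring. rewrite Cmod_0. simpl. lra.
  - rewrite !Cpow_S.
    replace (z * Cpow z n - w * Cpow w n)%C with (z * (Cpow z n - Cpow w n) + (z - w) * Cpow w n)%C by ring.
    assert (H := Cmod_triangle (z * (Cpow z n - Cpow w n)) ((z - w) * Cpow w n)).
    rewrite !Cmod_mult, Cmod_pow in H.
    assert (H1 : Cmod w ^ n <= rho ^ n) by (apply pow_incr; split; [apply Cmod_ge_0|exact Hw]).
    assert (H2 := Cmod_ge_0 (z - w)). assert (H3 := Cmod_ge_0 (Cpow z n - Cpow w n)).
    assert (Hz0 := Cmod_ge_0 z).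
    rewrite S_INR. change (rho ^ S n) with (rho * rho ^ n).
    apply Rle_trans with (rho * (rho * Cmod (Cpow z n - Cpow w n) + Cmod (z - w) * rho ^ n)).
    + apply Rmult_le_compat_l; [exact Hr|]. eapply Rle_trans; [exact H|].
      apply Rplus_le_compat; [now apply Rmult_le_compat_r|now apply Rmult_le_compat_l].
    + nra.
Qed.

Lemma Cmod_pow_le (z : C) (rho : R) (n : nat) : Cmod z <= rho -> Cmod (Cpow z n) <= rho ^ n.
Proof. intros H. rewrite Cmod_pow. apply pow_incr. split; [apply Cmod_ge_0|exact H]. Qed.

(** The derivative [n z^(n-1)], generated by the product rule so that no truncated exponent appears
    at [n = 0]. *)
Fixpoint Cpow_der (z : C) (n : nat) : C :=
  match n with O => 0%C | S m => (Cpow z m + z * Cpow_der z m)%C end.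

Lemma Cmod_Cpow_der_le (z : C) (rho : R) (n : nat) :
  Cmod z <= rho -> rho * Cmod (Cpow_der z n) <= INR n * rho ^ n.
Proof.
  intros Hz. assert (Hr : 0 <= rho) by (generalize (Cmod_ge_0 z); lra).
  induction n as [|n IH].
  - simpl. rewrite Cmod_0. lra.
  - simpl Cpow_der. rewrite S_INR. change (rho ^ S n) with (rho * rho ^ n).
    assert (H := Cmod_triangle (Cpow z n) (z * Cpow_der z n)). rewrite Cmod_mult in H.
    assert (H1 := Cmod_pow_le z rho n Hz). assert (H2 := Cmod_ge_0 (Cpow_der z n)).
    assert (Hz0 := Cmod_ge_0 z).
    apply Rle_trans with (rho * (rho ^ n + rho * Cmod (Cpow_der z n))); [|nra].
    apply Rmult_le_compat_l; [exact Hr|]. eapply Rle_trans; [exact H|].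
    apply Rplus_le_compat; [exact H1|now apply Rmult_le_compat_r].
Qed.

Lemma Cpow_taylor1 (z w : C) (rho : R) (n : nat) :
  Cmod z <= rho -> Cmod w <= rho ->
  rho ^ 2 * Cmod (Cpow w n - Cpow z n - Cpow_der z n * (w - z)) <=
  INR n ^ 2 * rho ^ n * Cmod (w - z) ^ 2.
Proof.
  intros Hz Hw. assert (Hr : 0 <= rho) by (generalize (Cmod_ge_0 z); lra).
  induction n as [|n IH].
  - simpl Cpow. simpl Cpow_der. replace (RtoC 1 - RtoC 1 - 0 * (w - z))%C with (RtoC 0) by ring.
    rewrite Cmod_0. simpl. lra.
  - rewrite !Cpow_S. simpl Cpow_der.
    set (D := (Cpow w n - Cpow z n - Cpow_der z n * (w - z))%C) in *.
    replace (w * Cpow w n - z * Cpow z n - (Cpow z n + z * Cpow_der z n) * (w - z))%C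
      with (z * D + (w - z) * (Cpow w n - Cpow z n))%C by (unfold D; ring).
    assert (H := Cmod_triangle (z * D) ((w - z) * (Cpow w n - Cpow z n))).
    rewrite !Cmod_mult in H.
    assert (H1 := Cpow_minus_le w z rho n Hw Hz). assert (H2 := Cmod_ge_0 D).
    assert (H3 := Cmod_ge_0 (w - z)). assert (Hn := pos_INR n).
    assert (Hp : 0 <= rho ^ n) by now apply pow_le.
    set (m := Cmod (w - z)) in *. set (e := Cmod (Cpow w n - Cpow z n)) in *.
    rewrite S_INR. change (rho ^ S n) with (rho * rho ^ n).
    apply Rle_trans with (rho ^ 2 * (rho * Cmod D + m * e)).
    + apply Rmult_le_compat_l; [nra|]. eapply Rle_trans; [exact H|].
      apply Rplus_le_compat_r. now apply Rmult_le_compat_r.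
    + apply Rle_trans with (rho * (INR n ^ 2 * rho ^ n * m ^ 2) + rho * m * (INR n * rho ^ n * m)).
      * replace (rho ^ 2 * (rho * Cmod D + m * e)) with (rho * (rho ^ 2 * Cmod D) + rho * m * (rho * e)) by ring.
        apply Rplus_le_compat; apply Rmult_le_compat_l; auto. nra.
      * replace (rho * (INR n ^ 2 * rho ^ n * m ^ 2) + rho * m * (INR n * rho ^ n * m))
          with ((INR n ^ 2 + INR n) * (rho * rho ^ n * m ^ 2)) by ring.
        replace ((INR n + 1) ^ 2 * (rho * rho ^ n) * m ^ 2) with ((INR n + 1) ^ 2 * (rho * rho ^ n * m ^ 2)) by ring.
        apply Rmult_le_compat_r; [|nra].
        apply Rmult_le_pos; [now apply Rmult_le_pos|]. apply pow2_ge_0.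
Qed.

(** Bernoulli's inequality for the powers of [1 / x = 1 + d]. *)
Lemma INR_pow_bounded (x : R) : 0 <= x < 1 -> exists B, forall n, INR n * x ^ n <= B.
Proof.
  intros [[Hx|<-] Hx1].
  - set (d := / x - 1). assert (Hd : 0 < d).
    { unfold d. assert (/ 1 < / x) by (apply Rinv_lt_contravar; lra). lra. }
    exists (/ d). intros n. assert (H := poly n d Hd).
    replace (1 + d) with (/ x) in H by (unfold d; ring). rewrite pow_inv in H.
    assert (Hxn : 0 < x ^ n) by now apply pow_lt.
    assert (H1 : INR n * d <= / x ^ n) by lra.
    apply Rmult_le_reg_r with d; [exact Hd|]. rewrite Rinv_l by lra.
    apply Rmult_le_compat_r with (r := x ^ n) in H1; [|lra]. rewrite Rinv_l in H1 by lra. lra.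
  - exists 0. intros [|n]; simpl; lra.
Qed.

Lemma INR_sq_pow_bounded (x : R) : 0 <= x < 1 -> exists B, 0 <= B /\ forall n, INR n ^ 2 * x ^ n <= B.
Proof.
  intros Hx. assert (Hs := sqrt_pos x). assert (Hss := sqrt_sqrt x (proj1 Hx)).
  destruct (INR_pow_bounded (sqrt x)) as [B HB].
  - split; [exact Hs|]. nra.
  - exists (B ^ 2). split; [apply pow2_ge_0|]. intros n. rewrite <- Hss at 1.
    rewrite Rpow_mult_distr.
    replace (INR n ^ 2 * (sqrt x ^ n * sqrt x ^ n)) with ((INR n * sqrt x ^ n) ^ 2) by ring.
    apply pow_incr. split; [|apply HB]. apply Rmult_le_pos; [apply pos_INR|]. now apply pow_le.
Qed.

Section ClosedDisk.
Context (c : nat -> R) (R0 : R).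
Hypothesis Hc : forall n, 0 <= c n.
Hypothesis HR0 : 0 < R0.
Hypothesis Hex : ex_series (fun n => c n * R0 ^ n).

(** An explicit sum in place of the chosen value [Cpsum]; the two agree on the closed disk by
    [Cpsum_gbar]. *)
Definition gbar (z : C) : C := CSer (fun n => (c n) * Cpow z n)%C.

Lemma gbar_term (z : C) (rho : R) (n : nat) : Cmod z <= rho ->
  Cmod ((c n) * Cpow z n) <= c n * rho ^ n.
Proof.
  intros Hz. rewrite Cmod_scale by apply Hc.
  apply Rmult_le_compat_l; [apply Hc|now apply Cmod_pow_le].
Qed.

Lemma gbar_series (z : C) : Cmod z <= R0 ->
  is_seriesC (fun n => (c n) * Cpow z n)%C (gbar z).
Proof.
  intros Hz. apply CSer_correct with (fun n => c n * R0 ^ n); [|exact Hex].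
  intros n. now apply gbar_term.
Qed.

Lemma Cpsum_gbar (z : C) : Cmod z <= R0 -> Cpsum (fun n => RtoC (c n)) z = gbar z.
Proof.
  intros Hz.
  assert (H : is_pseriesC (fun n => RtoC (c n)) z (gbar z)).
  { apply is_pseries_C. generalize (gbar_series z Hz). apply is_series_ext. intros n. C_ring. }
  assert (H' := epsilon_spec (inhabits (RtoC 0)) _ (ex_intro _ _ H)).
  change (is_pseriesC (fun n => RtoC (c n)) z
    (Cpsum (fun n => RtoC (c n)) z)) in H'.
  rewrite is_pseries_C in H. rewrite is_pseries_C in H'.
  exact (is_series_C_unique _ _ _ H' H).
Qed.

Lemma gbar_minus (z w : C) : Cmod z <= R0 -> Cmod w <= R0 ->
  (gbar z - gbar w)%C = CSer (fun n => (c n) * (Cpow z n - Cpow w n))%C.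
Proof.
  intros Hz Hw. unfold gbar.
  rewrite (CSer_minus _ _ (fun n => c n * R0 ^ n) (fun n => c n * R0 ^ n)); auto using gbar_term.
  apply CSer_ext. intros n. ring.
Qed.

(** Since [|z^n - w^n| <= 2 R0^n min(1, n |z - w| / R0)], [modulus_small] applies; its threshold
    [eta / 4] pays for this 2 and for the 2 of [Cmod_CSer_le]. *)
Lemma gbar_unif (eta : R) : 0 < eta -> exists delta, 0 < delta /\
  forall z w, Cmod z <= R0 -> Cmod w <= R0 -> Cmod (z - w) < delta -> Cmod (gbar z - gbar w) <= eta.
Proof.
  intros Heta.
  destruct (modulus_small (fun n => c n * R0 ^ n)) with (eta := eta / 4) as [d [Hd H]].
  - intros n. apply Rmult_le_pos; [apply Hc|apply pow_le; lra].
  - exact Hex.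
  - lra.
  - exists (d * R0). split; [now apply Rmult_lt_0_compat|]. intros z w Hz Hw Hzw.
    rewrite gbar_minus by assumption.
    set (tau := Cmod (z - w) / R0).
    assert (Htau : 0 <= tau < d).
    { unfold tau. split; [apply Rdiv_le_0_compat; [apply Cmod_ge_0|exact HR0]|].
      apply Rlt_div_l; lra. }
    specialize (H tau Htau).
    set (b := fun n => 2 * (c n * R0 ^ n * Rmin 1 (INR n * tau))).
    apply Rle_trans with (2 * Series b).
    + apply Cmod_CSer_le.
      * intros n. rewrite Cmod_scale by apply Hc. unfold b.
        replace (2 * (c n * R0 ^ n * Rmin 1 (INR n * tau))) with (c n * (2 * R0 ^ n * Rmin 1 (INR n * tau))) by ring.
        apply Rmult_le_compat_l; [apply Hc|].
        assert (Hp : 0 <= R0 ^ n) by (apply pow_le; lra).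
        unfold Rmin. destruct (Rle_dec 1 (INR n * tau)).
        -- le_trans_by Cmod_triangle_minus.
           assert (H1 := Cmod_pow_le z R0 n Hz). assert (H2 := Cmod_pow_le w R0 n Hw). lra.
        -- assert (H1 := Cpow_minus_le z w R0 n Hz Hw).
           apply Rmult_le_reg_l with R0; [exact HR0|]. eapply Rle_trans; [exact H1|].
           unfold tau. replace (R0 * (2 * R0 ^ n * (INR n * (Cmod (z - w) / R0)))) with
             (2 * (INR n * R0 ^ n * Cmod (z - w))) by (field; lra).
           assert (0 <= INR n * R0 ^ n * Cmod (z - w)).
           { apply Rmult_le_pos; [apply Rmult_le_pos; [apply pos_INR|exact Hp]|apply Cmod_ge_0]. }
           lra.
      * apply (ex_series_scal_R 2).
        apply ex_series_modulus; [|exact Hex|lra].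
        intros n. apply Rmult_le_pos; [apply Hc|apply pow_le; lra].
    + unfold b. rewrite Series_scal_l. lra.
Qed.

Lemma gbar_cont_in (z : C) : Cmod z <= R0 -> cont_in (fun w => Cmod w <= R0) gbar z.
Proof.
  intros Hz eps Heps. destruct (gbar_unif (eps / 2)) as [d [Hd H]]; [lra|].
  exists d. split; [exact Hd|]. intros w Hw Hwz. specialize (H w z Hw Hz Hwz). lra.
Qed.

(** At a radius [rho] strictly between [|z|] and [R0] the weights [n^2 rho^n] are bounded by a
    multiple of [R0^n], so the quadratic remainders of the powers can be summed. *)
Lemma gbar_cdiff (z : C) : Cmod z < R0 -> cdiff gbar z.
Proof.
  intros Hz. assert (Hz0 := Cmod_ge_0 z).
  set (rho := (Cmod z + R0) / 2).
  assert (Hrho : 0 < rho < R0) by (unfold rho; lra).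
  assert (Hzr : Cmod z < rho) by (unfold rho; lra).
  destruct (INR_sq_pow_bounded (rho / R0)) as [B [HB0 HB]].
  { split; [apply Rdiv_le_0_compat; lra|].
    apply Rlt_div_l; lra. }
  assert (Hb : forall n, INR n ^ 2 * rho ^ n <= B * R0 ^ n).
  { intros n. specialize (HB n). assert (Hp : 0 < R0 ^ n) by (apply pow_lt; lra).
    unfold Rdiv in HB. rewrite Rpow_mult_distr, pow_inv in HB.
    apply Rmult_le_compat_r with (r := R0 ^ n) in HB; [|lra].
    replace (INR n ^ 2 * (rho ^ n * / R0 ^ n) * R0 ^ n) with (INR n ^ 2 * rho ^ n) in HB by (field; lra).
    exact HB. }
  set (S := Series (fun n => c n * R0 ^ n)).
  assert (HS : 0 <= S).
  { apply Series_nonneg; [|exact Hex]. intros n. apply Rmult_le_pos; [apply Hc|apply pow_le; lra]. }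
  set (l := CSer (fun n => (c n) * Cpow_der z n)%C).
  assert (Hder : forall n, Cmod ((c n) * Cpow_der z n) <= B / rho * (c n * R0 ^ n)).
  { intros n. rewrite Cmod_scale by apply Hc.
    replace (B / rho * (c n * R0 ^ n)) with (c n * (B * R0 ^ n / rho)) by (field; lra).
    apply Rmult_le_compat_l; [apply Hc|].
    apply Rmult_le_reg_l with rho; [lra|].
    replace (rho * (B * R0 ^ n / rho)) with (B * R0 ^ n) by (field; lra).
    eapply Rle_trans; [apply Cmod_Cpow_der_le; lra|]. eapply Rle_trans; [|apply Hb].
    assert (0 <= rho ^ n) by (apply pow_le; lra). apply Rmult_le_compat_r; [assumption|].
    destruct n as [|n]; [simpl; lra|]. rewrite S_INR. generalize (pos_INR n). nra. }
  assert (HexS : forall a, ex_series (fun n => a * (c n * R0 ^ n))).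
  { intros a. now apply ex_series_scal_R. }
  assert (Hkey : forall w, Cmod w <= rho ->
    Cmod (gbar w - gbar z - l * (w - z)) <= 2 * (B / rho ^ 2 * Cmod (w - z) ^ 2 * S)).
  { intros w Hw. unfold l. rewrite Cmult_comm, <- (CSer_scal (w - z) _ _ Hder (HexS _)).
    rewrite gbar_minus by lra.
    rewrite (CSer_minus _ _ (fun n => 2 * (c n * R0 ^ n)) (fun n => Cmod (w - z) * (B / rho) * (c n * R0 ^ n))).
    - unfold S. rewrite <- Series_scal_l. apply Cmod_CSer_le; [|apply HexS].
      intros n.
      replace ((c n) * (Cpow w n - Cpow z n) - (w - z) * ((c n) * Cpow_der z n))%C with
        ((c n) * (Cpow w n - Cpow z n - Cpow_der z n * (w - z)))%C by ring.
      rewrite Cmod_scale by apply Hc.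
      replace (B / rho ^ 2 * Cmod (w - z) ^ 2 * (c n * R0 ^ n)) with
        (c n * (B * R0 ^ n * Cmod (w - z) ^ 2 / rho ^ 2)) by (field; lra).
      apply Rmult_le_compat_l; [apply Hc|].
      apply Rmult_le_reg_l with (rho ^ 2); [apply pow_lt; lra|].
      replace (rho ^ 2 * (B * R0 ^ n * Cmod (w - z) ^ 2 / rho ^ 2)) with (B * R0 ^ n * Cmod (w - z) ^ 2) by (field; lra).
      eapply Rle_trans; [apply Cpow_taylor1; lra|].
      apply Rmult_le_compat_r; [apply pow2_ge_0|apply Hb].
    - intros n. replace (2 * (c n * R0 ^ n)) with (c n * (R0 ^ n + R0 ^ n)) by ring.
      rewrite Cmod_scale by apply Hc. apply Rmult_le_compat_l; [apply Hc|].
      le_trans_by Cmod_triangle_minus. apply Rplus_le_compat; apply Cmod_pow_le; lra.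
    - apply HexS.
    - intros n. rewrite Cmod_mult, Rmult_assoc. apply Rmult_le_compat_l; [apply Cmod_ge_0|apply Hder].
    - apply HexS. }
  exists l. intros eps Heps.
  set (K := 2 * (B / rho ^ 2 * S)).
  assert (HK : 0 <= K).
  { unfold K. apply Rmult_le_pos; [lra|]. apply Rmult_le_pos; [|exact HS].
    apply Rdiv_le_0_compat; [exact HB0|apply pow_lt; lra]. }
  exists (Rmin (rho - Cmod z) (eps / (K + 1))). split.
  - apply Rmin_pos; [lra|apply Rdiv_lt_0_compat; lra].
  - intros w Hw. assert (H1 := lt_Rmin_l Hw).
    assert (H2 := lt_Rmin_r Hw).
    assert (H3 := Cmod_triangle_rev w z). assert (Hh := Cmod_ge_0 (w - z)).
    eapply Rle_trans; [apply Hkey; lra|].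
    assert (H4 : Cmod (w - z) * (K + 1) <= eps).
    { apply Rlt_div_r in H2; lra. }
    replace (2 * (B / rho ^ 2 * Cmod (w - z) ^ 2 * S)) with (K * Cmod (w - z) * Cmod (w - z)) by (unfold K; ring).
    nra.
Qed.
End ClosedDisk.

(** * Functions continuous on the closed disk *)

Section ClosedDiskFunction.
Context (F : C -> C) (R0 : R).
Hypothesis HR0 : 0 < R0.
Hypothesis HF : forall z, Cmod z <= R0 -> cont_in (fun w => Cmod w <= R0) F z.

(** Uniform continuity on the closed rectangle of polar coordinates asks for full neighbourhoods at
    its border; clamping the radius makes [F] in polar coordinates continuous on the whole plane. *)
Let clamp (x : R) : R := Rmax 0 (Rmin x R0).

Let clamp_bound (x : R) : 0 <= clamp x <= R0.
Proof.
  unfold clamp. split; [apply Rmax_l|]. apply Rmax_lub; [lra|apply Rmin_r].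
Qed.

Let clamp_id (x : R) : 0 <= x <= R0 -> clamp x = x.
Proof. intros H. unfold clamp. rewrite Rmin_left, Rmax_right; lra. Qed.

Let clamp_lipschitz (x y : R) : Rabs (clamp x - clamp y) <= Rabs (x - y).
Proof.
  unfold clamp, Rmax, Rmin.
  destruct (Rle_dec x R0), (Rle_dec y R0); repeat destruct (Rle_dec 0 _);
    unfold Rabs; repeat destruct (Rcase_abs _); lra.
Qed.

Let polar_minus (r s t u : R) : 0 <= r <= R0 ->
  Cmod (s * cis u - r * cis t) <= Rabs (s - r) + R0 * Rabs (u - t).
Proof.
  intros Hr. replace (s * cis u - r * cis t)%C with
    (RtoC (s - r) * cis u + r * (cis u - cis t))%C by (rewrite RtoC_minus; ring).
  le_trans_by Cmod_triangle.
  rewrite !Cmod_mult, Cmod_cis, !Cmod_R, (Rabs_pos_eq r) by lra.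
  assert (H := Cmod_cis_minus_le u t). assert (H1 := Cmod_ge_0 (cis u - cis t)).
  apply Rplus_le_compat; [lra|]. apply Rmult_le_compat; lra.
Qed.

Let polar_cont (x y : R) (eps : R) : 0 < eps -> exists delta, 0 < delta /\ forall u v,
  Rabs (u - x) < delta -> Rabs (v - y) < delta ->
  Cmod (F (RtoC (clamp u) * cis v) - F (RtoC (clamp x) * cis y)) < eps.
Proof.
  intros Heps. assert (Hcx := clamp_bound x).
  destruct (HF (RtoC (clamp x) * cis y)) with (eps := eps) as [d [Hd H]].
  - rewrite Cmod_circle; lra.
  - exact Heps.
  - exists (d / (1 + R0)). split; [apply Rdiv_lt_0_compat; lra|]. intros u v Hu Hv.
    assert (Hcu := clamp_bound u). apply H; [rewrite Cmod_circle; lra|].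
    eapply Rle_lt_trans; [now apply polar_minus|].
    assert (H1 := clamp_lipschitz u x).
    replace d with (d / (1 + R0) + R0 * (d / (1 + R0))) by (field; lra).
    assert (R0 * Rabs (v - y) < R0 * (d / (1 + R0))) by (apply Rmult_lt_compat_l; lra). lra.
Qed.

Lemma polar_unif (eps : R) : 0 < eps -> exists delta, 0 < delta /\
  forall r s t u, 0 <= r <= R0 -> 0 <= s <= R0 -> - PI <= t <= PI -> - PI <= u <= PI ->
    Rabs (s - r) < delta -> Rabs (u - t) < delta ->
    Cmod (F (s * cis u) - F (r * cis t)) < eps.
Proof.
  intros Heps. assert (He2 : 0 < eps / 2) by lra.
  destruct (uniform_continuity_2d (fun x y => fst (F (RtoC (clamp x) * cis y)%C)) 0 R0 (- PI) PI) with
    (eps := mkposreal _ He2) as [d1 H1].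
  { intros x y _ _ e. destruct (polar_cont x y e (cond_pos e)) as [d [Hd H]].
    exists (mkposreal d Hd). intros u v Hu Hv. exact (Rle_lt_trans _ _ _ (Rabs_fst_minus _ _) (H u v Hu Hv)). }
  destruct (uniform_continuity_2d (fun x y => snd (F (RtoC (clamp x) * cis y)%C)) 0 R0 (- PI) PI) with
    (eps := mkposreal _ He2) as [d2 H2].
  { intros x y _ _ e. destruct (polar_cont x y e (cond_pos e)) as [d [Hd H]].
    exists (mkposreal d Hd). intros u v Hu Hv. exact (Rle_lt_trans _ _ _ (Rabs_snd_minus _ _) (H u v Hu Hv)). }
  exists (Rmin d1 d2). split; [apply Rmin_pos; apply cond_pos|].
  intros r s t u Hr Hs Ht Hu Hsr Hut.
  specialize (H1 r t s u Hr Ht Hs Hu (lt_Rmin_l Hsr) (lt_Rmin_l Hut)).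
  specialize (H2 r t s u Hr Ht Hs Hu (lt_Rmin_r Hsr) (lt_Rmin_r Hut)).
  cbn [pos] in H1, H2. rewrite !clamp_id in H1, H2 by assumption.
  lt_trans_by Cmod_minus_le_abs. lra.
Qed.

(** Along a ray each step of length [d / 2] changes [F] by less than 1, and a bounded number of
    steps leads to the centre. *)
Lemma polar_bounded : exists M, 0 <= M /\ forall r t, 0 <= r <= R0 -> - PI <= t <= PI ->
  Cmod (F (r * cis t)) <= M.
Proof.
  destruct (polar_unif 1 Rlt_0_1) as [d [Hd H]].
  assert (Hstep : forall n r t, 0 <= r <= R0 -> - PI <= t <= PI -> r <= INR n * (d / 2) ->
    Cmod (F (r * cis t)) <= INR n + Cmod (F (0 * cis t))).
  { induction n as [|n IH]; intros r t Hr Ht Hrn.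
    - simpl in *. replace r with 0 by lra. lra.
    - rewrite S_INR in *. destruct (Rle_dec r (d / 2)) as [Hs|Hs].
      + assert (H1 : Cmod (F (r * cis t) - F (0 * cis t)) < 1).
        { apply H; auto; try lra.
          - rewrite Rminus_0_r, Rabs_pos_eq; lra.
          - rewrite Rminus_diag, Rabs_R0. lra. }
        assert (H2 := Cmod_triangle_rev (F (r * cis t)) (F (0 * cis t))).
        generalize (pos_INR n). lra.
      + assert (H1 : Cmod (F (r * cis t) - F (RtoC (r - d / 2) * cis t)) < 1).
        { apply H; auto; try lra.
          - replace (r - (r - d / 2)) with (d / 2) by ring. rewrite Rabs_pos_eq; lra.
          - rewrite Rminus_diag, Rabs_R0. lra. }
        assert (H2 := Cmod_triangle_rev (F (r * cis t)) (F (RtoC (r - d / 2) * cis t))).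
        assert (H3 := IH (r - d / 2) t ltac:(lra) Ht ltac:(lra)). lra. }
  destruct (nfloor_ex (R0 / (d / 2))) as [n Hn]; [apply Rdiv_le_0_compat; lra|].
  exists (INR (S n) + Cmod (F (RtoC 0))). split; [apply Rplus_le_le_0_compat; [apply pos_INR|apply Cmod_ge_0]|].
  intros r t Hr Ht. replace (RtoC 0) with (0 * cis t)%C by ring. apply Hstep; auto.
  rewrite S_INR. apply Rle_trans with R0; [lra|].
  apply Rmult_le_reg_r with (/ (d / 2)); [apply Rinv_0_lt_compat; lra|].
  rewrite Rmult_assoc, Rinv_r by lra. unfold Rdiv in Hn at 1. lra.
Qed.

Lemma polar_cont_path (r : R) : 0 <= r <= R0 -> pcont_on (fun t => F (r * cis t)%C) (- PI) PI.
Proof.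
  intros Hr t _. apply pcont_eps. intros eps Heps.
  destruct (polar_cont r t eps Heps) as [d [Hd H]]. exists d. split; [exact Hd|].
  intros s Hs. rewrite clamp_id in H by exact Hr.
  specialize (H r s). rewrite clamp_id in H by exact Hr. apply H; [|exact Hs].
  now rewrite Rminus_diag, Rabs_R0.
Qed.

Lemma fourier_cont_path (r : R) (n : nat) : 0 <= r <= R0 ->
  pcont_on (fun t => F (r * cis t) * cis (- (INR n * t)))%C (- PI) PI.
Proof.
  intros Hr t Ht. apply pcont_mult; [now apply (polar_cont_path r Hr)|apply pcont_cis_neg].
Qed.

(** Uniform continuity up to the boundary passes to the integrals; this carries the coefficient
    formula over to the circle of radius [R0]. *)
Lemma fourier_cont_boundary (n : nat) (eps : R) : 0 < eps -> exists delta, 0 < delta /\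
  forall r, 0 <= r <= R0 -> R0 - r < delta -> Cmod (fourier F r n - fourier F R0 n) <= eps.
Proof.
  intros Heps. assert (HPI := PI_RGT_0).
  (* [4 PI] is the length [2 PI] times the factor 2 of [Cmod_CI_le_const]. *)
  set (e := eps / (4 * PI)). assert (He : 0 < e) by (apply Rdiv_lt_0_compat; lra).
  destruct (polar_unif e He) as [d [Hd H]]. exists d. split; [exact Hd|].
  intros r Hr Hrd. unfold fourier.
  rewrite <- CI_minus by (try apply fourier_cont_path; lra).
  replace eps with (2 * ((PI - - PI) * e)) by (unfold e; field; lra).
  apply Cmod_CI_le_const; [lra| |].
  - intros t Ht. apply pcont_minus; apply fourier_cont_path; lra.
  - intros t Ht.
    replace (F (r * cis t) * cis (- (INR n * t)) - F (R0 * cis t) * cis (- (INR n * t)))%C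
      with ((F (r * cis t) - F (R0 * cis t)) * cis (- (INR n * t)))%C by ring.
    rewrite Cmod_mult, Cmod_cis, Rmult_1_r. left. apply H; try lra.
    + apply Rabs_lt_between. lra.
    + rewrite Rminus_diag, Rabs_R0. exact Hd.
Qed.

Lemma taylor_fourier_closed (r : R) (n : nat) :
  (forall w, Cmod w < R0 -> cdiff F w) -> 0 < r <= R0 ->
  (RtoC (2 * PI * r ^ n) * taylor R0 F n)%C = fourier F r n.
Proof.
  intros Hd Hr. assert (HPI := PI_RGT_0).
  assert (Hin : forall s, 0 < s < R0 -> (RtoC (2 * PI * s ^ n) * taylor R0 F n)%C = fourier F s n).
  { intros s Hs. rewrite (taylor_fourier R0 F HR0 Hd s n Hs).
    assert (Hp : 2 * PI * s ^ n <> 0).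
    { assert (0 < s ^ n) by (apply pow_lt; lra). nra. }
    rewrite Cmult_assoc, <- RtoC_mult, Rinv_r by exact Hp. ring. }
  destruct (Rlt_dec r R0) as [Hlt|Hge]; [apply Hin; lra|].
  replace r with R0 by lra. clear r Hr Hge.
  set (T := taylor R0 F n) in *.
  assert (Hz : (RtoC (2 * PI * R0 ^ n) * T - fourier F R0 n)%C = 0%C).
  { apply Cmod_eps_0 with 2. intros eps Heps.
    destruct (fourier_cont_boundary n eps Heps) as [d [Hd0 H]].
    assert (Hcont : continuous (fun s => 2 * PI * s ^ n * Cmod T) R0).
    { apply continuous_of_derive. auto_derive. trivial. }
    destruct (proj1 (continuous_eps _ _) Hcont eps Heps) as [d' [Hd' H']].
    set (m := Rmin (R0 / 2) (Rmin (d / 2) (d' / 2))).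
    assert (Hm : 0 < m /\ m <= R0 / 2 /\ m <= d / 2 /\ m <= d' / 2).
    { unfold m. assert (G1 := Rmin_l (R0 / 2) (Rmin (d / 2) (d' / 2))).
      assert (G2 := Rmin_r (R0 / 2) (Rmin (d / 2) (d' / 2))).
      assert (G3 := Rmin_l (d / 2) (d' / 2)). assert (G4 := Rmin_r (d / 2) (d' / 2)).
      repeat split; try lra. repeat apply Rmin_pos; lra. }
    specialize (H (R0 - m) ltac:(lra) ltac:(lra)).
    specialize (H' (R0 - m)). rewrite Rabs_left1 in H' by lra. specialize (H' ltac:(lra)).
    rewrite <- Hin in H by lra.
    replace (RtoC (2 * PI * R0 ^ n) * T - fourier F R0 n)%C with
      ((RtoC (2 * PI * (R0 - m) ^ n) * T - fourier F R0 n) -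
       RtoC (2 * PI * (R0 - m) ^ n - 2 * PI * R0 ^ n) * T)%C.
    2:{ rewrite (RtoC_minus (2 * PI * (R0 - m) ^ n)). ring. }
    le_trans_by Cmod_triangle_minus.
    rewrite Cmod_mult, Cmod_R. rewrite <- (Rabs_pos_eq (Cmod T)) by apply Cmod_ge_0.
    rewrite <- Rabs_mult.
    replace ((2 * PI * (R0 - m) ^ n - 2 * PI * R0 ^ n) * Cmod T) with
      (2 * PI * (R0 - m) ^ n * Cmod T - 2 * PI * R0 ^ n * Cmod T) by ring. lra. }
  replace (RtoC (2 * PI * R0 ^ n) * T)%C with
    (RtoC (2 * PI * R0 ^ n) * T - fourier F R0 n + fourier F R0 n)%C by ring.
  rewrite Hz. ring.
Qed.
End ClosedDiskFunction.

(** * Second order expansion on circles *)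

Lemma exp_le_mono (x y : R) : x <= y -> exp x <= exp y.
Proof. intros [H|H]; [left; now apply exp_increasing|rewrite H; lra]. Qed.

Lemma Rabs_exp_minus_1 (x : R) : Rabs (exp x - 1) <= Rabs x * exp (Rabs x).
Proof.
  assert (H : forall y, 0 <= y -> exp y - 1 <= y * exp y).
  { intros y Hy. assert (H := exp_ineq1_le (- y)). rewrite exp_Ropp in H.
    assert (Hp := exp_pos y). apply Rmult_le_compat_l with (r := exp y) in H; [|lra].
    rewrite Rinv_r in H by lra. nra. }
  destruct (Rle_dec 0 x) as [Hx|Hx].
  - rewrite (Rabs_pos_eq x) by exact Hx. rewrite Rabs_pos_eq; [now apply H|].
    generalize (exp_ineq1_le x). lra.
  - rewrite (Rabs_left1 x) by lra. rewrite Rabs_left1.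
    + assert (H1 := exp_ineq1_le x). assert (H2 := exp_ineq1_le (- x)). nra.
    + rewrite <- exp_0. generalize (exp_increasing x 0 ltac:(lra)). lra.
Qed.

Lemma Cexp_minus_1 (b : C) : Cmod (Cexp b - 1) <= 3 * (Cmod b * exp (Cmod b)).
Proof.
  destruct b as [x y]. set (m := Cmod (x, y)).
  assert (Hx := Rabs_fst_le_Cmod (x, y)). assert (Hy := Rabs_snd_le_Cmod (x, y)).
  fold m in Hx, Hy. simpl in Hx, Hy. assert (Hm := Cmod_ge_0 (x, y)). fold m in Hm.
  assert (Hax := Rabs_pos x). assert (Hay := Rabs_pos y).
  assert (Hem : 1 <= exp m) by (generalize (exp_ineq1_le m); lra).
  assert (Hexm : exp x <= exp m) by (apply exp_le_mono; generalize (Rle_abs x); lra).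
  assert (Hcs := Cmod_cis_minus_le y 0). rewrite Rminus_0_r in Hcs.
  assert (Hc := Rabs_fst_le_Cmod (cis y - cis 0)). assert (Hs := Rabs_snd_le_Cmod (cis y - cis 0)).
  simpl in Hc, Hs. rewrite cos_0 in Hc. rewrite sin_0, Ropp_0, Rplus_0_r in Hs.
  le_trans_by Cmod_le_abs. simpl fst; simpl snd.
  assert (H1 : Rabs (exp x * cos y + - (1)) <= m * exp m + m).
  { replace (exp x * cos y + - (1)) with ((exp x - 1) * cos y + (cos y + - (1))) by ring.
    le_trans_by Rabs_triang. rewrite Rabs_mult.
    assert (Hcb : Rabs (cos y) <= 1) by (apply Rabs_le; apply COS_bound).
    assert (He := Rabs_exp_minus_1 x). assert (He0 := Rabs_pos (exp x - 1)).
    assert (Hee : exp (Rabs x) <= exp m) by now apply exp_le_mono.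
    assert (Hp := exp_pos (Rabs x)).
    assert (Rabs x * exp (Rabs x) <= m * exp m) by (apply Rmult_le_compat; lra).
    assert (Hca := Rabs_pos (cos y)). nra. }
  assert (H2 : Rabs (exp x * sin y + - 0) <= exp m * m).
  { rewrite Ropp_0, Rplus_0_r, Rabs_mult, Rabs_pos_eq by (left; apply exp_pos).
    apply Rmult_le_compat; [left; apply exp_pos|apply Rabs_pos|exact Hexm|lra]. }
  nra.
Qed.

(** Half of the decay absorbs the factor [x], through [exp (x / 8) >= x / 8]. *)
Lemma mult_exp_le (x : R) : 0 <= x -> x * exp (- (x / 4)) <= 8 * exp (- (x / 8)).
Proof.
  intros Hx. replace (- (x / 4)) with (- (x / 8) + - (x / 8)) by field.
  rewrite exp_plus, <- Rmult_assoc. apply Rmult_le_compat_r; [left; apply exp_pos|].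
  rewrite exp_Ropp. assert (H := exp_ineq1_le (x / 8)). assert (Hp := exp_pos (x / 8)).
  apply Rmult_le_reg_r with (exp (x / 8)); [exact Hp|].
  rewrite Rmult_assoc, Rinv_l by lra. lra.
Qed.

(** The square of [exp (y / 2) >= y / 2]. A quadratic rate is enough against the linear bound on the
    normalising factor in the saddle point estimate. *)
Lemma exp_opp_le_inv_sq (y : R) : 0 < y -> exp (- y) <= 4 / y ^ 2.
Proof.
  intros Hy. rewrite exp_Ropp. assert (H := exp_ineq1_le (y / 2)).
  assert (Hp := exp_pos (y / 2)).
  assert (He : exp y = exp (y / 2) * exp (y / 2)) by (rewrite <- exp_plus; f_equal; field).
  replace (4 / y ^ 2) with (/ ((y / 2) * (y / 2))) by (field; lra).
  apply Rinv_le_contravar; [nra|]. rewrite He. apply Rmult_le_compat; lra.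
Qed.

Lemma Cexp_RtoC (x : R) : Cexp x = RtoC (exp x).
Proof. unfold Cexp, RtoC; simpl. rewrite cos_0, sin_0. f_equal; ring. Qed.

Lemma Cexp_Ci (x : R) : Cexp (Ci * RtoC x) = cis x.
Proof.
  unfold Cexp, cis, Ci, Cmult, RtoC; simpl.
  replace (0 * x - 1 * 0) with 0 by ring. replace (0 * 0 + 1 * x) with x by ring.
  rewrite exp_0. f_equal; ring.
Qed.

Lemma gbar_polar (c : nat -> R) (r t : R) :
  gbar c (r * cis t) =
  (Series (fun n => c n * r ^ n * cos (INR n * t)), Series (fun n => c n * r ^ n * sin (INR n * t))).
Proof.
  unfold gbar, CSer.
  assert (H : forall n, ((c n) * Cpow (r * cis t) n)%C =
    (c n * r ^ n * cos (INR n * t), c n * r ^ n * sin (INR n * t))).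
  { intros n. rewrite Cpow_mult, Cpow_RtoC, cis_pow. unfold cis, RtoC, Cmult; simpl. f_equal; ring. }
  apply injective_projections; apply Series_ext; intros n; now rewrite H.
Qed.

Lemma gbar_real (c : nat -> R) (r : R) : gbar c r = RtoC (Series (fun n => c n * r ^ n)).
Proof.
  replace (RtoC r) with (r * cis 0)%C by (rewrite cis_0; ring).
  rewrite gbar_polar. unfold RtoC. f_equal.
  - apply Series_ext. intros n. rewrite Rmult_0_r, cos_0. ring.
  - rewrite (Series_ext _ (fun n => 0 * (c n * r ^ n))).
    + rewrite Series_scal_l. ring.
    + intros n. rewrite Rmult_0_r, sin_0. ring.
Qed.

Local Notation gdiff a r t := (gbar a (r * cis t) - gbar a r)%C (only parsing).

Section PowerSeriesOnCircles.
Context (c : nat -> R) (R0 : R).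
Hypothesis Hc : forall n, 0 <= c n.
Hypothesis HR0 : 0 < R0.
Hypothesis Hex : ex_series (fun n => c n * R0 ^ n).

Let term_nonneg (r : R) (n : nat) : 0 <= r -> 0 <= c n * r ^ n.
Proof. intros Hr. apply Rmult_le_pos; [apply Hc|now apply pow_le]. Qed.

Let ex_trig (r : R) (g : nat -> R) (K : R) : 0 <= r <= R0 -> (forall n, Rabs (g n) <= K) ->
  ex_series (fun n => c n * r ^ n * g n).
Proof.
  intros Hr Hg. apply ex_series_dominated with (fun n => K * (c n * r ^ n)).
  - intros n. rewrite Rabs_mult, Rabs_pos_eq by (apply term_nonneg; lra).
    rewrite Rmult_comm. apply Rmult_le_compat_r; [apply term_nonneg; lra|apply Hg].
  - apply ex_series_scal_R.
    now apply ex_series_pow_le with R0.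
Qed.

Lemma Re_gbar_minus (r t : R) : 0 <= r <= R0 ->
  fst (gdiff c r t) =
  - Series (fun n => c n * r ^ n * (1 - cos (INR n * t))).
Proof.
  intros Hr. rewrite gbar_polar, gbar_real. simpl.
  rewrite (Series_ext (fun n => c n * r ^ n * (1 - cos (INR n * t)))
    (fun n => c n * r ^ n - c n * r ^ n * cos (INR n * t))) by (intros; ring).
  rewrite Series_minus; [ring| |].
  - now apply ex_series_pow_le with R0.
  - apply ex_trig with 1; [exact Hr|]. intros n. apply Rabs_le. apply COS_bound.
Qed.

Lemma Re_gbar_minus_le_0 (r t : R) : 0 <= r <= R0 ->
  fst (gdiff c r t) <= 0.
Proof.
  intros Hr. rewrite Re_gbar_minus by exact Hr.
  enough (0 <= Series (fun n => c n * r ^ n * (1 - cos (INR n * t)))) by lra.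
  apply Series_nonneg.
  - intros n. apply Rmult_le_pos; [apply term_nonneg; lra|]. generalize (COS_bound (INR n * t)). lra.
  - apply ex_trig with 2; [exact Hr|]. intros n. apply Rabs_le. generalize (COS_bound (INR n * t)). lra.
Qed.

Hypothesis Hex2 : ex_series (fun n => INR n ^ 2 * (c n * R0 ^ n)).

Lemma ex_series_moment2 (r : R) : 0 <= r <= R0 -> ex_series (fun n => INR n ^ 2 * (c n * r ^ n)).
Proof.
  intros Hr. apply ex_series_dominated with (fun n => INR n ^ 2 * (c n * R0 ^ n)); [|exact Hex2].
  intros n. rewrite Rabs_pos_eq.
  - apply Rmult_le_compat_l; [apply pow2_ge_0|]. apply Rmult_le_compat_l; [apply Hc|now apply pow_incr].
  - apply Rmult_le_pos; [apply pow2_ge_0|apply term_nonneg; lra].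
Qed.

Lemma INR_le_sq (n : nat) : INR n <= INR n ^ 2.
Proof. destruct n as [|n]; [simpl; lra|]. rewrite S_INR. generalize (pos_INR n). nra. Qed.

Lemma ex_series_moment1 (r : R) : 0 <= r <= R0 -> ex_series (fun n => INR n * (c n * r ^ n)).
Proof.
  intros Hr. apply ex_series_dominated with (fun n => INR n ^ 2 * (c n * r ^ n)).
  - intros n. rewrite Rabs_pos_eq.
    + apply Rmult_le_compat_r; [apply term_nonneg; lra|apply INR_le_sq].
    + apply Rmult_le_pos; [apply pos_INR|apply term_nonneg; lra].
  - now apply ex_series_moment2.
Qed.

(** The remainders of [cos] and [sin] at [n t] carry [n^2 t^2 min(1, n |t|)], and
    [c_n r^n <= c_n R0^n] makes their sum bounded independently of [r]; [modulus_small] then yields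
    [o(t^2)]. Two components with a factor 2 each account for [eta / 4]. *)
Lemma gbar_quadratic (eta : R) : 0 < eta -> exists delta, 0 < delta /\
  forall r t, 0 <= r <= R0 -> Rabs t < delta ->
  Cmod (gdiff c r t
    - Ci * RtoC (Series (fun n => INR n * (c n * r ^ n)) * t)
    + RtoC (Series (fun n => INR n ^ 2 * (c n * r ^ n)) * t ^ 2 / 2)) <= eta * t ^ 2.
Proof.
  intros Heta.
  destruct (modulus_small (fun n => INR n ^ 2 * (c n * R0 ^ n))) with (eta := eta / 4) as [d [Hd H]].
  - intros n. apply Rmult_le_pos; [apply pow2_ge_0|apply term_nonneg; lra].
  - exact Hex2.
  - lra.
  - exists d. split; [exact Hd|]. intros r t Hr Ht.
    set (tau := Rabs t) in *. assert (Htau : 0 <= tau < d) by (split; [apply Rabs_pos|exact Ht]).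
    specialize (H tau Htau).
    set (W := fun n => INR n ^ 2 * (c n * R0 ^ n) * Rmin 1 (INR n * tau)).
    assert (HexW : ex_series W).
    { apply ex_series_modulus; [|exact Hex2|lra].
      intros n. apply Rmult_le_pos; [apply pow2_ge_0|apply term_nonneg; lra]. }
    assert (Hgen : forall (e : R -> R), (forall x, Rabs (e x) <= 2 * x ^ 2 * Rmin 1 (Rabs x)) ->
      Rabs (Series (fun n => c n * r ^ n * e (INR n * t))) <= 2 * t ^ 2 * Series W).
    { intros e He. rewrite <- Series_scal_l. apply Rabs_Series_le.
      - intros n. rewrite Rabs_mult, Rabs_pos_eq by (apply term_nonneg; lra).
        eapply Rle_trans.
        { apply Rmult_le_compat_l; [apply term_nonneg; lra|apply He]. }
        rewrite Rabs_mult, (Rabs_pos_eq (INR n)) by apply pos_INR. fold tau. unfold W.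
        replace (c n * r ^ n * (2 * (INR n * t) ^ 2 * Rmin 1 (INR n * tau))) with
          (c n * r ^ n * (2 * t ^ 2 * INR n ^ 2 * Rmin 1 (INR n * tau))) by ring.
        replace (2 * t ^ 2 * (INR n ^ 2 * (c n * R0 ^ n) * Rmin 1 (INR n * tau))) with
          (c n * R0 ^ n * (2 * t ^ 2 * INR n ^ 2 * Rmin 1 (INR n * tau))) by ring.
        apply Rmult_le_compat_r.
        + apply Rmult_le_pos; [apply Rmult_le_pos; [generalize (pow2_ge_0 t); lra|apply pow2_ge_0]|].
          apply Rmin_glb; [lra|]. apply Rmult_le_pos; [apply pos_INR|lra].
        + apply Rmult_le_compat_l; [apply Hc|now apply pow_incr].
      - now apply ex_series_scal_R. }
    assert (H1 := Hgen _ cos_taylor2). assert (H2 := Hgen _ sin_taylor1).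
    assert (Hx0 : ex_series (fun n => c n * r ^ n)) by now apply ex_series_pow_le with R0.
    assert (Hx1 := ex_series_moment1 r Hr). assert (Hx2 := ex_series_moment2 r Hr).
    assert (Hxc : ex_series (fun n => c n * r ^ n * cos (INR n * t))).
    { apply ex_trig with 1; [exact Hr|]. intros n. apply Rabs_le. apply COS_bound. }
    assert (Hxs : ex_series (fun n => c n * r ^ n * sin (INR n * t))).
    { apply ex_trig with 1; [exact Hr|]. intros n. apply Rabs_le. apply SIN_bound. }
    assert (Hcos : Series (fun n => c n * r ^ n * (cos (INR n * t) - 1 + (INR n * t) ^ 2 / 2)) =
      Series (fun n => c n * r ^ n * cos (INR n * t)) - Series (fun n => c n * r ^ n) +
      Series (fun n => INR n ^ 2 * (c n * r ^ n)) * t ^ 2 / 2).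
    { rewrite (Series_ext _ (fun n => (c n * r ^ n * cos (INR n * t) - c n * r ^ n) +
        t ^ 2 / 2 * (INR n ^ 2 * (c n * r ^ n)))) by (intros; field).
      rewrite Series_plus, Series_minus, Series_scal_l; auto; [field| |].
      - now apply (ex_series_minus (K := R_AbsRing) (V := RV)).
      - now apply ex_series_scal_R. }
    assert (Hsin : Series (fun n => c n * r ^ n * (sin (INR n * t) - INR n * t)) =
      Series (fun n => c n * r ^ n * sin (INR n * t)) - Series (fun n => INR n * (c n * r ^ n)) * t).
    { rewrite (Series_ext _ (fun n => c n * r ^ n * sin (INR n * t) - t * (INR n * (c n * r ^ n)))) by (intros; ring).
      rewrite Series_minus, Series_scal_l; auto; [ring|].
      now apply ex_series_scal_R. }
    cbn beta in H1, H2. rewrite Hcos in H1. rewrite Hsin in H2.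
    le_trans_by Cmod_le_abs. rewrite gbar_polar, gbar_real.
    unfold Ci, Cminus, Cplus, Copp, Cmult, RtoC. cbn [fst snd].
    match goal with |- Rabs ?a + Rabs ?b <= _ =>
      replace a with (Series (fun n => c n * r ^ n * cos (INR n * t)) - Series (fun n => c n * r ^ n) +
        Series (fun n => INR n ^ 2 * (c n * r ^ n)) * t ^ 2 / 2) by ring;
      replace b with (Series (fun n => c n * r ^ n * sin (INR n * t)) - Series (fun n => INR n * (c n * r ^ n)) * t) by ring
    end.
    fold W in H. assert (Ht2 := pow2_ge_0 t). nra.
Qed.
End PowerSeriesOnCircles.

(** * The saddle point estimate *)

Section SaddlePoint.
Context (b c : nat -> R) (R0 : R) (f : C -> C).
Hypothesis HR0 : 0 < R0.
Hypothesis Hb : forall n, 0 <= b n.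
Hypothesis Hc : forall n, 0 <= c n.
Hypothesis Hexb : ex_series (fun n => b n * R0 ^ n).
Hypothesis Hexc : ex_series (fun n => c n * R0 ^ n).
Hypothesis Hexc2 : ex_series (fun n => INR n ^ 2 * (c n * R0 ^ n)).
Hypothesis Hmean : Series (fun n => INR n * (c n * R0 ^ n)) = 1.
Hypothesis Hdecay : forall r0, 0 < r0 <= R0 ->
  exists c0, 0 < c0 /\ forall r t, r0 <= r <= R0 -> Rabs t <= PI ->
    c0 * t ^ 2 <= Series (fun n => c n * r ^ n * (1 - cos (INR n * t))).
Hypothesis Hfd : forall z, Cmod z < R0 -> cdiff f z.
Hypothesis Hfc : forall z, Cmod z <= R0 -> cont_in (fun w => Cmod w <= R0) f z.

(** For [c = gcoef kappa], [mean] is the series of [z g'] and [var], a moment about 0, is that of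
    [b_2]. *)
Let mean (r : R) : R := Series (fun n => INR n * (c n * r ^ n)).
Let var (r : R) : R := Series (fun n => INR n ^ 2 * (c n * r ^ n)).
Let val (a : nat -> R) (r : R) : R := Series (fun n => a n * r ^ n).
Let F (v : R) (N : nat) (z : C) : C :=
  (f z * Cexp (v * (gbar b z + INR N * gbar c z)))%C.
(** The integrand divided by its exponential factor at [t = 0]: all exponents vanish there, so
    [h v N r 0] is [f r]. The term [Ci t] stems from [z^{-N}]. *)
Let h (v : R) (N : nat) (r t : R) : C :=
  (f (r * cis t) * Cexp (v * gdiff b r t)
   * Cexp (INR N * (v * gdiff c r t - Ci * RtoC t)))%C.

Lemma F_cont (v : R) (N : nat) (z : C) : Cmod z <= R0 -> cont_in (fun w => Cmod w <= R0) (F v N) z.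
Proof.
  intros Hz. apply cont_in_mult; [now apply Hfc|].
  apply (cont_in_comp _ Cexp); [apply cdiff_ccont, cdiff_Cexp|].
  apply cont_in_mult; [apply cont_in_const|].
  apply cont_in_plus; [now apply gbar_cont_in|].
  apply cont_in_mult; [apply cont_in_const|now apply gbar_cont_in].
Qed.

Lemma F_cdiff (v : R) (N : nat) (z : C) : Cmod z < R0 -> cdiff (F v N) z.
Proof.
  intros Hz. apply cdiff_mult; [now apply Hfd|].
  apply (cdiff_comp Cexp); [apply cdiff_Cexp|].
  apply cdiff_mult; [apply cdiff_const|].
  apply cdiff_plus; [now apply gbar_cdiff with R0|].
  apply cdiff_mult; [apply cdiff_const|now apply gbar_cdiff with R0].
Qed.

Lemma F_normalized (v : R) (N : nat) (r t : R) :
  (F v N (r * cis t) * cis (- (INR N * t)))%C =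
  (RtoC (exp (v * (val b r + INR N * val c r))) * h v N r t)%C.
Proof.
  unfold F, h. rewrite <- (Cexp_Ci (- (INR N * t))), <- Cexp_RtoC, !gbar_real. fold (val b r) (val c r).
  rewrite <- Cmult_assoc, <- (Cmult_assoc (f _)), (Cmult_comm (Cexp (RtoC (v * _)))), <- Cmult_assoc.
  f_equal. rewrite <- !Cexp_plus. f_equal.
  rewrite RtoC_opp, !RtoC_mult, RtoC_plus, RtoC_mult. ring.
Qed.

Lemma h_cont (v : R) (N : nat) (r : R) : 0 <= r <= R0 -> pcont_on (h v N r) (- PI) PI.
Proof.
  intros Hr t Ht.
  assert (HE := exp_pos (v * (val b r + INR N * val c r))).
  apply pcont_ext with (fun s => RtoC (/ exp (v * (val b r + INR N * val c r))) *
    (F v N (r * cis s) * cis (- (INR N * s))))%C.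
  - intros s. rewrite F_normalized, Cmult_assoc, <- RtoC_mult, Rinv_l by lra. ring.
  - apply pcont_scal.
    apply (fourier_cont_path (F v N) R0 HR0 (F_cont v N) r N Hr t Ht).
Qed.

(** The identity [sqrt (2 PI N A) = 2 PI sqrt (N A / 2 / PI)] turns the normalisation of the theorem
    into that of the Gaussian [exp (- N A t^2 / 2)]. *)
Lemma taylor_normalized (v : R) (N : nat) (r A : R) : 0 < r <= R0 -> 0 < A ->
  (taylor R0 (F v N) N * RtoC (r ^ N * sqrt (2 * PI * INR N * A) / exp (v * (val b r + INR N * val c r))))%C
  = (RtoC (sqrt (INR N * A / 2 / PI)) * CI (h v N r) (- PI) PI)%C.
Proof.
  intros Hr HA. assert (HPI := PI_RGT_0).
  assert (HE := exp_pos (v * (val b r + INR N * val c r))).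
  set (E := exp (v * (val b r + INR N * val c r))) in *.
  assert (HT := taylor_fourier_closed (F v N) R0 HR0 (F_cont v N) r N (F_cdiff v N) Hr).
  assert (Hfour : fourier (F v N) r N = (E * CI (h v N r) (- PI) PI)%C).
  { unfold fourier. rewrite <- CI_scal; [|lra|apply h_cont; lra].
    apply CI_ext; [lra|]. intros t _. apply F_normalized. }
  rewrite Hfour in HT.
  assert (Hsq : sqrt (2 * PI * INR N * A) = 2 * PI * sqrt (INR N * A / 2 / PI)).
  { replace (2 * PI * INR N * A) with ((2 * PI) ^ 2 * (INR N * A / 2 / PI)) by (field; lra).
    rewrite sqrt_mult_alt by apply pow2_ge_0. rewrite sqrt_pow2 by lra. reflexivity. }
  rewrite Hsq. set (s := sqrt (INR N * A / 2 / PI)). set (T := taylor R0 (F v N) N) in *.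
  replace (r ^ N * (2 * PI * s) / E) with (2 * PI * r ^ N * (s * / E)) by (field; lra).
  rewrite RtoC_mult, Cmult_assoc, (Cmult_comm T), HT.
  rewrite RtoC_mult. rewrite <- (Cmult_1_l (CI (h v N r) (- PI) PI)) at 2.
  replace (RtoC 1) with (RtoC (E * / E)) by (f_equal; field; lra).
  rewrite RtoC_mult. ring.
Qed.

Lemma Cmod_Cexp_gdiff_le_1 (v r t : R) : 0 <= v -> 0 <= r <= R0 -> Cmod (Cexp (v * gdiff b r t)) <= 1.
Proof.
  intros Hv Hr. rewrite Cmod_Cexp, <- exp_0. apply exp_le_mono.
  assert (H := Re_gbar_minus_le_0 b R0 Hb Hexb r t Hr).
  set (y := gdiff b r t) in *. unfold RtoC, Cmult. cbn [fst snd]. nra.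
Qed.

(** This part of the integrand does not grow with [N], so uniform continuity on the closed disk
    suffices, together with [v <= v0]. *)
Lemma theta_factor (v0 eta : R) : 1 <= v0 -> 0 < eta -> exists delta, 0 < delta /\
  forall v r t, 1 <= v <= v0 -> 0 <= r <= R0 -> Rabs t < delta -> Rabs t <= PI ->
  Cmod (f (r * cis t) * Cexp (v * gdiff b r t) - f r) <= eta.
Proof.
  intros Hv0 Heta. assert (HPI := PI_RGT_0).
  destruct (polar_bounded f R0 HR0 Hfc) as [M [HM HfM]].
  destruct (polar_unif f R0 HR0 Hfc (eta / 2)) as [d1 [Hd1 H1]]; [lra|].
  (* Half of [eta] is allotted to [|exp X - 1|], which is at most [3 e exp 1 <= 9 e]; hence 18. *)
  set (e := Rmin 1 (eta / (18 * (M + 1)))).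
  assert (He : 0 < e) by (apply Rmin_pos; [lra|apply Rdiv_lt_0_compat; lra]).
  destruct (gbar_unif b R0 Hb HR0 Hexb (e / v0)) as [d2 [Hd2 H2]]; [apply Rdiv_lt_0_compat; lra|].
  exists (Rmin d1 (d2 / R0)). split; [apply Rmin_pos; [exact Hd1|now apply Rdiv_lt_0_compat]|].
  intros v r t Hv Hr Ht HtPI.
  assert (Ht1 := lt_Rmin_l Ht). assert (Ht2 := lt_Rmin_r Ht).
  apply Rabs_le_between in HtPI.
  set (X := (v * gdiff b r t)%C).
  assert (HX : Cmod X <= e).
  { unfold X. rewrite Cmod_scale by lra.
    assert (H : Cmod (gdiff b r t) <= e / v0).
    { apply H2.
      - rewrite Cmod_circle; lra.
      - rewrite Cmod_R, Rabs_pos_eq; lra.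
      - replace (r * cis t - RtoC r)%C with (r * (cis t - cis 0))%C by (rewrite cis_0; ring).
        rewrite Cmod_scale by lra.
        assert (H := Cmod_cis_minus_le t 0). rewrite Rminus_0_r in H.
        apply Rle_lt_trans with (R0 * Rabs t).
        + apply Rmult_le_compat; try lra. apply Cmod_ge_0.
        + apply Rmult_lt_compat_l with (r := R0) in Ht2; [|exact HR0].
          replace (R0 * (d2 / R0)) with d2 in Ht2 by (field; lra). exact Ht2. }
    apply Rle_trans with (v0 * (e / v0)); [|right; field; lra].
    apply Rmult_le_compat; try lra. apply Cmod_ge_0. }
  assert (HeX : Cmod (Cexp X) <= 1) by (apply Cmod_Cexp_gdiff_le_1; lra).
  assert (HeX1 : Cmod (Cexp X - 1) <= 9 * e).
  { le_trans_by Cexp_minus_1.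
    assert (He1 : e <= 1) by apply Rmin_l. assert (HX0 := Cmod_ge_0 X).
    assert (exp (Cmod X) <= 3).
    { eapply Rle_trans; [|apply exp_le_3]. apply exp_le_mono. lra. }
    assert (Hp := exp_pos (Cmod X)). nra. }
  assert (Hff : Cmod (f (r * cis t) - f r) <= eta / 2).
  { left. replace (RtoC r) with (r * cis 0)%C at 2 by (rewrite cis_0; ring).
    apply H1; try lra.
    - rewrite Rminus_diag, Rabs_R0. lra.
    - now rewrite Rminus_0_r. }
  assert (HfrM : Cmod (f r) <= M).
  { replace (RtoC r) with (r * cis 0)%C by (rewrite cis_0; ring). apply HfM; lra. }
  replace (f (r * cis t) * Cexp X - f r)%C with
    ((f (r * cis t) - f r) * Cexp X + f r * (Cexp X - 1))%C by ring.
  le_trans_by Cmod_triangle. rewrite !Cmod_mult.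
  assert (G1 : Cmod (f (r * cis t) - f r) * Cmod (Cexp X) <= eta / 2 * 1).
  { apply Rmult_le_compat; try apply Cmod_ge_0; assumption. }
  assert (G2 : Cmod (f r) * Cmod (Cexp X - 1) <= (M + 1) * (9 * (eta / (18 * (M + 1))))).
  { apply Rmult_le_compat; try apply Cmod_ge_0; [lra|]. eapply Rle_trans; [exact HeX1|].
    apply Rmult_le_compat_l; [lra|apply Rmin_r]. }
  replace ((M + 1) * (9 * (eta / (18 * (M + 1))))) with (eta / 2) in G2 by (field; lra). lra.
Qed.

(** Put [x = N t^2]. The Gaussian exponent is at most [- x / 2] because [A >= 1], and the error
    costs at most [x / 4] because [eta <= 1/4]. The factor [x] of the difference is absorbed by
    [mult_exp_le]; 24 is 3 times its constant 8. *)
Lemma gaussian_comparison (eta A N t : R) (E : C) :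
  0 < eta <= / 4 -> 1 <= A -> 0 <= N -> Cmod E <= eta * t ^ 2 ->
  Cmod (Cexp (N * (RtoC (- (A * t ^ 2 / 2)) + E))) <= exp (- (N / 8 * t ^ 2)) /\
  Cmod (Cexp (N * (RtoC (- (A * t ^ 2 / 2)) + E)) - RtoC (exp (- (N * A / 2 * t ^ 2))))
    <= 24 * eta * exp (- (N / 8 * t ^ 2)).
Proof.
  intros Heta HA HN HE.
  assert (Ht := pow2_ge_0 t). set (x := N * t ^ 2). assert (Hx : 0 <= x) by (unfold x; nra).
  set (g := Cexp (N * E)).
  assert (Hsplit : Cexp (N * (RtoC (- (A * t ^ 2 / 2)) + E)) = (RtoC (exp (- (N * A / 2 * t ^ 2))) * g)%C).
  { unfold g. rewrite <- Cexp_RtoC, <- Cexp_plus. f_equal.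
    replace (- (N * A / 2 * t ^ 2)) with (N * (- (A * t ^ 2 / 2))) by field. rewrite RtoC_mult. ring. }
  assert (HNE : Cmod (N * E) <= eta * x).
  { rewrite Cmod_scale by exact HN. unfold x. nra. }
  assert (HNE0 := Cmod_ge_0 (N * E)).
  assert (Hga : exp (- (N * A / 2 * t ^ 2)) <= exp (- (x / 2))).
  { apply exp_le_mono. unfold x. assert (N * t ^ 2 <= N * t ^ 2 * A) by (fold x; nra). lra. }
  assert (Hgx : exp (Cmod (N * E)) <= exp (x / 4)) by (apply exp_le_mono; nra).
  assert (Hmul : exp (- (x / 2)) * exp (x / 4) = exp (- (x / 4))) by (rewrite <- exp_plus; f_equal; field).
  assert (Hp1 := exp_pos (- (N * A / 2 * t ^ 2))). assert (Hp2 := exp_pos (Cmod (N * E))).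
  replace (N / 8 * t ^ 2) with (x / 8) by (unfold x; field).
  rewrite Hsplit. split.
  - rewrite Cmod_scale by lra. unfold g. rewrite Cmod_Cexp.
    apply Rle_trans with (exp (- (x / 2)) * exp (x / 4)).
    + apply Rmult_le_compat; [lra|left; apply exp_pos|exact Hga|].
      eapply Rle_trans; [|exact Hgx]. apply exp_le_mono.
      eapply Rle_trans; [apply Rle_abs|apply Rabs_fst_le_Cmod].
    + rewrite Hmul. apply exp_le_mono. lra.
  - replace (RtoC (exp (- (N * A / 2 * t ^ 2))) * g - RtoC (exp (- (N * A / 2 * t ^ 2))))%C
      with (RtoC (exp (- (N * A / 2 * t ^ 2))) * (g - 1))%C by ring.
    rewrite Cmod_scale by lra.
    apply Rle_trans with (exp (- (x / 2)) * (3 * (eta * x * exp (x / 4)))).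
    + apply Rmult_le_compat; [lra|apply Cmod_ge_0|exact Hga|].
      le_trans_by Cexp_minus_1. apply Rmult_le_compat_l; [lra|].
      apply Rmult_le_compat; lra.
    + replace (exp (- (x / 2)) * (3 * (eta * x * exp (x / 4)))) with
        (3 * eta * (x * (exp (- (x / 2)) * exp (x / 4)))) by ring.
      rewrite Hmul. assert (H := mult_exp_le x Hx). nra.
Qed.
(** Since [r^n <= (r / R0) R0^n] for [n >= 1] and the mean at [R0] is 1, the mean at [r], which is
    [1 / v], is at most [r / R0]. *)
Let mean_radius (v0 v r : R) : 1 <= v <= v0 -> 0 < r <= R0 -> v * mean r = 1 -> R0 / v0 <= r.
Proof.
  intros Hv Hr Hm.
  assert (Hle : mean r <= r / R0 * 1).
  { rewrite <- Hmean. unfold mean. rewrite <- Series_scal_l. apply Series_le.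
    - intros n. assert (Hp : 0 <= c n * r ^ n) by (apply Rmult_le_pos; [apply Hc|apply pow_le; lra]).
      split; [apply Rmult_le_pos; [apply pos_INR|exact Hp]|].
      destruct n as [|n]; [simpl INR; lra|].
      replace (r / R0 * (INR (S n) * (c (S n) * R0 ^ S n))) with (INR (S n) * (c (S n) * (r * R0 ^ n))).
      2:{ simpl pow. field. lra. }
      apply Rmult_le_compat_l; [apply pos_INR|]. apply Rmult_le_compat_l; [apply Hc|].
      simpl pow. apply Rmult_le_compat_l; [lra|]. apply pow_incr. lra.
    - apply (ex_series_scal_R (r / R0)).
      apply (ex_series_moment1 c R0 Hc Hexc2). lra. }
  assert (Hmp : / v0 <= mean r).
  { replace (mean r) with (/ v) by (apply Rmult_eq_reg_l with v; [rewrite Rinv_r; lra|lra]).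
    apply Rinv_le_contravar; lra. }
  replace r with (R0 * (r / R0)) by (field; lra). unfold Rdiv at 1.
  apply Rmult_le_compat_l; lra.
Qed.

(** The lower bound compares the second moment with the mean through [n <= n^2]; the upper bound is
    monotonicity in [r]. *)
Let var_bounds (v0 v r : R) : 1 <= v <= v0 -> 0 < r <= R0 -> v * mean r = 1 ->
  1 <= v * var r <= v0 * var R0.
Proof.
  intros Hv Hr Hm.
  assert (Hp : forall n, 0 <= c n * r ^ n).
  { intros n. apply Rmult_le_pos; [apply Hc|apply pow_le; lra]. }
  assert (Hex2r := ex_series_moment2 c R0 Hc Hexc2 r ltac:(lra)).
  split.
  - rewrite <- Hm. apply Rmult_le_compat_l; [lra|]. apply Series_le; [|exact Hex2r].
    intros n. split; [apply Rmult_le_pos; [apply pos_INR|apply Hp]|].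
    apply Rmult_le_compat_r; [apply Hp|apply INR_le_sq].
  - assert (H0 : 0 <= var r).
    { apply Series_nonneg; [|exact Hex2r]. intros n. apply Rmult_le_pos; [apply pow2_ge_0|apply Hp]. }
    apply Rmult_le_compat; [lra|exact H0|lra|]. apply Series_le; [|exact Hexc2].
    intros n. split; [apply Rmult_le_pos; [apply pow2_ge_0|apply Hp]|].
    apply Rmult_le_compat_l; [apply pow2_ge_0|]. apply Rmult_le_compat_l; [apply Hc|].
    apply pow_incr. lra.
Qed.

(** The two terms of the bound come from different ranges of [t]: the first from [|t| < d], where
    the quadratic expansion holds, the second from [|t| >= d], where integrand and Gaussian are each
    at most [M exp (- N a)]. *)
Lemma integrand_comparison (v0 kap : R) : 1 <= v0 -> 0 < kap ->
  exists M a, 0 <= M /\ 0 < a /\ (forall r, 0 <= r <= R0 -> Cmod (f r) <= M) /\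
  forall N v r t, 1 <= v <= v0 -> 0 < r <= R0 -> v * mean r = 1 -> - PI <= t <= PI ->
  Cmod (h v N r t - f r * RtoC (exp (- (INR N * (v * var r) / 2 * t ^ 2)))) <=
  2 * kap * exp (- (INR N / 8 * t ^ 2)) + 2 * M * exp (- (INR N * a)).
Proof.
  intros Hv0 Hkap. assert (HPI := PI_RGT_0).
  destruct (polar_bounded f R0 HR0 Hfc) as [M [HM HfM]].
  assert (HfrM : forall r, 0 <= r <= R0 -> Cmod (f r) <= M).
  { intros r Hr. replace (RtoC r) with (r * cis 0)%C by (rewrite cis_0; ring). apply HfM; lra. }
  (* [/ 4] is what [gaussian_comparison] asks for; the other bound makes [24 M eta], its error times
     that of [f], at most [kap]. *)
  set (eta := Rmin (/ 4) (kap / (24 * (M + 1)))).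
  assert (Heta : 0 < eta <= / 4).
  { split; [apply Rmin_pos; [lra|apply Rdiv_lt_0_compat; lra]|apply Rmin_l]. }
  assert (HetaM : 24 * M * eta <= kap).
  { apply Rle_trans with (24 * (M + 1) * (kap / (24 * (M + 1)))); [|right; field; lra].
    apply Rmult_le_compat; try lra. apply Rmin_r. }
  destruct (theta_factor v0 kap Hv0 Hkap) as [d1 [Hd1 H1]].
  destruct (gbar_quadratic c R0 Hc HR0 Hexc Hexc2 (eta / v0)) as [d2 [Hd2 H2]];
    [apply Rdiv_lt_0_compat; lra|].
  destruct (Hdecay (R0 / v0)) as [c0 [Hc0 Hdec]].
  { split; [apply Rdiv_lt_0_compat; lra|]. apply Rle_div_l; nra. }
  set (d := Rmin d1 d2). assert (Hd : 0 < d) by now apply Rmin_pos.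
  (* [c0] governs the decay of the integrand, [/ 2] that of the Gaussian, since [A >= 1]. *)
  set (c1 := Rmin c0 (/ 2)). assert (Hc1 : 0 < c1) by (apply Rmin_pos; lra).
  assert (Hc10 : c1 <= c0) by apply Rmin_l. assert (Hc12 : c1 <= / 2) by apply Rmin_r.
  exists M, (c1 * d ^ 2). split; [exact HM|]. split; [apply Rmult_lt_0_compat; nra|].
  split; [exact HfrM|].
  intros N v r t Hv Hr Hm Ht.
  assert (HN := pos_INR N).
  assert (HtPI : Rabs t <= PI) by now apply Rabs_le.
  assert (HA := var_bounds v0 v r Hv Hr Hm). set (A := v * var r) in *.
  set (fX := (f (r * cis t) * Cexp (v * gdiff b r t))%C).
  set (Y0 := (v * gdiff c r t - Ci * RtoC t)%C).
  set (g := RtoC (exp (- (INR N * A / 2 * t ^ 2)))).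
  change (h v N r t) with (fX * Cexp (INR N * Y0))%C.
  set (e8 := exp (- (INR N / 8 * t ^ 2))). set (eN := exp (- (INR N * (c1 * d ^ 2)))).
  assert (Hpos1 : 0 < e8) by apply exp_pos. assert (Hpos2 : 0 < eN) by apply exp_pos.
  destruct (Rlt_dec (Rabs t) d) as [Hnear|Hfar].
  - assert (Hn1 := lt_Rmin_l Hnear).
    assert (Hn2 := lt_Rmin_r Hnear).
    specialize (H1 v r t Hv ltac:(lra) Hn1 HtPI). fold fX in H1.
    specialize (H2 r t ltac:(lra) Hn2). fold (mean r) (var r) in H2.
    (* [E] is [v] times the remainder of [gbar_quadratic], because [v * mean r = 1]. *)
    set (E := (Y0 + RtoC (A * t ^ 2 / 2))%C).
    assert (HE : Cmod E <= eta * t ^ 2).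
    { replace E with (v * (gdiff c r t
        - Ci * RtoC (mean r * t) + RtoC (var r * t ^ 2 / 2)))%C.
      - rewrite Cmod_scale by lra.
        apply Rle_trans with (v0 * (eta / v0 * t ^ 2)); [|right; field; lra].
        apply Rmult_le_compat; try lra. apply Cmod_ge_0.
      - unfold E, Y0, A. replace (v * var r * t ^ 2 / 2) with (v * (var r * t ^ 2 / 2)) by field.
        replace (RtoC t) with (v * RtoC (mean r * t))%C.
        + rewrite (RtoC_mult v). ring.
        + rewrite <- RtoC_mult. f_equal. rewrite <- Rmult_assoc, Hm. ring. }
    destruct (gaussian_comparison eta A (INR N) t E Heta (proj1 HA) HN HE) as [G1 G2]. fold e8 in G1, G2.
    replace (RtoC (- (A * t ^ 2 / 2)) + E)%C with Y0 in G1, G2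
      by (unfold E; rewrite RtoC_opp; ring).
    fold g in G2.
    replace (fX * Cexp (INR N * Y0) - f r * g)%C with
      ((fX - f r) * Cexp (INR N * Y0) + f r * (Cexp (INR N * Y0) - g))%C by ring.
    le_trans_by Cmod_triangle. rewrite !Cmod_mult.
    specialize (HfrM r ltac:(lra)).
    assert (K1 : Cmod (fX - f r) * Cmod (Cexp (INR N * Y0)) <= kap * e8).
    { apply Rmult_le_compat; try apply Cmod_ge_0; assumption. }
    assert (K2 : Cmod (f r) * Cmod (Cexp (INR N * Y0) - g) <=
      M * (24 * eta * e8)).
    { apply Rmult_le_compat; try apply Cmod_ge_0; assumption. }
    assert (K3 : M * (24 * eta * e8) <= kap * e8).
    { rewrite <- Rmult_assoc. apply Rmult_le_compat_r; lra. }
    assert (K4 : 0 <= 2 * M * eN) by (apply Rmult_le_pos; lra).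
    lra.
  - assert (Htd : d ^ 2 <= t ^ 2).
    { rewrite (Rabs_sq t). apply pow_incr. lra. }
    assert (HgN : Cmod g <= eN).
    { unfold g. rewrite Cmod_R, Rabs_pos_eq by (left; apply exp_pos). apply exp_le_mono.
      apply Ropp_le_contravar.
      replace (INR N * A / 2 * t ^ 2) with (INR N * (A / 2 * t ^ 2)) by field.
      apply Rmult_le_compat_l; [exact HN|]. apply Rmult_le_compat; try lra; try nra. }
    assert (HYN : Cmod (Cexp (INR N * Y0)) <= eN).
    { rewrite Cmod_Cexp. apply exp_le_mono.
      assert (HRe := Re_gbar_minus c R0 Hc Hexc r t ltac:(lra)).
      assert (Hlow := mean_radius v0 v r Hv Hr Hm).
      specialize (Hdec r t ltac:(lra) HtPI).
      set (y := (gdiff c r t)) in *.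
      replace (fst (INR N * Y0)%C) with (INR N * (v * fst y)).
      - rewrite HRe. rewrite <- Ropp_mult_distr_r, <- Ropp_mult_distr_r. apply Ropp_le_contravar.
        apply Rmult_le_compat_l; [exact HN|].
        assert (c1 * d ^ 2 <= c0 * t ^ 2) by (apply Rmult_le_compat; try lra; nra).
        set (S := Series (fun n => c n * r ^ n * (1 - cos (INR n * t)))) in *. assert (0 <= S) by (generalize (pow2_ge_0 t); nra). nra.
      - unfold Y0. unfold Ci, Cminus, Cplus, Copp, Cmult, RtoC. cbn [fst snd]. ring. }
    assert (HfX : Cmod fX <= M).
    { unfold fX. rewrite Cmod_mult.
      assert (Cmod (Cexp (v * gdiff b r t)) <= 1) by (apply Cmod_Cexp_gdiff_le_1; lra).
      rewrite <- (Rmult_1_r M). apply Rmult_le_compat; try apply Cmod_ge_0; [apply HfM; lra|assumption]. }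
    le_trans_by Cmod_triangle_minus. rewrite !Cmod_mult.
    specialize (HfrM r ltac:(lra)).
    assert (K1 : Cmod fX * Cmod (Cexp (INR N * Y0)) <= M * eN).
    { apply Rmult_le_compat; try apply Cmod_ge_0; assumption. }
    assert (K2 : Cmod (f r) * Cmod g <= M * eN).
    { apply Rmult_le_compat; try apply Cmod_ge_0; assumption. }
    assert (K3 : 0 <= 2 * kap * e8) by (apply Rmult_le_pos; lra).
    lra.
Qed.

Lemma CI_gaussian (z : C) (B : R) :
  CI (fun t => z * RtoC (exp (- (B * t ^ 2))))%C (- PI) PI =
  (z * RtoC (RInt (gaussian B) (- PI) PI))%C.
Proof.
  assert (HPI := PI_RGT_0).
  rewrite CI_scal; [|lra|intros t _; apply pcont_real, continuous_exp_sq].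
  f_equal. unfold CI. apply injective_projections; simpl; [reflexivity|].
  rewrite RInt_const. unfold scal; simpl; unfold mult; simpl. ring.
Qed.

Lemma saddle_point (v0 eps : R) : 1 <= v0 -> 0 < eps -> exists N0 : nat, forall (N : nat) (v r : R),
  (N0 <= N)%nat -> 1 <= v <= v0 -> 0 < r <= R0 -> v * mean r = 1 ->
  Cmod (taylor R0 (F v N) N *
    RtoC (r ^ N * sqrt (2 * PI * INR N * (v * var r)) / exp (v * (val b r + INR N * val c r)))
    - f r) < eps.
Proof.
  intros Hv0 Heps. assert (HPI := PI_RGT_0). assert (HPI2 : 2 <= PI) by (generalize PI2_1; lra).
  assert (HPI4 := PI_4).
  set (A1 := v0 * var R0).
  assert (HA1 : 0 <= A1).
  { unfold A1. apply Rmult_le_pos; [lra|]. apply Series_nonneg; [|exact Hexc2].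
    intros n. apply Rmult_le_pos; [apply pow2_ge_0|]. apply Rmult_le_pos; [apply Hc|apply pow_le; lra]. }
  (* After normalisation the error near 0 is at most [4 kap sqrt (4 A1)], to be kept below
     [eps / 2]. *)
  set (kap := eps / (8 * (sqrt (4 * A1) + 1))).
  assert (Hs4 := sqrt_pos (4 * A1)).
  assert (Hkap : 0 < kap) by (apply Rdiv_lt_0_compat; lra).
  destruct (integrand_comparison v0 kap Hv0 Hkap) as [M [a [HM [Ha [HfrM Hcmp]]]]].
  (* [Q / N] collects the range away from 0, bounded through [exp_opp_le_inv_sq], and the truncation
     error [4 M / N] of the Gaussian integral. *)
  set (Q := 16 * PI * M * (1 + A1) * 2 / a ^ 2 + 4 * M).
  assert (Ha2 : 0 < a ^ 2) by now apply pow_lt.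
  assert (HQ : 0 <= Q).
  { unfold Q. assert (0 <= 16 * PI * M * (1 + A1) * 2 / a ^ 2); [|lra].
    apply Rdiv_le_0_compat; [|exact Ha2].
    replace (16 * PI * M * (1 + A1) * 2) with (32 * (PI * (M * (1 + A1)))) by ring.
    assert (0 <= M * (1 + A1)) by (apply Rmult_le_pos; lra). nra. }
  destruct (nfloor_ex (2 * Q / eps)) as [n0 Hn0]; [apply Rdiv_le_0_compat; lra|].
  exists (S n0). intros N v r HN Hv Hr Hm.
  assert (HNQ : 2 * Q / eps < INR N).
  { apply Rlt_le_trans with (INR n0 + 1); [apply Hn0|]. rewrite <- S_INR. now apply le_INR. }
  assert (HN1 : 1 <= INR N).
  { change 1 with (INR 1). apply le_INR. lia. }
  assert (HQN : Q / INR N < eps / 2).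
  { apply Rlt_div_l in HNQ; [|lra]. apply Rlt_div_l; lra. }
  assert (HA := var_bounds v0 v r Hv Hr Hm). fold A1 in HA.
  specialize (Hcmp N v r). set (A := v * var r) in *. specialize (HfrM r ltac:(lra)).
  rewrite taylor_normalized by (assumption || lra).
  set (B := INR N * A / 2). assert (HB : 0 < B) by (unfold B; nra).
  set (s := sqrt (B / PI)). assert (Hs : 0 <= s) by apply sqrt_pos.
  set (G := RInt (gaussian B) (- PI) PI).
  assert (HG : Rabs (s * G - 1) <= 4 / INR N).
  { assert (U := gaussian_integral_le B PI HB ltac:(lra)). assert (L := gaussian_integral_ge B PI HB HPI).
    fold s G in U, L. rewrite Rabs_left1 by lra.
    apply Rle_trans with (2 / (B * PI ^ 2)); [lra|].
    replace (4 / INR N) with (2 / (INR N / 2)) by (field; lra).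
    apply Rmult_le_compat_l; [lra|]. apply Rinv_le_contravar; [lra|]. unfold B.
    assert (1 <= PI ^ 2) by nra. assert (INR N <= INR N * A) by nra.
    assert (0 <= (INR N * A / 2) * (PI ^ 2 - 1)) by (apply Rmult_le_pos; lra). lra. }
  assert (Hh := h_cont v N r ltac:(lra)).
  assert (Hgc : pcont_on (fun t => f r * RtoC (exp (- (B * t ^ 2))))%C (- PI) PI).
  { intros t _. apply pcont_scal. apply pcont_real, continuous_exp_sq. }
  set (I8 := RInt (gaussian (INR N / 8)) (- PI) PI).
  set (e := exp (- (INR N * a))).
  assert (Hdiff : Cmod (CI (h v N r) (- PI) PI - f r * RtoC G) <= 2 * (2 * kap * I8 + 2 * PI * (2 * M * e))).
  { unfold G. rewrite <- CI_gaussian, <- CI_minus by (assumption || lra).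
    replace (2 * kap * I8 + 2 * PI * (2 * M * e)) with
      (RInt (fun t => 2 * kap * exp (- (INR N / 8 * t ^ 2)) + 2 * M * e) (- PI) PI).
    - apply Cmod_CI_le; [lra| | |].
      + intros t Ht. apply pcont_minus; [now apply Hh|now apply Hgc].
      + apply ex_RInt_of_derive. intros x'. auto_derive. trivial.
      + intros t Ht. exact (Hcmp t Hv Hr Hm Ht).
    - apply is_RInt_unique.
      apply (is_RInt_plus (V := RV) (fun t => 2 * kap * exp (- (INR N / 8 * t ^ 2))) (fun _ => 2 * M * e)).
      + apply (is_RInt_scal (V := RV)). apply (RInt_correct (V := RB)).
        apply ex_RInt_exp_sq.
      + replace (2 * PI * (2 * M * e)) with (scal (PI - - PI) (2 * M * e)).
        * apply (is_RInt_const (V := RV)).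
        * unfold scal; simpl; unfold mult; simpl. ring. }
  (* [s] normalises [exp (- N A t^2 / 2)], whereas [I8] has exponent [N t^2 / 8]; the ratio of the
     normalising factors is [sqrt (4 A)]. *)
  assert (HsI8 : s * I8 <= sqrt (4 * A1)).
  { assert (U := gaussian_integral_le (INR N / 8) PI ltac:(lra) ltac:(lra)). fold I8 in U.
    assert (Hs2 : s = sqrt (4 * A) * sqrt (INR N / 8 / PI)).
    { unfold s, B. rewrite <- sqrt_mult_alt by lra. f_equal. field. lra. }
    rewrite Hs2, Rmult_assoc. rewrite <- (Rmult_1_r (sqrt (4 * A1))).
    apply Rmult_le_compat; [apply sqrt_pos| |apply sqrt_le_1_alt; lra|exact U].
    apply Rmult_le_pos; [apply sqrt_pos|]. apply RInt_ge_0; [lra|apply ex_RInt_exp_sq|].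
    intros. left. apply exp_pos. }
  assert (Hse : s * e <= 4 * (1 + A1) / a ^ 2 / INR N).
  { assert (Hs1 : s <= INR N * (1 + A1)).
    { assert (HBA : 0 <= B / PI <= INR N * A1).
      { split; [apply Rdiv_le_0_compat; lra|]. apply Rle_div_l; [lra|]. unfold B.
        assert (INR N * A <= INR N * A1) by (apply Rmult_le_compat_l; lra).
        assert (0 <= INR N * A1 * (PI - 1)) by (apply Rmult_le_pos; [apply Rmult_le_pos|]; lra).
        assert (0 <= INR N * A) by (apply Rmult_le_pos; lra). lra. }
      assert (Hss := sqrt_sqrt (B / PI) (proj1 HBA)). fold s in Hss. nra. }
    assert (He := exp_opp_le_inv_sq (INR N * a) ltac:(nra)). fold e in He.
    apply Rle_trans with (INR N * (1 + A1) * (4 / (INR N * a) ^ 2)).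
    - apply Rmult_le_compat; [exact Hs|left; apply exp_pos|exact Hs1|exact He].
    - right. field. lra. }
  replace (s * CI (h v N r) (- PI) PI - f r)%C with
    (s * (CI (h v N r) (- PI) PI - f r * RtoC G) + f r * RtoC (s * G - 1))%C.
  2:{ rewrite RtoC_minus, RtoC_mult. ring. }
  lt_trans_by Cmod_triangle. rewrite !Cmod_mult, !Cmod_R, (Rabs_pos_eq s) by exact Hs.
  assert (K1 : s * Cmod (CI (h v N r) (- PI) PI - f r * RtoC G) <=
    4 * kap * (s * I8) + 8 * PI * M * (s * e)).
  { replace (4 * kap * (s * I8) + 8 * PI * M * (s * e)) with
      (s * (2 * (2 * kap * I8 + 2 * PI * (2 * M * e)))) by ring.
    apply Rmult_le_compat_l; assumption. }
  assert (K2 : Cmod (f r) * Rabs (s * G - 1) <= M * (4 / INR N)).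
  { apply Rmult_le_compat; [apply Cmod_ge_0|apply Rabs_pos|exact HfrM|exact HG]. }
  assert (K3 : 4 * kap * (s * I8) <= eps / 2).
  { apply Rle_trans with (4 * kap * (sqrt (4 * A1) + 1)); [apply Rmult_le_compat_l; lra|].
    unfold kap. right. field. lra. }
  assert (K4 : 8 * PI * M * (s * e) <= 8 * PI * M * (4 * (1 + A1) / a ^ 2 / INR N)).
  { apply Rmult_le_compat_l; [nra|exact Hse]. }
  assert (K5 : 8 * PI * M * (4 * (1 + A1) / a ^ 2 / INR N) + M * (4 / INR N) = Q / INR N).
  { unfold Q. field. lra. }
  lra.
Qed.
End SaddlePoint.

(** * The cycle index of the symmetric group *)

Module CycleIndex.
From mathcomp Require Import all_boot all_order all_algebra all_fingroup.
From mathcomp Require Import Rstruct.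
Import GroupScope GRing.Theory Num.Theory.
Set Implicit Arguments.
Unset Strict Implicit.
Unset Printing Implicit Defensive.
Local Open Scope ring_scope.

Section MergeFixedPoint.
Variables (T : finType) (a b : T) (s : {perm T}).
Hypothesis ab : a != b.
Hypothesis sb : s b = b.

(** Inserts the fixed point [b] into the cycle of [a], right after [a]: the left factor acts first,
    so [a] goes to [b] and [b] to [s a]. *)
Let s' : {perm T} := (tperm a b * s)%g.

Let s'a : s' a = b. Proof. by rewrite permM tpermL. Qed.
Let s'b : s' b = s a. Proof. by rewrite permM tpermR. Qed.
Let s'D x : x != a -> x != b -> s' x = s x.
Proof. by move=> xa xb; rewrite permM tpermD // eq_sym. Qed.

Let iter_b i : (s ^+ i)%g b = b.
Proof. by elim: i => [|i IHi]; rewrite ?expg0 ?perm1 // expgSr permM IHi. Qed.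

Lemma porbit_fixed : b \notin porbit s a.
Proof.
apply/negP; rewrite porbit_sym => /porbitP [i]; rewrite iter_b => e.
by move: ab; rewrite e eqxx.
Qed.

Lemma porbit_merge_other x : x != b -> x \notin porbit s a -> porbit s' x = porbit s x.
Proof.
move=> xb xa.
have iterE i : (s' ^+ i)%g x = (s ^+ i)%g x.
  elim: i => [|i IHi]; first by rewrite !expg0.
  rewrite (expgSr s') (permM (s' ^+ i)) IHi (expgSr s) (permM (s ^+ i)); apply: s'D.
    apply: contraNneq xa => <-; rewrite porbit_sym; exact: mem_porbit.
  apply: contra xb => /eqP e; apply/eqP; apply: (@perm_inj _ (s ^+ i)%g).
  by rewrite e iter_b.
apply/setP => y; apply/porbitP/porbitP => -[i ->]; exists i; by rewrite iterE.
Qed.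

Lemma porbit_merge : porbit s' a = b |: porbit s a.
Proof.
apply/setP => y; rewrite in_setU1; apply/idP/idP.
  apply: contraLR; rewrite negb_or => /andP [yb ya].
  by rewrite porbit_sym porbit_merge_other // porbit_sym.
have next z : z \in porbit s' a -> s' z \in porbit s' a.
  move=> /porbitP [i ->]; rewrite -permM -expgSr; exact: mem_porbit.
have bin : b \in porbit s' a by rewrite -s'a; apply: next; exact: porbit_id.
case/orP => [/eqP -> //|/porbitP [i ->]].
elim: i => [|i IHi]; first by rewrite expg0 perm1 porbit_id.
rewrite expgSr permM.
have [-> | za] := eqVneq ((s ^+ i)%g a) a; first by rewrite -s'b next.
rewrite -s'D ?next //; apply: contraNneq porbit_fixed => <-; exact: mem_porbit.
Qed.

Lemma card_porbit_merge : #|porbit s' a| = #|porbit s a|.+1.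
Proof. by rewrite porbit_merge cardsU1 porbit_fixed. Qed.

(** Inserting [b] alters only the cycle of [a], which [a \notin C] discards; on the side of [s], the
    fixed point [b] is discarded by [C \subset A :\ b]. *)
Lemma mem_porbits_merge (A C : {set T}) : b \in A ->
  [&& C \in porbits s', C \subset A & a \notin C] =
  [&& C \in porbits s, C \subset A :\ b & a \notin C].
Proof.
move=> bA; apply/and3P/and3P => -[].
  move=> /imsetP [x _ ->] CA aC.
  have xP : x \notin porbit s' a by rewrite porbit_sym.
  move: (xP); rewrite porbit_merge in_setU1 negb_or => /andP [xb xa].
  move: CA aC; rewrite porbit_merge_other // => CA aC.
  split=> //; first by rewrite imset_f.
  rewrite subsetD1 CA /= porbit_sym; apply/negP => /porbitP [i].
  by rewrite iter_b => e; move: xb; rewrite e eqxx.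
move=> /imsetP [x _ ->]; rewrite subsetD1 => /andP [CA bC] aC.
have xa : x \notin porbit s a by rewrite porbit_sym.
have xb : x != b by apply: contraNneq bC => <-; exact: porbit_id.
rewrite -porbit_merge_other //; split; rewrite ?porbit_merge_other //.
by rewrite -porbit_merge_other // imset_f.
Qed.
End MergeFixedPoint.

Section Weights.
Variables (R : comNzRingType) (x : nat -> R).

(** Only cycles inside [A] count: points outside [A], fixed by the permutations of [A], would
    otherwise contribute factors [x 1]. *)
Definition cycle_weight (T : finType) (A : {set T}) (s : {perm T}) : R :=
  \prod_(C in porbits s | C \subset A) x #|C|.

(* Total cycle weight of the permutations of [A], where the cycle through [a]
   is counted as if it had [k] more elements. *)
Definition marked_sum (T : finType) (k : nat) (A : {set T}) (a : T) : R :=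
  \sum_(s : {perm T} | perm_on A s)
     x (k + #|porbit s a|) * \prod_(C in porbits s | (C \subset A) && (a \notin C)) x #|C|.

Definition total_sum (T : finType) (A : {set T}) : R :=
  \sum_(s : {perm T} | perm_on A s) cycle_weight A s.

Lemma porbit_sub (T : finType) (A : {set T}) (s : {perm T}) (a : T) :
  perm_on A s -> a \in A -> porbit s a \subset A.
Proof.
move=> sA aA; apply/subsetP => y /porbitP [i ->].
elim: i => [|i IHi]; first by rewrite expg0 perm1.
by rewrite expgSr permM (perm_closed _ sA).
Qed.

Lemma total_sum_marked (T : finType) (A : {set T}) (a : T) :
  a \in A -> total_sum A = marked_sum 0 A a.
Proof.
move=> aA; apply: eq_bigr => s sA; rewrite /cycle_weight.
rewrite (bigD1 (porbit s a)) /=; last by rewrite imset_f // porbit_sub.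
congr (_ * _); apply: eq_bigl => C.
have [/imsetP [y _ ->] /= | //] := boolP (C \in porbits s).
by rewrite eq_porbit_mem porbit_sym.
Qed.

(** Sort by the image [b] of [a]. If [b = a], the marked cycle is closed with total length [k + 1];
    otherwise deleting [b] shortens it by one, which [k + 1] records, so that [x] is still taken at
    the original length. *)
Lemma marked_sum_rec (T : finType) (k : nat) (A : {set T}) (a : T) : a \in A ->
  marked_sum k A a =
  x k.+1 * total_sum (A :\ a) + \sum_(b in A :\ a) marked_sum k.+1 (A :\ b) a.
Proof.
move=> aA; rewrite /marked_sum.
rewrite (partition_big (fun s : {perm T} => s a) (mem A)) /=; last first.
  by move=> s sA; rewrite (perm_closed _ sA).
rewrite (bigD1 a) //=; congr (_ + _).
  rewrite /total_sum mulr_sumr; apply: eq_big => [s|s /andP [sA /eqP saa]].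
    apply/andP/idP => [[sA /eqP saa]|sA].
      apply/subsetP => y ysy; rewrite in_setD1 (subsetP sA) // andbT.
      by apply: contraTneq ysy => ->; rewrite inE saa eqxx.
    split; first by apply: subset_trans sA _; rewrite subD1set.
    by rewrite (out_perm sA) // in_setD1 eqxx.
  have pa : porbit s a = [set a].
    apply/setP => y; rewrite in_set1; apply/porbitP/eqP => [[i ->]|->].
      by elim: i => [|i IHi]; rewrite ?expg0 ?perm1 // expgSr permM IHi.
    by exists 0%N; rewrite expg0 perm1.
  rewrite pa cards1 addn1; congr (_ * _); apply: eq_bigl => C; congr (_ && _).
  by rewrite subsetD1.
apply: eq_big => [b|b /andP [bA ba]]; first by rewrite in_setD1 andbC.
have ab : a != b by rewrite eq_sym.
(* Left multiplication by [tperm a b] matches the permutations of [A :\ b] with those of [A] sending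
   [a] to [b]. *)
rewrite (reindex_inj (mulgI (tperm a b))) /=.
have tA : perm_on A (tperm a b).
  apply/subsetP => y; rewrite inE; case: tpermP => [-> //|-> //|_ _]; by rewrite eqxx.
apply: eq_big => [s|s].
  rewrite permM tpermL; apply/andP/idP => [[tsA /eqP sb]|sA].
    have sA : perm_on A s.
      by rewrite -[s](mulKg (tperm a b)) perm_onM // perm_onV.
    apply/subsetP => y ysy; rewrite in_setD1 (subsetP sA) // andbT.
    by apply: contraTneq ysy => ->; rewrite inE sb eqxx.
  have sA' : perm_on A s by apply: subset_trans sA _; rewrite subD1set.
  split; first exact: perm_onM.
  by rewrite (out_perm sA) // in_setD1 eqxx.
rewrite permM tpermL => /andP [_ /eqP sb].
rewrite card_porbit_merge // addnS addSn; congr (_ * _); apply: eq_bigl => C.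
by have := mem_porbits_merge ab sb C bA.
Qed.

Variable h : nat -> R.
Hypothesis h0 : h 0 = 1.
Hypothesis hS : forall n, n.+1%:R * h n.+1 = \sum_(i < n.+1) x i.+1 * h (n - i).

(** Induction on the size of [A]: the recursion for [marked_sum] solves to a sum over the length of
    the marked cycle, which [hS] evaluates. *)
Lemma total_sum_card (T : finType) (A : {set T}) : total_sum A = #|A|`!%:R * h #|A|.
Proof.
have [n] := ubnP #|A|; elim: n T A => // n IHn T A /ltnSE An.
have [->|[a aA]] := set_0Vmem A.
  rewrite cards0 h0 mulr1 /total_sum (big_pred1 1%g) => [|s].
    rewrite /cycle_weight big1 // => C /andP [/imsetP [y _ ->]].
    by rewrite subset0 => /eqP /setP /(_ y); rewrite porbit_id inE.
  apply/idP/eqP => [/subsetP s0|->]; last exact: perm_on1.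
  apply/permP => y; rewrite perm1; apply/eqP/negPn/negP => ny.
  by have := s0 y ny; rewrite inE.
(* [i.+1] is the length of the cycle of [a] in [B], and [m - i] the number of points of [B] outside
   it. *)
have marked m k (B : {set T}) : #|B| = m.+1 -> (m.+1 <= n)%N -> a \in B ->
    marked_sum k B a = m`!%:R * \sum_(i < m.+1) x (k + i.+1) * h (m - i).
  elim: m k B => [|m IHm] k B Bm mn aB; rewrite marked_sum_rec //.
    have cB : #|B :\ a| = 0%N by move: Bm; rewrite (cardsD1 a) aB => -[].
    rewrite IHn ?cB // big1 => [|b]; last by rewrite (cards0_eq cB) inE.
    by rewrite addr0 big_ord1 subn0 h0 fact0 !mulr1 mul1r addn1.
  have cB : #|B :\ a| = m.+1 by move: Bm; rewrite (cardsD1 a) aB => -[].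
  rewrite IHn ?cB //.
  rewrite (eq_bigr (fun=> m`!%:R * \sum_(i < m.+1) x (k.+1 + i.+1) * h (m - i))); last first.
    move=> b; rewrite in_setD1 => /andP [ba bB].
    have cBb : #|B :\ b| = m.+1 by move: Bm; rewrite (cardsD1 b) bB => -[].
    by rewrite IHm // ?in_setD1 1?eq_sym ?ba // ltnW.
  (* Each of the [m.+1] points [b] contributes equally, which turns the factorial of [m] into that
     of [m.+1]. *)
  rewrite sumr_const cB -mulrnAl -mulrnA mulnC -factS [in RHS]big_ord_recl /= subn0 addn1 mulrDr.
  congr (_ + _); first by rewrite mulrCA.
  congr (_ * _); apply: eq_bigr => i _.
  by rewrite /bump /= add1n !addnS !addSn subSS.
rewrite (total_sum_marked aA).
case En : #|A| An => [|m] mn; first by rewrite (cards0_eq En) inE in aA.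
by rewrite (marked m) // factS natrM -mulrA mulrCA hS.
Qed.
End Weights.

(** Cycles are grouped by length: a cycle is nonempty and has at most [N] points, so its length
    occurs in the range of [j]. *)
Lemma prod_ncycles (R : comNzRingType) (x : nat -> R) (N : nat) (s : {perm 'I_N}) :
  \prod_(1 <= j < N.+1) x j ^+ ncycles j s = cycle_weight x setT s.
Proof.
rewrite /cycle_weight.
transitivity (\prod_(1 <= j < N.+1) \prod_(C in porbits s | #|C| == j) x #|C|).
  apply: eq_bigr => j _; rewrite (eq_bigr (fun=> x j)) => [|C /andP [_ /eqP -> //]].
  by rewrite prodr_const; congr (_ ^+ _); apply: eq_card => C; rewrite !inE.
rewrite (exchange_big_dep (mem (porbits s))) /=; last by move=> j C _ /andP [].
apply: eq_big => [C|C Cs]; first by rewrite subsetT andbT.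
rewrite (eq_bigl (fun j => j == #|C|)) => [|j]; last by rewrite Cs eq_sym.
rewrite big_nat1_eq.
have /imsetP [y _ ->] := Cs.
have -> : (0 < #|porbit s y|)%N by apply/card_gt0P; exists y; exact: porbit_id.
by rewrite ltnS -[X in (_ <= X)%N]card_ord max_card.
Qed.

Lemma cycle_index_recurrence (x h : nat -> R) (N : nat) :
  h 0 = 1 -> (forall n, n.+1%:R * h n.+1 = \sum_(i < n.+1) x i.+1 * h (n - i)%N) ->
  (N`!%:R)^-1 * \sum_(s : {perm 'I_N}) \prod_(1 <= j < N.+1) x j ^+ ncycles j s = h N.
Proof.
move=> h0 hS.
have N0 : N`!%:R != 0 :> R by rewrite pnatr_eq0 -lt0n fact_gt0.
rewrite (eq_bigr _ (fun s _ => prod_ncycles x s)).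
have -> : \sum_(s : {perm 'I_N}) cycle_weight x setT s = total_sum x [set: 'I_N].
  by apply: eq_bigl => s; symmetry; apply/subsetP => y _; rewrite inE.
by rewrite (total_sum_card h0 hS) cardsT card_ord mulKf.
Qed.

Lemma sum_f_R0_bigE (u : nat -> R) (n : nat) : sum_f_R0 u n = \sum_(i < n.+1) u i.
Proof.
elim: n => [|n IHn]; first by rewrite big_ord1.
by rewrite big_ord_recr /= -IHn.
Qed.

Lemma H_N_of_recurrence (theta kappa h : nat -> R) (N : nat) :
  h 0 = IZR 1 ->
  (forall n, Rmult (INR n.+1) (h n.+1) =
     sum_f_R0 (fun i => Rmult (Rplus (theta i.+1) (Rmult (INR N) (kappa i.+1))) (h (Nat.sub n i))) n) ->
  H_N theta kappa N = h N.
Proof.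
move=> h0 hS; apply: (cycle_index_recurrence (x := fun j => theta j + N%:R * kappa j)) => // n.
transitivity (Rmult (INR n.+1) (h n.+1)); first by rewrite RmultE INRE.
rewrite hS sum_f_R0_bigE.
by apply: eq_bigr => i _; rewrite RmultE RplusE RmultE INRE.
Qed.
End CycleIndex.

(** * Coefficients of the exponential of a power series *)

(* Comparing coefficients in [p' = g' p] for [p = exp g]. *)
Lemma exp_pseries_recurrence (g p : nat -> R) (rho : R) : 0 < rho -> g 0%nat = 0 ->
  (forall x, 0 < x < rho -> ex_series (fun n => g n * x ^ n)) ->
  (forall x, Rabs x < rho -> is_series (fun n => p n * x ^ n) (exp (PSeries g x))) ->
  p 0%nat = 1 /\ forall n, INR (S n) * p (S n) =
    sum_f_R0 (fun i => INR (S i) * g (S i) * p (n - i)%nat) n.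
Proof.
  intros Hrho Hg0 Hg Hp.
  assert (Hp' : forall x, Rabs x < rho -> PSeries p x = exp (PSeries g x)).
  { intros x Hx. exact (is_series_unique _ _ (Hp x Hx)). }
  assert (Hrg : forall x, Rabs x < rho -> Rbar_lt (Rabs x) (CV_radius g)).
  { intros x. now apply CV_radius_gt. }
  assert (Hrp : forall x, Rabs x < rho -> Rbar_lt (Rabs x) (CV_radius p)).
  { intros x. apply CV_radius_gt. intros y Hy. eexists. apply Hp. rewrite Rabs_pos_eq; lra. }
  assert (Hrdg : forall x, Rabs x < rho -> Rbar_lt (Rabs x) (CV_radius (PS_derive g))).
  { intros x Hx. rewrite CV_radius_derive. now apply Hrg. }
  split.
  - rewrite <- (PSeries_0 p), Hp' by (rewrite Rabs_R0; exact Hrho).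
    rewrite PSeries_0, Hg0. apply exp_0.
  - intros n. change (PS_derive p n = PS_mult (PS_derive g) p n).
    assert (H0 : Rabs 0 < rho) by (rewrite Rabs_R0; exact Hrho).
    apply PSeries_ext_recip.
    + rewrite CV_radius_derive. rewrite <- Rabs_R0. now apply Hrp.
    + apply (CV_radius_pos _ rho Hrho). intros y Hy.
      assert (Hy' : Rabs y < rho) by (rewrite Rabs_pos_eq; lra).
      destruct (ex_pseries_mult (PS_derive g) p y (Hrdg y Hy') (Hrp y Hy')) as [l Hl].
      exists l. apply is_pseries_R. exact Hl.
    + exists (mkposreal rho Hrho). intros x Hx.
      assert (Hx' : Rabs x < rho).
      { change (Rabs (x - 0) < rho) in Hx. now rewrite Rminus_0_r in Hx. }
      rewrite PSeries_mult by auto. rewrite <- Derive_PSeries by auto.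
      rewrite (Derive_ext_loc (PSeries p) (fun x => exp (PSeries g x))).
      * apply is_derive_unique. rewrite Hp' by exact Hx'.
        apply (is_derive_comp exp (PSeries g)); [apply is_derive_exp|].
        apply is_derive_PSeries. now apply Hrg.
      * assert (Hd : 0 < rho - Rabs x) by lra.
        exists (mkposreal _ Hd). intros y Hy. apply Hp'.
        change (Rabs (y - x) < rho - Rabs x) in Hy.
        assert (H := Rabs_triang_inv y x). lra.
Qed.

(** * Boundary values and radial derivatives *)

Lemma at_left_interval (x : R) : 0 < x -> at_left x (fun y => 0 < y < x).
Proof.
  intros Hx. exists (mkposreal x Hx). intros y Hy Hlt.
  change (Rabs (y - x) < x) in Hy. apply Rabs_lt_between in Hy. lra.
Qed.

Lemma abel_nonneg_of_eq (a : nat -> R) (g : R -> R) (R0 L : R) :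
  0 < R0 -> (forall n, 0 <= a n) -> CV_radius a = Finite R0 ->
  (forall r, 0 < r < R0 -> g r = PSeries a r) ->
  filterlim g (at_left R0) (locally L) -> is_series (fun n => a n * R0 ^ n) L.
Proof.
  intros HR Ha Hrad Heq Hlim. apply abel_nonneg; auto.
  revert Hlim. apply filterlim_ext_loc.
  generalize (at_left_interval R0 HR). apply filter_imp. exact Heq.
Qed.

Section RadialDerivatives.
Context (c : nat -> R) (R0 : R).
Hypothesis HR0 : 0 < R0.
Hypothesis Hrad : CV_radius c = Finite R0.

(** [PS_incr_1] multiplies a series by its variable, so these are the coefficients of [z g']. *)
Lemma PS_incr_derive (n : nat) : PS_incr_1 (PS_derive c) n = INR n * c n.
Proof. destruct n as [|n]; [simpl; unfold zero; simpl; ring|reflexivity]. Qed.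

(** The coefficients of [z^2] times the second derivative, in the form [n^2 - n]: added to those of
    [z g'] they give [n^2 c_n], the series of [b_2]. *)
Lemma PS_incr_derive2 (n : nat) :
  PS_incr_1 (PS_incr_1 (PS_derive (PS_derive c))) n = (INR n ^ 2 - INR n) * c n.
Proof.
  destruct n as [|[|n]]; [simpl; unfold zero; simpl; ring|simpl; unfold zero; simpl; ring|].
  change (INR (S n) * (INR (S (S n)) * c (S (S n))) = (INR (S (S n)) ^ 2 - INR (S (S n))) * c (S (S n))).
  rewrite (S_INR (S n)). ring.
Qed.

Lemma CV_radius_moment1 : CV_radius (fun n => INR n * c n) = Finite R0.
Proof.
  rewrite <- Hrad, <- (CV_radius_derive c), <- (CV_radius_incr_1 (PS_derive c)).
  apply CV_radius_ext. intros n. symmetry. apply PS_incr_derive.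
Qed.

Lemma CV_radius_moment2 : CV_radius (fun n => (INR n ^ 2 - INR n) * c n) = Finite R0.
Proof.
  rewrite <- Hrad, <- (CV_radius_derive c), <- (CV_radius_derive (PS_derive c)),
    <- (CV_radius_incr_1 (PS_derive (PS_derive c))),
    <- (CV_radius_incr_1 (PS_incr_1 (PS_derive (PS_derive c)))).
  apply CV_radius_ext. intros n. symmetry. apply PS_incr_derive2.
Qed.

Let inside (r : R) : 0 <= r < R0 -> Rbar_lt (Rabs r) (CV_radius c).
Proof. intros Hr. rewrite Hrad, Rabs_pos_eq by lra. simpl. lra. Qed.

Lemma radial_derivative1 (r : R) : 0 <= r < R0 ->
  r * Derive (PSeries c) r = PSeries (fun n => INR n * c n) r.
Proof.
  intros Hr. rewrite Derive_PSeries by now apply inside.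
  rewrite <- PSeries_incr_1. apply PSeries_ext. apply PS_incr_derive.
Qed.

Lemma radial_derivative2 (r : R) : 0 <= r < R0 ->
  r ^ 2 * Derive_n (PSeries c) 2 r = PSeries (fun n => (INR n ^ 2 - INR n) * c n) r.
Proof.
  intros Hr. change (Derive_n (PSeries c) 2 r) with (Derive (Derive (PSeries c)) r).
  rewrite (Derive_ext_loc _ (PSeries (PS_derive c))).
  - rewrite Derive_PSeries by (rewrite CV_radius_derive; now apply inside).
    simpl pow. rewrite Rmult_1_r, Rmult_assoc, <- !PSeries_incr_1.
    apply PSeries_ext. apply PS_incr_derive2.
  - assert (Hd : 0 < R0 - r) by lra. exists (mkposreal _ Hd). intros y Hy.
    change (Rabs (y - r) < R0 - r) in Hy. apply Derive_PSeries. rewrite Hrad. simpl.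
    assert (H := Rabs_triang_inv y r).
    rewrite (Rabs_pos_eq r) in H by lra. lra.
Qed.
End RadialDerivatives.

(** With the boundary value identified as the series at [R0], the case [r = R0] calls for no
    separate treatment afterwards. *)
Lemma bval_series (g : R -> R) (a : nat -> R) (R0 L r : R) :
  (forall s, 0 < s < R0 -> g s = PSeries a s) -> is_series (fun n => a n * R0 ^ n) L ->
  0 < r <= R0 -> bval g R0 L r = Series (fun n => a n * r ^ n).
Proof.
  intros Hg HL Hr. unfold bval. destruct (Rlt_dec r R0) as [Hlt|Hge]; simpl.
  - apply Hg. lra.
  - assert (E : r = R0) by lra. subst r. exact (eq_sym (is_series_unique _ _ HL)).
Qed.

(** * Taylor coefficients and [H_N] *)

(** Serves to replace [gcomplex] by [gbar], known to agree with it on the disk. *)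
Lemma taylor_ext (F G : C -> C) (R0 : R) (n : nat) : 0 < R0 ->
  (forall z, Cmod z < R0 -> F z = G z) -> (forall z, Cmod z < R0 -> cdiff F z) ->
  taylor R0 F n = taylor R0 G n.
Proof.
  intros HR0 Heq HF. apply (pseries_C_unique _ _ F R0 HR0).
  - now apply taylor_correct.
  - intros z Hz. rewrite Heq by exact Hz. apply taylor_correct; [exact HR0| |exact Hz].
    intros w Hw. apply cdiff_ext_disk with F R0; [exact Heq|exact Hw|now apply HF].
Qed.

Lemma gcoef_plus (a b : nat -> R) (x : R) (n : nat) :
  gcoef (fun j => a j + x * b j) n = gcoef a n + x * gcoef b n.
Proof. destruct n as [|n]; cbn -[INR]; [ring|]. unfold Rdiv. ring. Qed.

Lemma INR_gcoef (a : nat -> R) (n : nat) : INR (S n) * gcoef a (S n) = a (S n).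
Proof. cbn -[INR]. field. apply not_0_INR. lia. Qed.

(** The weights [theta j + N kappa j] belong to one fixed [N] while the coefficient index runs; the
    recurrence determines the whole coefficient sequence, and its entry of index [N] is [H_N]. *)
Lemma taylor_exp_H_N (theta kappa : nat -> R) (R0 : R) (F : C -> C) (N : nat) :
  0 < R0 -> (forall z, Cmod z < R0 -> cdiff F z) ->
  (forall x, 0 < x < R0 -> ex_series (fun n => gcoef theta n * x ^ n)) ->
  (forall x, 0 < x < R0 -> ex_series (fun n => gcoef kappa n * x ^ n)) ->
  (forall x, Rabs x < R0 ->
     F x = RtoC (exp (PSeries (gcoef (fun j => theta j + INR N * kappa j)) x))) ->
  fst (taylor R0 F N) = H_N theta kappa N.
Proof.
  intros HR0 HF Hth Hka HFx.
  destruct (exp_pseries_recurrence (gcoef (fun j => theta j + INR N * kappa j))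
    (fun n => fst (taylor R0 F n)) R0 HR0 eq_refl) as [H0 HS].
  - intros x Hx.
    apply ex_series_ext with (fun n => gcoef theta n * x ^ n + INR N * (gcoef kappa n * x ^ n)).
    + intros n. rewrite gcoef_plus. unfold plus, scal; simpl. unfold mult; simpl. R_ring.
    + apply (ex_series_plus (K := R_AbsRing) (V := RV)); [now apply Hth|].
      apply ex_series_scal_R. now apply Hka.
  - intros x Hx.
    assert (H := taylor_correct R0 F HR0 HF x ltac:(now rewrite Cmod_R)).
    rewrite HFx in H by exact Hx. exact (proj1 (pseries_C_real_arg _ _ _ H)).
  - symmetry. apply (CycleIndex.H_N_of_recurrence (h := fun n => fst (taylor R0 F n))).
    + exact H0.
    + intros n. eapply eq_trans; [apply HS|]. apply sum_eq. intros i _. now rewrite INR_gcoef.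
Qed.

(** The equivalence is expressed by the normalised coefficient minus [f(r_v)]: this stays meaningful
    where [f(r_v)] vanishes, and gives a ratio tending uniformly to 1 wherever [|f(r_v)|] is bounded
    below. *)
Theorem theorem3p7 (theta kappa : nat -> R) (R0 Lth Lk L2 : R)
  (f : C -> C) (rv : R -> R)
  (Hth : forall j : nat, (1 <= j)%nat -> 0 <= theta j)
  (Hk : forall j : nat, (1 <= j)%nat -> 0 <= kappa j)
  (Hna : non_arithmetic kappa)
  (Hk2 : exists j : nat, (2 <= j)%nat /\ 0 < kappa j)
  (HR : 0 < R0)
  (Hradth : CV_radius (gcoef theta) = Finite R0)
  (Hradk : CV_radius (gcoef kappa) = Finite R0)
  (Hgth : filterlim (greal theta) (at_left R0) (locally Lth))
  (Hgk : filterlim (greal kappa) (at_left R0) (locally Lk))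
  (Hg1 : filterlim (g1real kappa) (at_left R0) (locally 1))
  (Hg2 : filterlim (g2real kappa) (at_left R0) (locally L2))
  (HL2 : 0 < L2)
  (Hhol : forall z : C, Cmod z < R0 ->
     ex_derive (K := C_AbsRing) (V := C_NormedModule) f z)
  (Hcont : forall z : C, Cmod z <= R0 ->
     filterlim f (within (fun w : C => Cmod w <= R0) (locally z)) (locally (f z)))
  (Hrv : forall v : R, 1 <= v ->
     0 < rv v <= R0 /\ bval (g1real kappa) R0 1 (rv v) = / v) :
  (forall v0 : R, 1 <= v0 -> forall eps : R, 0 < eps ->
     exists N0 : nat, forall (N : nat) (v : R), (N0 <= N)%nat -> 1 <= v <= v0 ->
       let r := rv v in
       let GN := bval (greal theta) R0 Lth r + INR N * bval (greal kappa) R0 Lk r in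
       let b2 := bval (g1real kappa) R0 1 r + bval (g2real kappa) R0 L2 r in
       Cmod (Cminus
         (Cmult
           (taylor R0 (fun z : C => Cmult (f z)
              (Cexp (Cmult (RtoC v)
                 (Cplus (gcomplex theta z) (Cmult (RtoC (INR N)) (gcomplex kappa z)))))) N)
           (RtoC (r ^ N * sqrt (2 * PI * INR N * v * b2) / exp (v * GN))))
         (f (RtoC r))) < eps)
  /\
  is_lim_seq (fun N : nat =>
     H_N theta kappa N * R0 ^ N * sqrt (2 * PI * INR N * (1 + L2))
       / exp (Lth + INR N * Lk)) 1.
Proof.
  assert (Hb := gcoef_nonneg theta Hth). assert (Hc := gcoef_nonneg kappa Hk).
  set (b := gcoef theta) in *. set (c := gcoef kappa) in *.
  assert (Hr1 : forall r, 0 < r < R0 -> g1real kappa r = PSeries (fun n => INR n * c n) r).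
  { intros r Hr. apply (radial_derivative1 c R0 Hradk). lra. }
  assert (Hr2 : forall r, 0 < r < R0 -> g2real kappa r = PSeries (fun n => (INR n ^ 2 - INR n) * c n) r).
  { intros r Hr. apply (radial_derivative2 c R0 Hradk). lra. }
  assert (Hp1 : forall n, 0 <= INR n * c n).
  { intros n. apply Rmult_le_pos; [apply pos_INR|apply Hc]. }
  assert (Hp2 : forall n, 0 <= (INR n ^ 2 - INR n) * c n).
  { intros n. apply Rmult_le_pos; [|apply Hc]. generalize (INR_le_sq n). lra. }
  assert (Sth := abel_nonneg b R0 Lth HR Hb Hradth Hgth).
  assert (Sk := abel_nonneg c R0 Lk HR Hc Hradk Hgk).
  assert (S1 := abel_nonneg_of_eq _ _ R0 1 HR Hp1 (CV_radius_moment1 c R0 Hradk) Hr1 Hg1).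
  assert (S2 := abel_nonneg_of_eq _ _ R0 L2 HR Hp2 (CV_radius_moment2 c R0 Hradk) Hr2 Hg2).
  assert (Hexb : ex_series (fun n => b n * R0 ^ n)) by (eexists; exact Sth).
  assert (Hexc : ex_series (fun n => c n * R0 ^ n)) by (eexists; exact Sk).
  assert (Hmean : Series (fun n => INR n * (c n * R0 ^ n)) = 1).
  { rewrite <- (is_series_unique _ _ S1). apply Series_ext. intros n. ring. }
  (* [n c_n] and [(n^2 - n) c_n] add up to [n^2 c_n]; the finite limits of both radial derivatives
     enter here. *)
  assert (Hexc2 : ex_series (fun n => INR n ^ 2 * (c n * R0 ^ n))).
  { exists (plus 1 L2). generalize (is_series_plus _ _ _ _ S1 S2). apply is_series_ext.
    intros n. unfold plus; simpl. R_ring. }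
  assert (Hsumr : forall r, 0 < r <= R0 ->
    bval (g1real kappa) R0 1 r = Series (fun n => INR n * (c n * r ^ n)) /\
    bval (g1real kappa) R0 1 r + bval (g2real kappa) R0 L2 r = Series (fun n => INR n ^ 2 * (c n * r ^ n))).
  { intros r Hr.
    assert (E1 : bval (g1real kappa) R0 1 r = Series (fun n => INR n * (c n * r ^ n))).
    { rewrite (bval_series _ _ R0 1 r Hr1 S1 Hr). apply Series_ext. intros n. ring. }
    split; [exact E1|].
    rewrite E1, (bval_series _ _ R0 L2 r Hr2 S2 Hr).
    assert (X2 := ex_series_moment2 c R0 Hc Hexc2 r ltac:(lra)).
    assert (X1 := ex_series_moment1 c R0 Hc Hexc2 r ltac:(lra)).
    rewrite (Series_ext (fun n => (INR n ^ 2 - INR n) * c n * r ^ n)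
      (fun n => INR n ^ 2 * (c n * r ^ n) - INR n * (c n * r ^ n))) by (intros; ring).
    rewrite Series_minus by assumption. ring. }
  assert (Hvalb : forall r, 0 < r <= R0 -> bval (greal theta) R0 Lth r = Series (fun n => b n * r ^ n)).
  { intros r Hr. now apply bval_series. }
  assert (Hvalc : forall r, 0 < r <= R0 -> bval (greal kappa) R0 Lk r = Series (fun n => c n * r ^ n)).
  { intros r Hr. now apply bval_series. }
  assert (Hdecay := fun r0 => real_part_decay kappa R0 r0 Hk Hna Hk2 Hexc).
  split.
  - intros v0 Hv0 eps Heps.
    assert (Hfd : forall z, Cmod z < R0 -> cdiff f z) by (intros z Hz; now apply ex_derive_cdiff, Hhol).
    assert (Hfc : forall z, Cmod z <= R0 -> cont_in (fun w => Cmod w <= R0) f z).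
    { intros z Hz. now apply filterlim_cont_in, Hcont. }
    destruct (saddle_point b c R0 f HR Hb Hc Hexb Hexc Hexc2 Hmean Hdecay Hfd Hfc v0 eps Hv0 Heps) as [N0 HN0].
    exists N0. intros N v HN Hv. cbv zeta.
    destruct (Hrv v (proj1 Hv)) as [Hr Hrv1].
    destruct (Hsumr _ Hr) as [E1 E2]. rewrite E1 in Hrv1. rewrite E2, Hvalb, Hvalc by exact Hr.
    specialize (HN0 N v (rv v) HN Hv Hr). rewrite Hrv1, Rinv_r in HN0 by lra.
    specialize (HN0 eq_refl).
    rewrite (Rmult_assoc _ v).
    rewrite <- (taylor_ext (fun z => f z * Cexp (RtoC v * (gbar b z + RtoC (INR N) * gbar c z)))%C); [exact HN0|exact HR| |].
    + intros z Hz. unfold gcomplex. now rewrite !(Cpsum_gbar _ R0) by (assumption || lra).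
    + intros z Hz. now apply (F_cdiff b c R0 f).
  - assert (H1d : forall z, Cmod z < R0 -> cdiff (fun _ => 1%C) z) by (intros; apply cdiff_const).
    assert (H1c : forall z, Cmod z <= R0 -> cont_in (fun w => Cmod w <= R0) (fun _ => 1%C) z)
      by (intros; apply cont_in_const).
    assert (HR00 : 0 < R0 <= R0) by lra.
    destruct (Hsumr R0 HR00) as [_ Hvar].
    assert (HbR : forall g L, bval g R0 L R0 = L).
    { intros g L. unfold bval. destruct (Rlt_dec R0 R0); simpl; [lra|reflexivity]. }
    apply is_lim_seq_spec. intros eps.
    (* The case [f = 1], [v0 = 1]; then [v = 1] and [r = R0], where the mean is 1. *)
    destruct (saddle_point b c R0 (fun _ => 1%C) HR Hb Hc Hexb Hexc Hexc2 Hmean Hdecay H1d H1c 1 eps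
      (Rle_refl 1) (cond_pos eps)) as [N0 HN0].
    exists N0. intros N HN.
    specialize (HN0 N 1 R0 HN ltac:(lra) HR00 ltac:(rewrite Hmean; ring)).
    rewrite <- Hvar, <- Hvalb, <- Hvalc, !HbR, !Rmult_1_l in HN0 by exact HR00.
    set (T := taylor R0 _ N) in HN0.
    assert (HT : fst T = H_N theta kappa N).
    { apply taylor_exp_H_N; auto.
      - intros z Hz. now apply (F_cdiff b c R0 (fun _ => 1%C)).
      - intros x Hx. now apply ex_series_pow_le with R0; [| |lra].
      - intros x Hx. now apply ex_series_pow_le with R0; [| |lra].
      - intros x Hx. rewrite !gbar_real, Cmult_1_l, Cmult_1_l, <- RtoC_mult, <- RtoC_plus, Cexp_RtoC.
        f_equal. f_equal. rewrite PSeries_sum, <- Series_scal_l.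
        (* [x] may be negative, so the domination is by the powers of [|x|]. *)
        assert (Hxa : forall a, (forall n, 0 <= a n) -> ex_series (fun n => a n * R0 ^ n) -> ex_series (fun n => a n * x ^ n)).
        { intros a Ha Hex. apply ex_series_dominated with (fun n => a n * Rabs x ^ n).
          - intros n. rewrite Rabs_mult, RPow_abs, Rabs_pos_eq by apply Ha. lra.
          - apply ex_series_pow_le with R0; [exact Ha|exact Hex|]. split; [apply Rabs_pos|lra]. }
        rewrite <- Series_plus; [|now apply Hxa|].
        + apply Series_ext. intros n. rewrite gcoef_plus. fold b c. ring.
        + apply ex_series_scal_R. now apply Hxa. }
    (* The normalising factor is real, so the real part of the complex error is the error for
       [H_N]. *)
    eapply Rle_lt_trans; [|exact HN0].
    eapply Rle_trans; [|apply Rabs_fst_le_Cmod]. right. f_equal.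
    unfold Cminus, Cplus, Copp, Cmult, RtoC. cbn [fst snd]. rewrite HT.
    unfold Rdiv, Rminus. ring.
Qed.
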